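(* Consider the spatial functional linear regression model, the data, the matrices $\mathbf{X},\mathbf{Y},\mathbf{A}_m$, the estimator $\widehat{\boldsymbol{\beta}}$ and the semi-norm $\|\cdot\|_{\Gamma_{n,p}}$ described in the context. Assume: (i) $\beta$ is $m$-times differentiable and $\beta^{(m)}\in L^2([0,1])$; (ii) $\{\epsilon_{\mathbf{i}}\}_{\mathbf{i}\in\mathbb{Z}^d}$ is a strictly stationary random field, polynomially mixing, independent of $\{X_{\mathbf{i}}\}_{\mathbf{i}\in\mathbb{Z}^d}$, and $\sup_{\mathbf{i}\in\mathbb{Z}^d}|\epsilon_{\mathbf{i}}|<M_1$ almost surely for some constant $M_1>0$; (iii) $\{(X_{\mathbf{i}},Y_{\mathbf{i}})\}_{\mathbf{i}\in\mathbb{Z}^d}$ is a strictly stationary and polynomially mixing random field; (iv) there is $M_2>0$ such that $\|X_{\mathbf{i}}\|<M_2$ almost surely for all $\mathbf{i}\in\mathbb{Z}^d$; (v) the mixing coefficients in (ii) and (iii) satisfy $\alpha_{1,\infty}(u)=O(u^{-\theta})$ with $\theta>d$. Then there are constants $c>0$ and $C_0>0$, not depending on $n,p,\rho$, such that for all $\rho>n^{-2md}$ the following holds. If the eigenvalues $\lambda_{x,1}\ge\lambda_{x,2}\ge\dots\ge\lambda_{x,p}\ge 0$ of $\frac{1}{n^dp}\mathbf{X}^T\mathbf{X}$ satisfy $$\sum_{j=r+1}^{p}\lambda_{x,j}\le C\, r^{-2q}\quad\text{with } C>0,\ q>0,\ r:=\lfloor \rho^{-1/(2m+2q+1)}\rfloor,$$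 then $$\mathbb{E}_{\epsilon}\left(\|\widehat{\boldsymbol{\beta}}-\mathbb{E}_{\epsilon}(\widehat{\boldsymbol{\beta}})\|^{2}_{\Gamma_{n,p}}\right)\le\left(\frac{\sigma_\epsilon^2}{n^d}+\frac{c\ln n}{n^d}\right)\left(m+\lfloor\rho^{-1/(2m+2q+1)}\rfloor\,(2+C\,C_0)\right).$$
   Context: Model: $d\ge1$, $Y_{\mathbf{i}}=\beta_0+\int_0^1\beta(t)X_{\mathbf{i}}(t)\,dt+\epsilon_{\mathbf{i}}$, $\mathbf{i}\in\mathbb{Z}^d$, where $Y_{\mathbf{i}}$ is real-valued, $X_{\mathbf{i}}$ is a square integrable random function on $I=[0,1]$, $\beta_0$ is a constant, $\beta$ is the unknown slope function, and $(\epsilon_{\mathbf{i}})$ is a centered random field with variance $\sigma_\epsilon^2>0$. All $(X_{\mathbf{i}},Y_{\mathbf{i}})$ have the same distribution as a pair $(X,Y)$. $\|\cdot\|$ and $\langle\cdot,\cdot\rangle$ are the usual norm and inner product of $L^2([0,1])$. Data: for $n\in\mathbb{N}^*$, the sites of $\{1,\dots,n\}^d$ are listed in lexicographic order as $\mathbf{i}_1,\dots,\mathbf{i}_{n^d}$; $(X_{\mathbf{i}_i},Y_{\mathbf{i}_i})$, $1\le i\le n^d$, are observed, each $X_{\mathbf{i}_i}$ at the points $t_j=j/p$, $j=1,\dots,p$. Set $\overline{Y}=n^{-d}\sum_i Y_{\mathbf{i}_i}$, $\overline{X}=n^{-d}\sum_iX_{\mathbf{i}_i}$, $\mathbf{Y}=(Y_{\mathbf{i}_1}-\overline{Y},\dots,Y_{\mathbf{i}_{n^d}}-\overline{Y})^T$,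 and let $\mathbf{X}$ be the $n^d\times p$ matrix with $(i,j)$ entry $X_{\mathbf{i}_i}(t_j)-\overline{X}(t_j)$. Estimator: let $m\ge1$ be an integer, and let $D_1,\dots,D_p$ be a basis of the $p$-dimensional space $NS^m(t_1,\dots,t_p)$ of natural splines of order $2m$ with knots $t_1,\dots,t_p$. Put $\mathbf{D}(t)=(D_1(t),\dots,D_p(t))^T$, and let $\mathbf{D}$ be the $p\times p$ matrix with $(j,i)$ entry $D_i(t_j)$. Let $\mathbf{P}_m$ be the orthogonal projection matrix of $\mathbb{R}^p$ onto $\{(\sum_{l=1}^m\theta_l t_j^{l-1})_{1\le j\le p}:\theta\in\mathbb{R}^m\}$, and $$\mathbf{A}_m=\mathbf{P}_m+p\,\mathbf{D}(\mathbf{D}^T\mathbf{D})^{-1}\Big[\int_0^1\mathbf{D}^{(m)}(t)\mathbf{D}^{(m)}(t)^T\,dt\Big](\mathbf{D}^T\mathbf{D})^{-1}\mathbf{D}^T .$$ For a smoothing parameter $\rho>0$, $$\widehat{\boldsymbol{\beta}}=\frac1{n^d}\Big(\frac1{n^dp}\mathbf{X}^T\mathbf{X}+\rho\mathbf{A}_m\Big)^{-1}\mathbf{X}^T\mathbf{Y}.$$ Semi-norm: for $\mathbf{u}\in\mathbb{R}^p$, $\|\mathbf{u}\|_{\Gamma_{n,p}}^2=\frac1p\mathbf{u}^T\big(\frac1{n^dp}\mathbf{X}^T\mathbf{X}\big)\mathbf{u}$. $\mathbb{E}_\epsilon$ is the conditional expectation given $X_{\mathbf{i}_1},\dots,X_{\mathbf{i}_{n^d}}$.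 $\lfloor x\rfloor$ is the integer part of $x$. Mixing: for sub-$\sigma$-algebras $\mathcal{U},\mathcal{V}$, $\alpha(\mathcal{U},\mathcal{V})=\sup\{|\mathbb{P}(A\cap B)-\mathbb{P}(A)\mathbb{P}(B)|:A\in\mathcal{U},B\in\mathcal{V}\}$. For a random field $(Z_{\mathbf{i}})_{\mathbf{i}\in\mathbb{Z}^d}$, $$\alpha_{1,\infty}(u)=\sup\{\alpha(\sigma(Z_{\mathbf{i}}),\sigma(Z_{\mathbf{j}};\mathbf{j}\in\Lambda)):\mathbf{i}\in\mathbb{Z}^d,\ \Lambda\subset\mathbb{Z}^d,\ \delta(\Lambda,\{\mathbf{i}\})\ge u\},$$ where $\delta(\Gamma_1,\Gamma_2)=\min\{\|\mathbf{i}-\mathbf{j}\|_2:\mathbf{i}\in\Gamma_1,\mathbf{j}\in\Gamma_2\}$ with $\|\cdot\|_2$ the Euclidean norm. The field is polynomially mixing if $\alpha_{1,\infty}(u)=O(u^{-\theta})$ for some $\theta>0$. *)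

(* Defs.v *)
From HB Require Import structures.
From mathcomp Require Import all_boot all_order all_algebra.
From mathcomp Require Import all_classical all_reals all_analysis.
Set Implicit Arguments.
Unset Strict Implicit.
Unset Printing Implicit Defensive.
Import Order.TTheory GRing.Theory Num.Theory.
Import numFieldNormedType.Exports.
Local Open Scope classical_set_scope.
Local Open Scope ring_scope.

Section FunctionsOnUnitInterval.
Variable R : realType.
Implicit Types f g x : R -> R.

(* A function on [0,1] is represented by any extension of it to R; only its
   values on [0,1] are ever used. *)
Definition I01 : set R := `[0, 1]%classic.

Definition inL2 x := x \_ I01 \in Lfun (@lebesgue_measure R) 2%:E.

Definition normL2 x : \bar R :=
  Lnorm (@lebesgue_measure R) 2%:E (EFin \o (x \_ I01)).

Definition innerL2 x f : R := \int[@lebesgue_measure R]_(t in I01) (x t * f t).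

(* g is the derivative of f on [0,1], one-sided at the endpoints. *)
Definition deriv_on01 f g := forall t, I01 t ->
  (fun s => (f s - f t) / (s - t)) @ within I01 t^' --> g t.

Fixpoint nderiv_on01 (m : nat) f g : Prop :=
  if m is k.+1 then exists2 f1, deriv_on01 f f1 & nderiv_on01 k f1 g
  else {in I01, f =1 g}.

(* The events about a random function x which are observable through its values
   x(t), t in [0,1], and through its inner products with elements of L^2. *)
Definition ranfun_gen : set (set (R -> R)) :=
  [set A | exists t B, [/\ I01 t, measurable B & A = [set x | B (x t)]]] `|`
  [set A | exists f B, [/\ inL2 f, measurable B
                         & A = [set x | B (innerL2 x f)]]].

End FunctionsOnUnitInterval.

Notation ranfun R := (g_sigma_algebraType (@ranfun_gen R)).

Section RandomFields.
Context (R : realType) (dO : measure_display) (Omega : measurableType dO).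
Variable P : probability Omega R.

Definition sigma_of (I : Type) (dS : measure_display) (S : measurableType dS)
    (Z : I -> Omega -> S) (L : set I) : set (set Omega) :=
  <<s \bigcup_(i in L) g_sigma_algebra_preimage (Z i) >>.

Definition indep_sigma (U V : set (set Omega)) :=
  forall A B, U A -> V B -> P (A `&` B) = (P A * P B)%E.

Definition alpha_mixing (U V : set (set Omega)) : \bar R :=
  ereal_sup [set (`|P (A `&` B) - P A * P B|)%E | A in U & B in V].

Definition is_cond_exp (G : set (set Omega)) (f g : Omega -> R) :=
  [/\ forall B, measurable B -> G (g @^-1` B),
      P.-integrable setT (EFin \o g)
    & forall A, G A ->
        (\int[P]_(w in A) (g w)%:E = \int[P]_(w in A) (f w)%:E)%E].

(* One version, which exists for integrable f when G is a sub-sigma-algebra and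
   is unique up to a P-null set. *)
Definition cond_exp (G : set (set Omega)) (f : Omega -> R) : Omega -> R :=
  xget (cst 0) [set g | is_cond_exp G f g].

Section Zd.
Variable d : nat.
Notation site := 'rV[int]_d.

Definition dist_site (i j : site) : R :=
  Num.sqrt (\sum_(k < d) ((i 0 k - j 0 k)%:~R) ^+ 2).

Definition dist_sets (L1 L2 : set site) : \bar R :=
  ereal_inf [set (dist_site i j)%:E | i in L1 & j in L2].

Context (dS : measure_display) (S : measurableType dS).
Variable Z : site -> Omega -> S.

Definition strictly_stationary :=
  forall (k : nat) (s : k.-tuple site) (h : site) (A : set (k.-tuple S)),
    measurable A ->
    P [set w | A [tuple Z (tnth s l + h) w | l < k]] =
    P [set w | A [tuple Z (tnth s l) w | l < k]].

Definition alpha_1oo (u : R) : \bar R :=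
  ereal_sup [set a | exists i L, (u%:E <= dist_sets L [set i])%E /\
    a = alpha_mixing (sigma_of Z [set i]) (sigma_of Z L)].

Definition polynomially_mixing (theta : R) :=
  exists K : R, \forall u \near +oo_R,
    (alpha_1oo u <= (K * u `^ (- theta))%:E)%E.

End Zd.
End RandomFields.

Section Splines.
Variable R : realType.

Definition design_pt (p j : nat) : R := j%:R / p%:R.

Definition agrees_with_poly (k : nat) (D : set R) (s : R -> R) :=
  exists2 q : {poly R}, (size q <= k)%N & forall x, D x -> s x = q.[x].

(* NS^m(t_1, ..., t_p), the natural splines of order 2m with knots t_j = j / p,
   as functions on R: the boundary condition at t_p = 1 is about t >= 1. *)
Definition natural_spline (m p : nat) : set (R -> R) :=
  [set s |
    [/\ (forall k, (k < 2 * m - 2)%N -> forall x, derivable (derive1n k s) x 1),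
        continuous (derive1n (2 * m - 2) s),
        (forall j, (1 <= j < p)%N -> agrees_with_poly (2 * m)
          `[design_pt p j, design_pt p j.+1]%classic s),
        agrees_with_poly m `]-oo, design_pt p 1]%classic s
      & agrees_with_poly m `[design_pt p p, +oo[%classic s]].

Definition is_basis (p : nat) (E : set (R -> R)) (D : 'I_p -> R -> R) :=
  (forall i, E (D i)) /\
  forall s, E s -> exists! a : {ffun 'I_p -> R},
    s = (fun x => \sum_(i < p) a i * D i x).

Definition is_orth_proj (p : nat) (E : set 'cV[R]_p) (Q : 'M[R]_p) :=
  forall u, E (Q *m u) /\ forall v, E v -> v^T *m (u - Q *m u) = 0.

(* The index j : 'I_p stands for j + 1, so that D_i(t_(j+1)) is D i at
   design_pt p j.+1. *)
Definition poly_vectors (m p : nat) : set 'cV[R]_p :=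
  [set u | exists theta : 'I_m -> R,
     u = \col_(j < p) \sum_(l < m) theta l * design_pt p j.+1 ^+ l].

Definition spline_mx (p : nat) (D : 'I_p -> R -> R) : 'M[R]_p :=
  \matrix_(j < p, i < p) D i (design_pt p j.+1).

Definition roughness_mx (m p : nat) (D : 'I_p -> R -> R) : 'M[R]_p :=
  \matrix_(i < p, k < p)
    \int[@lebesgue_measure R]_(t in @I01 R) (derive1n m (D i) t * derive1n m (D k) t).

Definition penalty_mx (m p : nat) (Pm : 'M[R]_p) (D : 'I_p -> R -> R) :
    'M[R]_p :=
  let DD := spline_mx D in
  Pm + p%:R *: (DD *m invmx (DD^T *m DD) *m roughness_mx m D
                *m invmx (DD^T *m DD) *m DD^T).

(* The eigenvalues are counted with multiplicity; size lam = p follows. *)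
Definition ordered_eigenvalues (p : nat) (M : 'M[R]_p) (lam : seq R) :=
  sorted >=%R lam /\ char_poly M = \prod_(l <- lam) ('X - l%:P).

End Splines.

Arguments poly_vectors : clear implicits.

Section Estimator.
Context (R : realType) (Omega : Type) (d : nat).
Notation site := 'rV[int]_d.
Variables (X : site -> Omega -> R -> R) (Y : site -> Omega -> R).

(* The sites of {1..n}^d in lexicographic order: the coordinates of the i-th one
   are 1 plus the base-n digits of i, most significant digit first. *)
Definition grid_site (n : nat) (i : 'I_(n ^ d)) : site :=
  \row_(k < d) ((i %/ n ^ (d - k.+1)) %% n).+1%:Z.

Definition Xmx (n p : nat) (w : Omega) : 'M[R]_(n ^ d, p) :=
  \matrix_(i < n ^ d, j < p)
    (X (grid_site i) w (design_pt R p j.+1)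
     - (n ^ d)%:R^-1 * \sum_(k < n ^ d) X (grid_site k) w (design_pt R p j.+1)).

Definition Yvec (n : nat) (w : Omega) : 'cV[R]_(n ^ d) :=
  \col_(i < n ^ d)
    (Y (grid_site i) w - (n ^ d)%:R^-1 * \sum_(k < n ^ d) Y (grid_site k) w).

Definition gram (n p : nat) (w : Omega) : 'M[R]_p :=
  (n ^ d * p)%:R^-1 *: ((Xmx n p w)^T *m Xmx n p w).

Definition beta_hat (n p : nat) (A : 'M[R]_p) (rho : R) (w : Omega) :
    'cV[R]_p :=
  (n ^ d)%:R^-1 *:
    (invmx (gram n p w + rho *: A) *m (Xmx n p w)^T *m Yvec n w).

Definition sqnorm_Gamma (n p : nat) (w : Omega) (u : 'cV[R]_p) : R :=
  p%:R^-1 * (u^T *m gram n p w *m u) 0 0.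

End Estimator.

(* Main.v *)
Require Import Defs.
From HB Require Import structures.
From mathcomp Require Import all_boot all_order all_algebra.
From mathcomp Require Import all_classical all_reals all_analysis.
From mathcomp Require Import measurable_realfun.
From mathcomp Require Import ring lra.
From mathcomp Require Import zify.
Set Implicit Arguments.
Unset Strict Implicit.
Unset Printing Implicit Defensive.
Import Order.TTheory GRing.Theory Num.Theory.
Import numFieldNormedType.Exports.
Local Open Scope classical_set_scope.
Local Open Scope ring_scope.

(** Write [N = n ^ d], [M = X^T X / (N p)] and [H = (M + rho A)^-1 X^T].  The
    columns of [X] sum to zero, so centring the responses is immaterial and, the
    predictors being fixed, [bhat - E bhat = H eps / N].  Its squared semi-norm is
    a quadratic form [eps^T B eps] whose matrix depends on the predictors only, and
    the errors are independent of the predictors: the conditional expectation is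
    [tr (B Sigma)], where [Sigma] is the covariance matrix of the errors at the
    [N] sites ([conditional_variance]).

    As [B] is positive semidefinite, [tr (B Sigma)] is at most [tr B] times the
    largest absolute row sum of [Sigma] ([mxtrace_row_sum_le]).  The covariance
    inequality for bounded mixing variables ([covariance_inequality]) bounds an
    entry of [Sigma] by a multiple of [(1 + dist)^-theta]; this decay is dominated
    by a product over the coordinates, and [theta > d] makes each factor summable.
    Row sums are therefore at most [sigma^2] plus a constant, and the constant
    is at most a multiple of [ln n] when [n >= 2], while for [n = 1] there is
    only one site ([covariance_row_sums]).

    Up to the factor [1 / N], [tr B] is [tr (V M V M) <= tr (V M)] with
    [V = (M + rho A)^-1].  On the subspace [W] cut out by [k] linear conditions,
    the trace of [V M] loses at most [k] ([mxtrace_invmx_restrict]).  Take for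
    [W] the vectors orthogonal to the [r] leading eigenvectors of [M] and subject
    to [m + r] conditions that make [A] large; this leaves
    [m + 2 r + tail / (rho kappa)], where [kappa] is the lower bound of [A] on [W],
    and the value of [r] balances the last term ([mxtrace_smoothing]).

    That [kappa] can be taken of order [r^(2 m)], uniformly in the number [p] of
    knots, is the spline part.  The penalty of a vector [u] contains [p] times the
    energy (the integral of the squared [m]-th derivative) of the natural spline
    interpolating [u] ([penalty_energy]).  Impose [u = 0] at the first [m] knots of
    each of about [r / m] blocks of consecutive knots.  In a block of length [h]
    the interpolating spline has [m] zeros, so by Rolle's theorem it is bounded by
    [h^(2 m - 1)] times its energy in the block; summing over the knots gives the
    bound ([sampled_spline_le_energy], [penalty_lower_bound]).

    On each piece a natural spline is a polynomial [q] with [q^(2 m) = 0], and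
    repeated integration by parts gives an explicit polynomial primitive [green] of
    the squared [m]-th derivative.  All statements on the energy, such as the
    uniqueness of spline interpolation ([spline_mx_unit]), are proved with these
    primitives. *)

(** * Positive semidefinite matrices *)

Section QuadraticForms.
Variable R : rcfType.

Definition qform n (S : 'M[R]_n) (u : 'rV_n) : R := (u *m S *m u^T) 0 0.

Definition psdmx n (S : 'M[R]_n) := S^T = S /\ forall u, 0 <= qform S u.

Lemma qformE n (S : 'M[R]_n) u :
  qform S u = \sum_i \sum_j u 0 i * S i j * u 0 j.
Proof.
rewrite /qform mxE exchange_big /=; apply: eq_bigr => j _.
by rewrite mxE mulr_suml; apply: eq_bigr => i _; rewrite !mxE.
Qed.

Lemma qform1 n (u : 'rV[R]_n) : qform 1%:M u = \sum_i u 0 i ^+ 2.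
Proof.
by rewrite /qform mulmx1 mxE; apply: eq_bigr => i _; rewrite !mxE expr2.
Qed.

Lemma qformD n (S T : 'M[R]_n) u : qform (S + T) u = qform S u + qform T u.
Proof. by rewrite /qform mulmxDr mulmxDl mxE. Qed.

Lemma qformB n (S T : 'M[R]_n) u : qform (S - T) u = qform S u - qform T u.
Proof. by rewrite /qform mulmxBr mulmxBl !mxE. Qed.

Lemma qformZ n (S : 'M[R]_n) a u : qform (a *: S) u = a * qform S u.
Proof. by rewrite /qform -scalemxAr -scalemxAl mxE. Qed.

Lemma qform_mul n k (S : 'M[R]_k) (G : 'M[R]_(k, n)) u :
  qform (G^T *m S *m G) u = qform S (u *m G^T).
Proof. by rewrite /qform trmx_mul trmxK !mulmxA. Qed.

Lemma qform1_ge0 n (u : 'rV[R]_n) : 0 <= qform 1%:M u.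
Proof. by rewrite qform1; apply: sumr_ge0 => i _; rewrite sqr_ge0. Qed.

Lemma qform1_eq0 n (u : 'rV[R]_n) : qform 1%:M u = 0 -> u = 0.
Proof.
rewrite qform1 => /eqP; rewrite psumr_eq0; last by move=> i _; rewrite sqr_ge0.
move=> /allP h; apply/rowP => i; rewrite mxE.
by have := h i (mem_index_enum i); rewrite sqrf_eq0 => /eqP.
Qed.

Lemma psdmx_gram n k (G : 'M[R]_(k, n)) : psdmx (G^T *m G).
Proof.
split; first by rewrite trmx_mul trmxK.
by move=> u; rewrite -(mulmx1 G^T) qform_mul qform1_ge0.
Qed.

Lemma psdmxD n (S T : 'M[R]_n) : psdmx S -> psdmx T -> psdmx (S + T).
Proof.
move=> [sS pS] [sT pT]; split; first by rewrite linearD /= sS sT.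
by move=> u; rewrite qformD addr_ge0.
Qed.

Lemma psdmxZ n (S : 'M[R]_n) a : 0 <= a -> psdmx S -> psdmx (a *: S).
Proof.
move=> a0 [sS pS]; split; first by rewrite linearZ /= sS.
by move=> u; rewrite qformZ mulr_ge0.
Qed.

Lemma psdmx_mul n k (S : 'M[R]_k) (G : 'M[R]_(k, n)) :
  psdmx S -> psdmx (G^T *m S *m G).
Proof.
move=> [sS pS]; split; first by rewrite !trmx_mul trmxK sS mulmxA.
by move=> u; rewrite qform_mul.
Qed.

Lemma trmx11 (Z : 'M[R]_1) : Z^T = Z.
Proof. by rewrite (mx11_scalar Z) tr_scalar_mx. Qed.

Lemma qform_block n (a : R) (b : 'rV[R]_n) (S : 'M[R]_n) x (y : 'rV_n) :
  qform (block_mx a%:M b b^T S) (row_mx (x%:M : 'M[R]_1) y) =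
  a * x ^+ 2 + 2 * x * (b *m y^T) 0 0 + qform S y.
Proof.
rewrite /qform mul_row_block tr_row_mx mul_row_col mulmxDl mulmxDl tr_scalar_mx.
rewrite -!scalar_mxM.
have -> : y *m b^T *m x%:M = x *: (b *m y^T) :> 'M[R]_1.
  by rewrite mul_mx_scalar -[y *m b^T]trmx11 trmx_mul trmxK.
rewrite mul_scalar_mx -scalemxAl !mxE mulr1n; ring.
Qed.

(** Completing the square eliminates one variable from the form; when its pivot
    vanishes, positivity along a line forces the whole row to vanish. *)
Lemma psdmx_factor n (S : 'M[R]_n) : psdmx S -> exists G : 'M[R]_n, S = G^T *m G.
Proof.
elim: n => [|n IH] in S *.
  by move=> _; exists 0; rewrite [S]flatmx0 trmx0 mul0mx.
move: S; rewrite -[n.+1]/(1 + n)%N => S [sS pS].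
pose a := ulsubmx S 0 0; pose b := ursubmx S; pose S' := drsubmx S.
have eS : S = block_mx a%:M b b^T S'.
  rewrite -[LHS]submxK; congr block_mx; first by rewrite -mx11_scalar.
  by rewrite /b trmx_ursub sS.
have sS' : S'^T = S' by rewrite /S' trmx_drsub sS.
have q x y : 0 <= a * x ^+ 2 + 2 * x * (b *m y^T) 0 0 + qform S' y.
  by rewrite -qform_block -eS.
have a0 : 0 <= a.
  by have := q 1 0; rewrite /qform trmx0 !mulmx0 !mxE; nra.
have [aE|an0] := eqVneq a 0.
  have b0 : b = 0.
    apply: qform1_eq0; rewrite /qform mulmx1; apply/eqP.
    set t := _ 0 0; have t0 : 0 <= t by have := qform1_ge0 b; rewrite /qform mulmx1.
    apply: contraT => tn0; pose c := qform S' b.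
    have c0 : 0 <= c by have := q 0 b; rewrite -/c; nra.
    have := q (- (c + 1) / t) b; rewrite -/t -/c aE.
    have -> : 2 * (- (c + 1) / t) * t = - 2 * (c + 1) by field.
    nra.
  have [|G eG] := IH S'.
    by split=> // u; have := q 0 u; nra.
  exists (block_mx (0 : 'M[R]_1) 0 0 G).
  rewrite tr_block_mx mulmx_block eS b0 aE eG !trmx0 !mul0mx !mulmx0 !add0r.
  by rewrite -scalemx1 scale0r.
have agt : 0 < a by rewrite lt_def an0.
have [|G eG] := IH (S' - a^-1 *: (b^T *m b)).
  split; first by rewrite linearB linearZ /= trmx_mul trmxK sS'.
  move=> u; rewrite qformB qformZ -[b^T]mulmx1 qform_mul {2}/qform mulmx1.
  rewrite trmx_mul trmxK.
  have -> : u *m b^T *m (b *m u^T) = ((b *m u^T) 0 0 ^+ 2)%:M.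
    rewrite -[u *m b^T]trmx11 trmx_mul trmxK [b *m u^T]mx11_scalar.
    by rewrite -scalar_mxM expr2 !mxE mulr1n.
  rewrite [_ 0 0]mxE mulr1n.
  have := q (- (b *m u^T) 0 0 / a) u; set t := (b *m u^T) 0 0.
  have -> : a * (- t / a) ^+ 2 + 2 * (- t / a) * t + qform S' u =
    qform S' u - a^-1 * t ^+ 2 by field.
  by [].
pose s := Num.sqrt a.
have ss : s * s = a by rewrite -expr2 sqr_sqrtr.
have sn0 : s != 0 by apply: contraNneq an0 => s0; rewrite -ss s0 mulr0.
exists (block_mx (s%:M : 'M[R]_1) (s^-1 *: b) 0 G).
rewrite tr_block_mx mulmx_block eS -eG !trmx0 !mul0mx !mulmx0 !addr0.
rewrite tr_scalar_mx -scalar_mxM ss mul_scalar_mx scalerA divff // scale1r.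
rewrite linearZ /= -scalemxAl mul_mx_scalar scalerA mulVf // scale1r.
rewrite -scalemxAl -scalemxAr scalerA -invfM ss.
by rewrite addrC subrK.
Qed.

Lemma mxtrace_gram_ge0 n k (G : 'M[R]_(k, n)) : 0 <= \tr (G^T *m G).
Proof.
rewrite /mxtrace; apply: sumr_ge0 => i _; rewrite mxE; apply: sumr_ge0 => j _.
by rewrite mxE -expr2 sqr_ge0.
Qed.

(** With both factorizations, the trace is the sum of the squared entries of a
    product. *)
Lemma mxtrace_psdmx_ge0 n (S T : 'M[R]_n) :
  psdmx S -> psdmx T -> 0 <= \tr (S *m T).
Proof.
move=> /psdmx_factor[G ->] /psdmx_factor[K ->].
rewrite mulmxA mxtrace_mulC.
have -> : K *m (G^T *m G *m K^T) = (G *m K^T)^T *m (G *m K^T).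
  by rewrite trmx_mul trmxK !mulmxA.
exact: mxtrace_gram_ge0.
Qed.
End QuadraticForms.
(** * Trace of a resolvent on a subspace *)

Section TraceBounds.
Variable R : rcfType.
Local Notation qform := (@qform R _).

Lemma definite_unitmx n (S : 'M[R]_n) :
  (forall u, qform S u = 0 -> u = 0) -> S \in unitmx.
Proof.
move=> dS; rewrite -row_free_unit -kermx_eq0; apply/rowV0P => u /sub_kermxP uS.
by apply: dS; rewrite /qform uS mul0mx mxE.
Qed.

Lemma psdmx_inv n (S : 'M[R]_n) :
  psdmx S -> S \in unitmx -> psdmx (invmx S).
Proof.
move=> pS uS; have -> : invmx S = (invmx S)^T *m S *m invmx S.
  by rewrite trmx_inv (proj1 pS) mulVmx // mul1mx.
exact: psdmx_mul.
Qed.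

(** The [S]-orthogonal projection onto the kernel [W] of [Cc] splits the inverse
    of [S] into the inverse of [S] restricted to [W] and a remainder [Z].  The
    remainder satisfies [Z S Z = Z] and [tr (Z S) = codim W], so that
    [tr (Z M) <= tr (Z S)] costs one unit per condition, whereas the inverse of
    the restriction to [W] is at most [eta^-1]. *)
Lemma mxtrace_invmx_restrict p l (S M M2 : 'M[R]_p) (Cc : 'M[R]_(p, l)) eta :
  psdmx M -> psdmx (S - M) -> (forall u, qform S u = 0 -> u = 0) ->
  psdmx M2 -> (forall u : 'rV_p, u *m Cc = 0 -> u *m M = u *m M2) ->
  0 < eta ->
  (forall u, u *m Cc = 0 -> eta * qform 1%:M u <= qform S u) ->
  \tr (invmx S *m M) <= (\rank Cc)%:R + eta^-1 * \tr M2.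
Proof.
move=> pM pSM dS pM2 MM2 eta0 etaS.
have pS : psdmx S by rewrite -(subrK M S); exact: psdmxD.
have uS := definite_unitmx dS.
have w_eq : (\rank (kermx Cc) = p - \rank Cc)%N by rewrite mxrank_ker.
move: (row_base_free (kermx Cc)) (eq_row_base (kermx Cc)).
move: (row_base (kermx Cc)); move: (\rank (kermx Cc)) w_eq => w w_eq F Ffree eF.
have FC : F *m Cc = 0 by apply/sub_kermxP; rewrite eF.
pose SW := F *m S *m F^T.
have uSW : SW \in unitmx.
  apply: definite_unitmx => v; rewrite /SW -{1}[F]trmxK qform_mul trmxK => /dS.
  by move/eqP; rewrite mulmx_free_eq0 // => /eqP.
have pSW : psdmx SW by rewrite /SW -{1}[F]trmxK; exact: psdmx_mul.
pose ZW := F^T *m invmx SW *m F; pose Z := invmx S - ZW.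
have pZW : psdmx ZW by apply: psdmx_mul; exact: psdmx_inv.
have ZWSZW : ZW *m S *m ZW = ZW.
  rewrite /ZW !mulmxA; congr (_ *m _).
  rewrite -!mulmxA; congr (_ *m _).
  by rewrite (mulmxA F) (mulmxA _ F^T) -/SW mulmxA mulVmx // mul1mx.
have pZ : psdmx Z.
  have sZ : Z^T = Z by rewrite /Z linearB /= (proj1 pZW) trmx_inv (proj1 pS).
  have -> : Z = Z^T *m S *m Z.
    rewrite sZ {2}/Z mulmxBl mulVmx // mulmxBl mul1mx {3}/Z mulmxBr ZWSZW.
    by rewrite -mulmxA mulmxV // mulmx1 subrr subr0.
  exact: psdmx_mul.
have -> : invmx S = Z + ZW by rewrite /Z subrK.
rewrite mulmxDl mxtraceD lerD //.
  have -> : (\rank Cc)%:R = \tr (Z *m S).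
    rewrite /Z mulmxBl mulVmx // linearB /= mxtrace1 /ZW -!mulmxA mxtrace_mulC.
    rewrite -!mulmxA (mulmxA F) -/SW mulVmx // mxtrace1 w_eq natrB ?rank_leq_row //.
    by rewrite opprB addrCA subrr addr0.
  rewrite -subr_ge0 -linearB -mulmxBr; exact: mxtrace_psdmx_ge0.
have -> : ZW *m M = ZW *m M2.
  rewrite /ZW -!mulmxA; congr (_ *m (_ *m _)).
  apply/row_matrixP => i; rewrite !row_mul; apply: MM2.
  by rewrite -row_mul FC row0.
have pD : psdmx (eta^-1%:M - ZW).
  split; first by rewrite linearB /= tr_scalar_mx (proj1 pZW).
  move=> u; rewrite -scalemx1 qformB qformZ.
  pose y := u *m ZW.
  have yC : y *m Cc = 0 by rewrite /y /ZW !mulmxA -mulmxA FC mulmx0.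
  have qy : qform S y = qform ZW u.
    by rewrite /y -{1}(proj1 pZW) -qform_mul (proj1 pZW) ZWSZW.
  have := etaS y yC; rewrite qy.
  have : qform 1%:M (u - eta *: y) =
      qform 1%:M u - 2 * eta * qform ZW u + eta ^+ 2 * qform 1%:M y.
    have uy : qform ZW u = \sum_i u 0 i * y 0 i.
      rewrite /qform -/y mxE; apply: eq_bigr => i _; rewrite [u^T _ _]mxE.
      exact: mulrC.
    rewrite uy !qform1 !mulr_sumr -sumrB -big_split /=; apply: eq_bigr => i _.
    by rewrite !mxE; ring.
  have := qform1_ge0 (u - eta *: y).
  set a := qform _ u; set b := qform _ u; set c := qform _ y.
  move=> h e he; rewrite e in h.
  have h2 : eta * b <= a by nra.
  by rewrite subr_ge0 mulrC ler_pdivlMr // mulrC.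
have := mxtrace_psdmx_ge0 pD pM2.
by rewrite mulmxBl linearB /= mul_scalar_mx linearZ /= subr_ge0.
Qed.
End TraceBounds.
(** * Spectral theorem for symmetric matrices with split characteristic polynomial *)

Section Spectral.
Variable R : rcfType.
Local Notation qform := (@qform R _).

(** The reflection in the hyperplane orthogonal to [v - e_1] exchanges the unit
    vectors [v] and [e_1]. *)
Lemma householder n (v : 'rV[R]_(1 + n)) : qform 1%:M v = 1 ->
  exists H : 'M[R]_(1 + n),
    [/\ H^T = H, H *m H = 1%:M & v *m H = row_mx 1%:M 0].
Proof.
move=> v1; set e := row_mx 1%:M 0.
have [ve|vne] := eqVneq v e.
  by exists 1%:M; split; rewrite ?trmx1 ?mulmx1.
have [w wE] : exists w, w = v - e by exists (v - e).
pose c := qform 1%:M w.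
have cE : c = (w *m w^T) 0 0 by rewrite /c /qform mulmx1.
have c0 : c != 0 by apply: contraNneq vne => /qform1_eq0/eqP; rewrite wE subr_eq0.
have ww : w *m w^T = c%:M by rewrite [LHS]mx11_scalar -cE.
have e1 : e *m e^T = 1%:M.
  by rewrite /e tr_row_mx mul_row_col mul0mx addr0 trmx1 mulmx1.
have vv : v *m v^T = 1%:M by rewrite [LHS]mx11_scalar -v1 /qform mulmx1.
have ev : e *m v^T = v *m e^T by rewrite -[LHS]trmx11 trmx_mul trmxK.
have vw : v *m w^T = (c / 2)%:M.
  have : c%:M = 2 *: (v *m w^T).
    rewrite -ww wE linearB /= !mulmxBl !mulmxBr vv e1 ev.
    by rewrite scaler_nat mulr2n opprB.
  move=> /(congr1 (fun Z => 2^-1 *: Z)); rewrite scalerA mulVf ?pnatr_eq0 //.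
  by rewrite scale1r => <-; rewrite scale_scalar_mx mulrC.
exists (1%:M - (2 / c) *: (w^T *m w)); split.
- by rewrite linearB linearZ /= trmx1 trmx_mul trmxK.
- have WW : w^T *m w *m (w^T *m w) = c *: (w^T *m w).
    by rewrite mulmxA -(mulmxA _ w) ww mul_mx_scalar -scalemxAl.
  move: (w^T *m w) WW => W WW.
  rewrite mulmxBl mul1mx mulmxBr mulmx1 -!scalemxAr -!scalemxAl WW !scalerA.
  have -> : 2 / c * (2 / c) * c = 2 / c + 2 / c by field.
  by rewrite scalerDl opprB addrK subrK.
- rewrite mulmxBr mulmx1 -scalemxAr mulmxA vw mul_scalar_mx scalerA.
  have -> : 2 / c * (c / 2) = 1 by field.
  by rewrite scale1r wE opprB addrCA subrr addr0.
Qed.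

Lemma char_poly_similar n (M H : 'M[R]_n) :
  H *m H = 1%:M -> char_poly (H *m M *m H) = char_poly M.
Proof.
move=> HH; rewrite /char_poly /char_poly_mx.
pose K := map_mx polyC H.
have KK : K *m K = 1%:M by rewrite -map_mxM HH map_mx1.
have -> : 'X%:M - map_mx polyC (H *m M *m H) =
  K *m ('X%:M - map_mx polyC M) *m K.
  rewrite mulmxBr mulmxBl -!map_mxM; congr (_ - _).
  by rewrite scalar_mxC -mulmxA KK mulmx1.
by rewrite !det_mulmx mulrAC -det_mulmx KK det1 mul1r.
Qed.

Lemma char_poly_block n (l : R) (M : 'M[R]_n) :
  char_poly (block_mx (l%:M : 'M[R]_1) 0 0 M) = ('X - l%:P) * char_poly M.
Proof.
rewrite /char_poly /char_poly_mx map_block_mx !map_mx0 scalar_mx_block.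
rewrite opp_block_mx add_block_mx !subr0 det_ublock; congr (_ * _).
by rewrite map_scalar_mx det_mx11 !mxE.
Qed.

(** Deflation: a Householder reflection moves a unit eigenvector to [e_1], and
    symmetry then makes the conjugate matrix block diagonal.  The eigenvalues are
    given by the factorization, so no algebraic closure is involved. *)
Lemma symmetric_spectral n (M : 'M[R]_n) lam : M^T = M ->
  char_poly M = \prod_(l <- lam) ('X - l%:P) ->
  exists Q : 'M[R]_n,
    Q *m Q^T = 1%:M /\ M = Q^T *m diag_mx (\row_i lam`_i) *m Q.
Proof.
elim: n => [|n IH] in M lam *.
  exists 1%:M; split; first by rewrite trmx1 mulmx1.
  by rewrite [LHS]flatmx0 [RHS]flatmx0.
move: M; rewrite -[n.+1]/(1 + n)%N => M sM cM.
case: lam cM => [|l lam] cM.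
  by have := size_char_poly M; rewrite cM big_nil size_polyC oner_eq0.
have /eigenvalueP[v0 v0M v00] : eigenvalue M l.
  by rewrite eigenvalue_root_char cM big_cons rootM root_XsubC eqxx.
pose t := qform 1%:M v0.
have t0 : 0 < t.
  by rewrite lt_def qform1_ge0 andbT; apply: contraNneq v00 => /qform1_eq0 ->.
pose s := (Num.sqrt t)^-1; pose v := s *: v0.
have v1 : qform 1%:M v = 1.
  rewrite /v /qform linearZ /= -!scalemxAl -scalemxAr scalerA mxE -/(qform _ _) -/t.
  by rewrite /s -expr2 exprVn sqr_sqrtr ?ltW // mulVf // gt_eqF.
have vM : v *m M = l *: v by rewrite /v -scalemxAl v0M scalerA mulrC -scalerA.
have [H [sH HH vH]] := householder v1.
pose N := H *m M *m H.
have sN : N^T = N by rewrite /N !trmx_mul sH sM mulmxA.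
have eN : row_mx 1%:M 0 *m N = l *: row_mx 1%:M 0 :> 'rV_(1 + n).
  by rewrite -vH /N !mulmxA -(mulmxA v H H) HH mulmx1 vM -scalemxAl.
pose M' := drsubmx N.
have NE : N = block_mx l%:M 0 0 M'.
  move: eN; rewrite -{1}[N]submxK mul_row_block !mul1mx !mul0mx !addr0 scale_row_mx.
  rewrite scaler0 scalemx1 => /eq_row_mx[e1 e2].
  rewrite -[LHS]submxK e1 e2; congr block_mx.
  by rewrite -[in LHS]sN -trmx_ursub e2 trmx0.
have [||Q [QQ M'E]] := IH M' lam.
- by rewrite /M' trmx_drsub sN.
- apply: (@mulfI _ ('X - l%:P)); first by rewrite polyXsubC_eq0.
  by rewrite -char_poly_block -NE char_poly_similar // cM big_cons.
pose Q1 : 'M[R]_(1 + n) := block_mx 1%:M 0 0 Q.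
exists (Q1 *m H); split.
  rewrite trmx_mul sH mulmxA -(mulmxA Q1) HH mulmx1 tr_block_mx mulmx_block.
  by rewrite !trmx0 !mulmx0 !mul0mx trmx1 mulmx1 QQ !addr0 add0r -scalar_mx_block.
have -> : M = H *m N *m H by rewrite /N !mulmxA HH mul1mx -mulmxA HH mulmx1.
suff -> : N = Q1^T *m diag_mx (\row_i (l :: lam)`_i) *m Q1.
  by rewrite trmx_mul sH !mulmxA.
rewrite NE M'E.
have -> : diag_mx (\row_i (l :: lam)`_i) =
    block_mx (l%:M : 'M[R]_1) 0 0 (diag_mx (\row_(i < n) lam`_i)).
  rewrite -[\row_i _]hsubmxK diag_mx_row; congr block_mx.
    by apply/matrixP => i j; rewrite !ord1 !mxE.
  by congr diag_mx; apply/rowP => i; rewrite !mxE.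
rewrite tr_block_mx !mulmx_block !trmx0 !mulmx0 !mul0mx trmx1 !mulmx1 !mul1mx.
by rewrite !addr0 !add0r mul0mx.
Qed.


(** The conditions [Cc] express orthogonality to the first [k] eigenvectors, and
    [M2] is the part of [M] carried by the other ones. *)
Lemma psdmx_split n (M : 'M[R]_n) lam k : psdmx M ->
  char_poly M = \prod_(l <- lam) ('X - l%:P) ->
  exists (Cc M2 : 'M[R]_n), [/\ psdmx M2, (\rank Cc <= k)%N,
    forall u : 'rV_n, u *m Cc = 0 -> u *m M = u *m M2 &
    \tr M2 = \sum_(k <= j < n) lam`_j].
Proof.
move=> pM cM; have [Q [QQ ME]] := symmetric_spectral (proj1 pM) cM.
pose v2 : 'rV[R]_n := \row_(i < n) (if (i < k)%N then 0 else lam`_i).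
pose P0 : 'rV[R]_n := \row_(i < n) (i < k)%N%:R.
exists (Q^T *m diag_mx P0), (Q^T *m diag_mx v2 *m Q); split.
- apply: psdmx_mul; split; first exact: tr_diag_mx.
  move=> u; rewrite qformE; apply: sumr_ge0 => i _; rewrite (bigD1 i) //= big1.
    rewrite !mxE eqxx mulr1n addr0 mulrAC -expr2 mulr_ge0 ?sqr_ge0 //.
    case: ifP => // _; have := (proj2 pM) (delta_mx 0 i *m Q).
    rewrite {1}ME /qform trmx_mul !mulmxA -(mulmxA _ Q) QQ mulmx1.
    rewrite -(mulmxA _ Q) QQ mulmx1 trmx_delta -rowE -colE !mxE eqxx mulr1n.
    by [].
  by move=> j ji; rewrite !mxE eq_sym (negbTE ji) mulr0n mulr0 mul0r.
- have -> : diag_mx P0 = pid_mx k.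
    apply/matrixP => i j; rewrite !mxE; case: eqVneq => [<-|ij]; rewrite ?mulr1n ?mulr0n.
      by rewrite eqxx.
    by rewrite val_eqE (negbTE ij).
  apply: leq_trans (mxrankM_maxr _ _) _.
  by rewrite -pid_mx_minv rank_pid_mx ?geq_minl ?geq_minr.
- move=> u u0; set D := diag_mx (\row_i lam`_i) in ME.
  have DE : D = diag_mx P0 *m D + diag_mx v2.
    rewrite /D mulmx_diag -linearD /=; congr diag_mx; apply/rowP => i.
    by rewrite !mxE; case: ifP => _; rewrite ?mul1r ?mul0r ?addr0 ?add0r.
  rewrite {1}ME {1}DE mulmxDr mulmxDl mulmxDr !mulmxA -(mulmxA u) u0 !mul0mx.
  by rewrite add0r.
- rewrite mxtrace_mulC mulmxA QQ mul1mx mxtrace_diag.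
  rewrite (big_nat_widenl _ 0%N) // big_mkord [RHS]big_mkcond /=.
  by apply: eq_bigr => i _; rewrite mxE; case: leqP.
Qed.
End Spectral.
(** * Ridge matrices *)

Section RidgeTrace.
Variable R : rcfType.
Local Notation qform := (@qform R _).

Lemma definite_ridge p (M A : 'M[R]_p) rho : psdmx M -> psdmx A ->
  (forall u, qform A u = 0 -> u = 0) -> 0 < rho ->
  forall u, qform (M + rho *: A) u = 0 -> u = 0.
Proof.
move=> [_ pM] [_ pA] dA rho0 u; rewrite qformD qformZ => h; apply: dA.
have := pM u; have := pA u; nra.
Qed.

(** [V - V M V = V (rho A) V] is positive semidefinite. *)
Lemma mxtrace_ridge p (M A : 'M[R]_p) rho : psdmx M -> psdmx A ->
  (forall u, qform A u = 0 -> u = 0) -> 0 < rho ->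
  let V := invmx (M + rho *: A) in
  \tr (V *m M *m V *m M) <= \tr (V *m M).
Proof.
move=> pM pA dA rho0 /=; set S := M + rho *: A; set V := invmx S.
have dS := definite_ridge pM pA dA rho0.
have uS : S \in unitmx := definite_unitmx dS.
have pS : psdmx S by apply: psdmxD => //; apply: psdmxZ => //; exact: ltW.
have pV : psdmx V := psdmx_inv pS uS.
have VE : V - V *m M *m V = V^T *m (rho *: A) *m V.
  have -> : rho *: A = S - M by rewrite /S addrC addKr.
  by rewrite mulmxBr mulmxBl (proj1 pV) mulVmx // mul1mx.
have pD : psdmx (V - V *m M *m V).
  rewrite VE; apply: psdmx_mul; apply: psdmxZ => //; exact: ltW.
by have := mxtrace_psdmx_ge0 pD pM; rewrite mulmxBl linearB /= subr_ge0.
Qed.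

Lemma mxtrace_ridge_le_dim p (M A : 'M[R]_p) rho : psdmx M -> psdmx A ->
  (forall u, qform A u = 0 -> u = 0) -> 0 < rho ->
  \tr (invmx (M + rho *: A) *m M) <= p%:R.
Proof.
move=> pM pA dA rho0; set S := M + rho *: A.
have dS := definite_ridge pM pA dA rho0.
have uS : S \in unitmx := definite_unitmx dS.
have pS : psdmx S by apply: psdmxD => //; apply: psdmxZ => //; exact: ltW.
have pV := psdmx_inv pS uS.
have -> : p%:R = \tr (invmx S *m S) by rewrite mulVmx // mxtrace1.
rewrite -subr_ge0 -linearB -mulmxBr /=; apply: mxtrace_psdmx_ge0 => //.
have -> : S - M = rho *: A by rewrite /S addrC addKr.
by apply: psdmxZ => //; exact: ltW.
Qed.

(** Discarding the [r] leading eigenvectors of [M] and the conditions [CA] leaves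
    a space on which [M] has trace at most the tail of its spectrum, while the
    penalty is bounded below. *)
Lemma mxtrace_ridge_tail p l (M A : 'M[R]_p) rho lam r (CA : 'M[R]_(p, l)) kappa :
  psdmx M -> psdmx A -> (forall u, qform A u = 0 -> u = 0) -> 0 < rho ->
  char_poly M = \prod_(x <- lam) ('X - x%:P) ->
  0 < kappa -> (forall u, u *m CA = 0 -> kappa * qform 1%:M u <= qform A u) ->
  \tr (invmx (M + rho *: A) *m M) <=
    (\rank CA)%:R + r%:R + (rho * kappa)^-1 * \sum_(r <= j < p) lam`_j.
Proof.
move=> pM pA dA rho0 cM k0 hk.
have [CM [M2 [pM2 rCM MM2 trM2]]] := psdmx_split r pM cM.
have dS := definite_ridge pM pA dA rho0.
have pSM : psdmx (M + rho *: A - M).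
  by rewrite addrC addKr; apply: psdmxZ => //; exact: ltW.
have := @mxtrace_invmx_restrict _ _ _ (M + rho *: A) M M2 (row_mx CA CM)
  (rho * kappa) pM pSM dS pM2.
rewrite trM2 => h; apply: le_trans (h _ _ _) _.
- move=> u; rewrite mul_mx_row -[0]hsubmxK => /eq_row_mx[_].
  by rewrite linear0; exact: MM2.
- exact: mulr_gt0.
- move=> u; rewrite mul_mx_row -[0]hsubmxK => /eq_row_mx[].
  rewrite linear0 => /hk hu _; rewrite qformD qformZ -mulrA.
  by rewrite -[X in X <= _]add0r lerD ?(proj2 pM) // ler_pM2l.
rewrite lerD2r -natrD ler_nat.
have -> : \rank (row_mx CA CM) = \rank (CA^T + CM^T)%MS.
  by rewrite -mxrank_tr tr_row_mx addsmxE.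
apply: leq_trans (mxrank_adds_leqif _ _) _; rewrite !mxrank_tr leq_add2l.
exact: rCM.
Qed.

Lemma sum_mul_sqr_le n (a b : 'I_n -> R) :
  (\sum_i a i * b i) ^+ 2 <= (\sum_i a i ^+ 2) * (\sum_i b i ^+ 2).
Proof.
have : 0 <= \sum_i \sum_j (a i * b j - a j * b i) ^+ 2.
  by apply: sumr_ge0 => i _; apply: sumr_ge0 => j _; rewrite sqr_ge0.
have -> : \sum_i \sum_j (a i * b j - a j * b i) ^+ 2 =
   \sum_i \sum_j (a i ^+ 2 * b j ^+ 2) + \sum_i \sum_j (b i ^+ 2 * a j ^+ 2)
   - 2 * \sum_i \sum_j ((a i * b i) * (a j * b j)).
  rewrite mulr_sumr -sumrN -!big_split /=; apply: eq_bigr => i _.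
  rewrite mulr_sumr -sumrN -!big_split /=; apply: eq_bigr => j _; ring.
have E (f g : 'I_n -> R) : \sum_i \sum_j (f i * g j) = (\sum_i f i) * (\sum_i g i).
  by rewrite mulr_suml; apply: eq_bigr => i _; rewrite mulr_sumr.
rewrite (E (fun i => a i ^+ 2) (fun i => b i ^+ 2)).
rewrite (E (fun i => b i ^+ 2) (fun i => a i ^+ 2)).
rewrite (E (fun i => a i * b i) (fun i => a i * b i)); lra.
Qed.

Lemma qform1_mul_le n k (u : 'rV[R]_n) (K : 'M[R]_(n, k)) :
  qform 1%:M (u *m K) <= (\sum_i \sum_j K i j ^+ 2) * qform 1%:M u.
Proof.
rewrite !qform1 exchange_big /= mulr_suml; apply: ler_sum => j _.
by rewrite mxE mulrC; exact: sum_mul_sqr_le.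
Qed.

(** Writing [A = G^T G] with [G] invertible, the bound is the boundedness of the
    inverse of [G]. *)
Lemma definite_coercive n (A : 'M[R]_n) : psdmx A ->
  (forall u, qform A u = 0 -> u = 0) ->
  exists2 eta, 0 < eta & forall u, eta * qform 1%:M u <= qform A u.
Proof.
move=> /psdmx_factor[G ->] dG.
have qG u : qform (G^T *m G) u = qform 1%:M (u *m G^T).
  by rewrite -[G^T in LHS]mulmx1 qform_mul.
have uG : G^T \in unitmx.
  rewrite -row_free_unit -kermx_eq0; apply/rowV0P => u /sub_kermxP uG.
  by apply: dG; rewrite qG uG /qform !mul0mx mxE.
pose f := 1 + \sum_i \sum_j (invmx G^T) i j ^+ 2.
have f0 : 0 < f.
  rewrite ltr_pwDl // sumr_ge0 // => i _; rewrite sumr_ge0 // => j _.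
  exact: sqr_ge0.
exists f^-1; first by rewrite invr_gt0.
move=> u; rewrite mulrC ler_pdivrMr // qG.
rewrite -{1}(mulmxK uG u); apply: le_trans (qform1_mul_le _ _) _.
rewrite mulrC ler_wpM2l ?qform1_ge0 // /f; lra.
Qed.

(** A bound which does not depend on [X] makes these entries, as functions of the
    random predictors, integrable.  It holds because [M + rho A] dominates both
    [M = X^T X / c] and a multiple of the identity. *)
Lemma ridge_entries_bounded p N (A : 'M[R]_p) rho c : psdmx A ->
  (forall u, qform A u = 0 -> u = 0) -> 0 < rho -> 0 < c ->
  exists2 L, 0 < L & forall X : 'M[R]_(N, p),
    let H := invmx (c^-1 *: (X^T *m X) + rho *: A) *m X^T in
    (forall i j, `|H i j| <= L) /\ (forall i j, `|(X *m H) i j| <= L).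
Proof.
move=> pA dA rho0 c0; have [eta eta0 etaA] := definite_coercive pA dA.
exists (1 + c + c / (rho * eta)).
  by rewrite !addr_gt0 // divr_gt0 // mulr_gt0.
move=> X; set M := c^-1 *: (X^T *m X); set S := M + rho *: A => H.
have pM : psdmx M by apply: psdmxZ; [rewrite invr_ge0 ltW|exact: psdmx_gram].
have dS := definite_ridge pM pA dA rho0.
have uS : S \in unitmx := definite_unitmx dS.
have pS : psdmx S by apply: psdmxD => //; apply: psdmxZ => //; exact: ltW.
suff key j : (forall i, `|H i j| <= 1 + c + c / (rho * eta)) /\
             (forall i, `|(X *m H) i j| <= 1 + c + c / (rho * eta)).
  by split=> i j; have [? ?] := key j.
pose u := (col j H)^T.
have uE : u = row j X *m invmx S.
  by rewrite /u /H tr_col trmx_mul trmxK trmx_inv (proj1 pS) row_mul.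
pose z := u *m X^T; have zE i : z 0 i = (X *m H) i j.
  rewrite /z /u -trmx_mul mxE colE mulmxA.
  by rewrite -colE mxE.
have qS : qform S u = z 0 j.
  rewrite /qform {1}uE mulmxKV // /z !mxE; apply: eq_bigr => i _.
  by rewrite !mxE mulrC.
have qM : qform M u = c^-1 * qform 1%:M z.
  by rewrite /M qformZ -(mulmx1 X^T) qform_mul.
have zz i : z 0 i ^+ 2 <= qform 1%:M z.
  rewrite qform1 (bigD1 i) //= lerDl sumr_ge0 // => k _; exact: sqr_ge0.
have uu i : u 0 i ^+ 2 <= qform 1%:M u.
  rewrite qform1 (bigD1 i) //= lerDl sumr_ge0 // => k _; exact: sqr_ge0.
have qSE : qform S u = c^-1 * qform 1%:M z + rho * qform A u.
  by rewrite /S qformD qM qformZ.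
have A0 := proj2 pA u.
have rA0 : 0 <= rho * qform A u by rewrite mulr_ge0 // ltW.
have zc : qform 1%:M z <= c * z 0 j.
  by rewrite mulrC -ler_pdivrMr // mulrC -qS qSE lerDl.
have zj := zz j.
have zjc : z 0 j <= c by nra.
have Z : qform 1%:M z <= c ^+ 2 by nra.
have Q : qform 1%:M u <= c / (rho * eta).
  rewrite ler_pdivlMr ?mulr_gt0 //.
  have Az := etaA u; have Z0 := qform1_ge0 z.
  have ci0 : 0 <= c^-1 * qform 1%:M z by rewrite mulr_ge0 // invr_ge0 ltW.
  nra.
have cre : 0 <= c / (rho * eta) by rewrite divr_ge0 // ?mulr_ge0 ?ltW.
have sqle (x y : R) : 0 <= y -> x ^+ 2 <= y -> `|x| <= 1 + y.
  by move=> y0 xy; rewrite ler_norml; apply/andP; split; nra.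
split=> i.
  have -> : H i j = u 0 i by rewrite !mxE.
  apply: le_trans (sqle _ _ cre (le_trans (uu i) Q)) _; lra.
rewrite -zE; have := le_trans (zz i) Z; rewrite ler_norml => h.
by apply/andP; split; nra.
Qed.

(** By diagonal dominance, [s 1 - Sig] is positive semidefinite. *)
Lemma mxtrace_row_sum_le N (B Sig : 'M[R]_N) s : psdmx B -> Sig^T = Sig ->
  (forall i, \sum_j `|Sig i j| <= s) -> \tr (B *m Sig) <= s * \tr B.
Proof.
move=> pB sS hs.
have pD : psdmx (s%:M - Sig).
  split; first by rewrite linearB /= tr_scalar_mx sS.
  move=> u; rewrite -scalemx1 qformB qformZ qform1 qformE subr_ge0.
  have absle (x y z : R) : x * y * z <= `|y| * (x ^+ 2 / 2) + `|y| * (z ^+ 2 / 2).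
    have := ler_norm y; have := ler_norm (- y); rewrite normrN.
    set t := `|y| => h1 h2; have := sqr_ge0 (x - z); have := sqr_ge0 (x + z); nra.
  apply: (@le_trans _ _ (\sum_i \sum_j (`|Sig i j| * (u 0 i ^+ 2 / 2) +
      `|Sig i j| * (u 0 j ^+ 2 / 2)))).
    by apply: ler_sum => i _; apply: ler_sum => j _.
  have E : \sum_i \sum_j `|Sig i j| * (u 0 i ^+ 2 / 2) <=
      s * (\sum_i (u 0 i ^+ 2 / 2)).
    rewrite mulr_sumr; apply: ler_sum => i _; rewrite -mulr_suml.
    by apply: ler_wpM2r => //; rewrite divr_ge0 ?sqr_ge0.
  have E2 : \sum_i \sum_j `|Sig i j| * (u 0 j ^+ 2 / 2) <=
      s * (\sum_i (u 0 i ^+ 2 / 2)).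
    rewrite exchange_big /=; apply: le_trans E; apply: ler_sum => i _.
    by apply: ler_sum => j _; rewrite -{1}sS mxE.
  have -> : s * \sum_i u 0 i ^+ 2 =
      s * \sum_i (u 0 i ^+ 2 / 2) + s * \sum_i (u 0 i ^+ 2 / 2).
    rewrite -mulrDr -big_split /=; congr (_ * _); apply: eq_bigr => i _; lra.
  apply: le_trans (lerD E E2); rewrite -big_split /= le_eqVlt; apply/orP; left.
  by apply/eqP; apply: eq_bigr => i _; rewrite big_split.
have := mxtrace_psdmx_ge0 pD pB.
rewrite mulmxBl linearB /= mul_scalar_mx linearZ /= subr_ge0.
by rewrite (mxtrace_mulC B).
Qed.
End RidgeTrace.
(** * Polynomial primitives of products of derivatives *)

Section Green.
Variable R : realType.
Implicit Types q r : {poly R}.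

(** The boundary terms of [m] integrations by parts of [q^(m) r^(m)]: a primitive
    of it as soon as [q^(2 m) = 0]. *)
Definition green m q r : {poly R} :=
  \sum_(k < m) (-1) ^+ k *: (q^`(m + k) * r^`(m - k.+1)).

Lemma derivn_small n q : (size q <= n)%N -> q^`(n) = 0.
Proof.
move=> sq; apply/polyP => i; rewrite coef0 coef_derivn nth_default ?mul0rn //.
exact: leq_trans sq (leq_addr _ _).
Qed.

Lemma size_derivn0 n q : q^`(n) = 0 -> (size q <= n)%N.
Proof.
move=> q0; apply/leq_sizeP => j nj.
have : q^`(n)`_(j - n) = 0 by rewrite q0 coef0.
rewrite coef_derivn subnKC // => /eqP; rewrite mulrn_eq0 => /orP[|/eqP//].
by rewrite -leqn0 leqNgt ffact_gt0 nj.
Qed.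

Lemma deriv_green m q r : (size q <= 2 * m)%N ->
  (green m q r)^`() = q^`(m) * r^`(m).
Proof.
move=> sq; pose a k := - ((-1) ^+ k *: (q^`(m + k) * r^`(m - k))).
have -> : (green m q r)^`() = \sum_(k < m) (a k.+1 - a k).
  rewrite /green linear_sum; apply: eq_bigr => k _ /=.
  rewrite derivZ derivM -!derivnS /a -subSn // subSS addnS exprS mulN1r scaleNr.
  by rewrite !opprK -scalerDr.
rewrite -(big_mkord xpredT (fun k => a k.+1 - a k)) telescope_sumr //.
rewrite /a addnn -mul2n derivn_small // mul0r scaler0 oppr0 add0r opprK.
by rewrite expr0 scale1r addn0 subn0.
Qed.

Lemma poly0_itv q (a b : R) : a < b ->
  (forall x, a <= x <= b -> q.[x] = 0) -> q = 0.
Proof.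
move=> ab h; apply/eqP/negPn/negP => q0.
pose s := [seq a + (b - a) / k.+1%:R | k <- iota 0 (size q)].
have : (size s < size q)%N.
  apply: max_poly_roots => //.
    apply/allP => x /mapP[k _ ->]; apply/rootP/h.
    have ba : 0 <= b - a by rewrite subr_ge0 ltW.
    rewrite lerDl divr_ge0 //= -lerBrDl ler_pdivrMr // ler_peMr // ler1n.
    by [].
  rewrite map_inj_uniq ?iota_uniq // => k l /addrI /mulfI h2.
  have /h2/invr_inj/eqP : b - a != 0 by rewrite subr_eq0 gt_eqF.
  by rewrite eqr_nat => /eqP [].
by rewrite size_map size_iota ltnn.
Qed.

(** Both polynomials have the same Taylor expansion at [x]. *)
Lemma poly_derivn_inj n q r x : (size q <= n)%N -> (size r <= n)%N ->
  (forall k, (k < n)%N -> q^`(k).[x] = r^`(k).[x]) -> q = r.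
Proof.
move=> sq sr h; apply/eqP; rewrite -subr_eq0; apply/eqP; set d := q - r.
have sd : (size d <= n)%N.
  by rewrite (leq_trans (size_polyD _ _)) // geq_max sq size_polyN.
apply: (@poly0_itv _ 0 1) => // y _; rewrite -[y](subrK x) addrC.
rewrite nderiv_taylor; last exact: mulrC.
apply: big1 => i _.
have : d^`(i).[x] = 0.
  rewrite /d derivnB hornerD hornerN h ?subrr //.
  exact: leq_trans (ltn_ord i) sd.
rewrite nderivn_def hornerMn => /eqP; rewrite mulrn_eq0 => /orP[|/eqP ->].
  by rewrite -leqn0 leqNgt fact_gt0.
by rewrite mul0r.
Qed.

Lemma horner_le_deriv q (a b : R) : a <= b ->
  (forall x, 0 <= q^`().[x]) -> q.[a] <= q.[b].
Proof.
move=> ab h.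
apply: (@ger0_derive1_le_cc R (horner q) a b) => //.
- by move=> x _; rewrite -derivE.
- by apply: continuous_subspaceT; exact: continuous_horner.
- by rewrite in_itv /= lexx.
- by rewrite in_itv /= lexx ab.
Qed.

Lemma green_le m q a b : (size q <= 2 * m)%N -> a <= b ->
  (green m q q).[a] <= (green m q q).[b].
Proof.
move=> sq ab; apply: horner_le_deriv => // x.
by rewrite deriv_green // hornerM -expr2 sqr_ge0.
Qed.

(** Cauchy-Schwarz inequality for [q'] on the interval, without integrals. *)
Lemma sqr_hornerB_le q r (a b : R) : a <= b -> r^`() = q^`() ^+ 2 ->
  (q.[b] - q.[a]) ^+ 2 <= (b - a) * (r.[b] - r.[a]).
Proof.
rewrite le_eqVlt => /predU1P[->|ab] rE; first by rewrite !subrr mul0r expr0n.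
have [l lE] : exists l, l * (b - a) = q.[b] - q.[a].
  by exists ((q.[b] - q.[a]) / (b - a)); rewrite divfK // subr_eq0 gt_eqF.
(* the derivative of this polynomial is a square, and [l] is the mean slope *)
have h : (r - (2 * l) *: q + (l ^+ 2) *: 'X).[a] <=
         (r - (2 * l) *: q + (l ^+ 2) *: 'X).[b].
  apply: horner_le_deriv (ltW ab) _ => x.
  rewrite derivD derivB !derivZ derivX rE !hornerE.
  rewrite [X in 0 <= X](_ : _ = (q^`().[x] - l) ^+ 2) ?sqr_ge0 //; ring.
have ba : 0 < b - a by rewrite subr_gt0.
suff : r.[a] - 2 * l * q.[a] + l ^+ 2 * a <= r.[b] - 2 * l * q.[b] + l ^+ 2 * b.
  move=> h2.
  have lE2 : l * (q.[b] - q.[a]) = l ^+ 2 * (b - a) by rewrite -lE; ring.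
  have h3 : l ^+ 2 * (b - a) <= r.[b] - r.[a] by lra.
  have -> : (q.[b] - q.[a]) ^+ 2 = (b - a) * (l ^+ 2 * (b - a)).
    by rewrite -lE; ring.
  by rewrite ler_pM2l.
by rewrite !hornerE in h.
Qed.

Lemma green_cs m q a b : (0 < m)%N -> (size q <= 2 * m)%N -> a <= b ->
  (q^`(m.-1).[b] - q^`(m.-1).[a]) ^+ 2 <=
    (b - a) * ((green m q q).[b] - (green m q q).[a]).
Proof.
move=> m0 sq ab; apply: sqr_hornerB_le => //.
by rewrite deriv_green // -derivnS prednK // expr2.
Qed.

Lemma green_suml m n (c : 'I_n -> R) (Q : 'I_n -> {poly R}) r :
  green m (\sum_i c i *: Q i) r = \sum_i c i *: green m (Q i) r.
Proof.
rewrite /green; under [RHS]eq_bigr do rewrite scaler_sumr.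
rewrite exchange_big /=; apply: eq_bigr => k _.
rewrite linear_sum /= mulr_suml scaler_sumr; apply: eq_bigr => i _.
by rewrite linearZ /= -scalerAl !scalerA mulrC.
Qed.

Lemma green_sumr m n (c : 'I_n -> R) (Q : 'I_n -> {poly R}) r :
  green m r (\sum_i c i *: Q i) = \sum_i c i *: green m r (Q i).
Proof.
rewrite /green; under [RHS]eq_bigr do rewrite scaler_sumr.
rewrite exchange_big /=; apply: eq_bigr => k _.
rewrite linear_sum /= mulr_sumr scaler_sumr; apply: eq_bigr => i _.
by rewrite linearZ /= -scalerAr !scalerA mulrC.
Qed.
End Green.
(** * Polynomial pieces of a natural spline *)

Section SplinePieces.
Variable R : realType.
Implicit Types (s : R -> R) (q : {poly R}).

Lemma design_pt_lt p i j : (i < j)%N -> (0 < p)%N -> design_pt R p i < design_pt R p j.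
Proof. by move=> ij p0; rewrite /design_pt ltr_pM2r ?invr_gt0 ?ltr0n // ltr_nat. Qed.

Lemma design_pt_le p i j : (i <= j)%N -> design_pt R p i <= design_pt R p j.
Proof. by move=> ij; rewrite /design_pt ler_wpM2r ?invr_ge0 ?ler0n // ler_nat. Qed.

(** The [j]-th piece between consecutive knots; the first and the last ones are
    unbounded. *)
Definition in_piece p j (x : R) :=
  ((0 < j)%N -> design_pt R p j <= x) /\ ((j < p)%N -> x <= design_pt R p j.+1).

Definition in_open_piece p j (x : R) :=
  ((0 < j)%N -> design_pt R p j < x) /\ ((j < p)%N -> x < design_pt R p j.+1).

(** Up to order [2 m - 2] the derivatives are continuous, hence given by the
    polynomial on the closed piece: two neighbouring polynomials then agree to this
    order at their common knot.  Beyond that order only the open piece is safe,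
    since the derivative need not exist at the knots; this occurs for the order
    [m] of the penalty when [m = 1]. *)
Definition spline_pieces m p s (q : nat -> {poly R}) :=
  [/\ forall j, (j <= p)%N -> (size (q j) <= 2 * m)%N,
      (size (q 0%N) <= m)%N, (size (q p) <= m)%N,
      forall k j x, (k <= 2 * m - 2)%N -> (j <= p)%N -> in_piece p j x ->
        derive1n k s x = (q j)^`(k).[x]
    & forall k j x, (j <= p)%N -> in_open_piece p j x ->
        derive1n k s x = (q j)^`(k).[x]].

Lemma derive1n_eq_horner (U : set R) s q k : open U ->
  (forall x, U x -> s x = q.[x]) ->
  forall x, U x -> derive1n k s x = q^`(k).[x].
Proof.
move=> oU sq; elim: k => [|k IH] x Ux; first by rewrite derivn0 /= sq.
rewrite derive1nS derivnS derivE !derive1E; apply: near_eq_derive.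
have : nbhs x U by apply: open_nbhs_nbhs.
by apply: filterS => y /IH.
Qed.

Lemma open_piece_open p j : open [set x | in_open_piece p j x].
Proof.
have -> : [set x | in_open_piece p j x] =
  [set x | (0 < j)%N -> design_pt R p j < x] `&`
  [set x | (j < p)%N -> x < design_pt R p j.+1] by [].
apply: openI.
- case: ltnP => _.
    rewrite (_ : mkset _ = `]design_pt R p j, +oo[%classic); first exact: interval_open.
    by apply/seteqP; split=> x /=; rewrite in_itv /= andbT; auto.
  by rewrite (_ : mkset _ = setT); [exact: openT|apply/seteqP; split].
- case: ltnP => _.
    rewrite (_ : mkset _ = `]-oo, design_pt R p j.+1[%classic); first exact: interval_open.
    by apply/seteqP; split=> x /=; rewrite in_itv /=; auto.
  by rewrite (_ : mkset _ = setT); [exact: openT|apply/seteqP; split].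
Qed.

Lemma cvg_at_left_horner (f : R -> R) q x e : e < x -> {for x, continuous f} ->
  (forall y, e < y -> y < x -> f y = q.[y]) -> f x = q.[x].
Proof.
move=> ex cf fq.
have h1 : f y @[y --> x^'-] --> f x by apply: cvg_at_left_filter; exact: cf.
have h2 : q.[y] @[y --> x^'-] --> q.[x].
  by apply: cvg_at_left_filter; apply: continuous_horner.
apply: (@cvg_unique _ _ (q.[y] @[y --> x^'-])) => //; apply: cvg_trans h1.
apply: near_eq_cvg; near=> y; rewrite fq //.
Unshelve. all: by end_near. Qed.

Lemma cvg_at_right_horner (f : R -> R) q x e : x < e -> {for x, continuous f} ->
  (forall y, x < y -> y < e -> f y = q.[y]) -> f x = q.[x].
Proof.
move=> ex cf fq.
have h1 : f y @[y --> x^'+] --> f x by apply: cvg_at_right_filter; exact: cf.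
have h2 : q.[y] @[y --> x^'+] --> q.[x].
  by apply: cvg_at_right_filter; apply: continuous_horner.
apply: (@cvg_unique _ _ (q.[y] @[y --> x^'+])) => //; apply: cvg_trans h1.
apply: near_eq_cvg; near=> y; rewrite fq //.
Unshelve. all: by end_near. Qed.

Lemma derivable_derive1n_continuous s n k :
  (forall k, (k < n)%N -> forall x, derivable (derive1n k s) x 1) ->
  continuous (derive1n n s) -> (k <= n)%N -> continuous (derive1n k s).
Proof.
move=> ds cs; rewrite leq_eqVlt => /predU1P[->//|kn] x.
by apply: differentiable_continuous; apply/derivable1_diffP; exact: ds.
Qed.

Lemma natural_spline_pieces m p s : (0 < m)%N -> (0 < p)%N ->
  natural_spline m p s -> exists q : nat -> {poly R}, spline_pieces m p s q.
Proof.
move=> m0 p0 [ds cs mid lo hi].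
have pieces j : exists r : {poly R}, (j <= p)%N ->
    [/\ (size r <= 2 * m)%N, (j = 0%N \/ j = p -> (size r <= m)%N) &
    forall x, in_piece p j x -> s x = r.[x]].
  have m2 : (m <= 2 * m)%N by rewrite leq_pmull.
  have [->|j0] := eqVneq j 0%N.
    have [r sr rP] := lo; exists r => _; split=> //; first exact: leq_trans sr m2.
    by move=> x [_ hx]; apply: rP; rewrite /= in_itv /= hx.
  have [->|jp] := eqVneq j p.
    have [r sr rP] := hi; exists r => _; split=> //; first exact: leq_trans sr m2.
    by move=> x [hx _]; apply: rP; rewrite /= in_itv /= hx.
  have [jlt|jge] := ltnP j p; last first.
    by exists 0 => jle; move: jp; rewrite eqn_leq jle jge.
  have j1 : (0 < j)%N by rewrite lt0n.
  have [|r sr rP] := mid j; first by rewrite j1.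
  exists r => _; split=> //; first by case=> /eqP; rewrite ?(negbTE j0) ?(negbTE jp).
  by move=> x [h1 h2]; apply: rP; rewrite /= in_itv /= h1 // h2.
have [q qP] := choice pieces.
have opn k j x : (j <= p)%N -> in_open_piece p j x ->
    derive1n k s x = (q j)^`(k).[x].
  move=> jp; apply: (@derive1n_eq_horner [set x | in_open_piece p j x]).
    exact: open_piece_open.
  move=> y [h1 h2]; have [_ _ ->//] := qP j jp.
  by split=> [/h1/ltW|/h2/ltW].
exists q; split=> //.
- by move=> j /qP[].
- by have [_ + _] := qP 0%N (leq0n _); apply; left.
- by have [_ + _] := qP p (leqnn _); apply; right.
move=> k j x kn jp [h1 h2].
have ck := derivable_derive1n_continuous ds cs kn.
have tj : design_pt R p j < design_pt R p j.+1 by apply: design_pt_lt.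
have [xl|xl] := pselect ((0 < j)%N -> design_pt R p j < x); last first.
  move/not_implyP: xl => [j0 /negP]; rewrite -leNgt => xl.
  have xE : x = design_pt R p j by apply/eqP; rewrite eq_le xl h1.
  apply: (@cvg_at_right_horner _ _ _ (design_pt R p j.+1)); rewrite ?xE //.
    exact: ck.
  by move=> y y1 y2; apply: opn.
have [xr|xr] := pselect ((j < p)%N -> x < design_pt R p j.+1); last first.
  move/not_implyP: xr => [j0 /negP]; rewrite -leNgt => xr.
  have xE : x = design_pt R p j.+1 by apply/eqP; rewrite eq_le xr h2.
  apply: (@cvg_at_left_horner _ _ _ (design_pt R p j)); rewrite ?xE //.
    exact: ck.
  by move=> y y1 y2; apply: opn.
exact: opn.
Qed.

End SplinePieces.
(** * Energy of a spline *)

Section Energy.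
Variable R : realType.
Implicit Types (s : R -> R) (q : nat -> {poly R}).
Local Notation pt := (design_pt R).

(** The integral of [q^(m) r^(m)] over the [j]-th piece. *)
Definition piece_energy m p (q r : nat -> {poly R}) j : R :=
  (green m (q j) (r j)).[pt p j.+1] - (green m (q j) (r j)).[pt p j].

Definition energy m p q r : R := \sum_(1 <= j < p) piece_energy m p q r j.

Lemma in_piece_right p j : (0 < p)%N -> (j < p)%N -> in_piece p j (pt p j.+1).
Proof. by move=> p0 jp; split => // _; apply: design_pt_le. Qed.

Lemma in_piece_left p j : (0 < p)%N -> in_piece p j (pt p j).
Proof. by move=> p0; split => // _; apply: design_pt_le. Qed.

Lemma pieces_match m p s q k j : (0 < p)%N -> spline_pieces m p s q ->
  (j < p)%N -> (k <= 2 * m - 2)%N ->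
  (q j)^`(k).[pt p j.+1] = (q j.+1)^`(k).[pt p j.+1].
Proof.
move=> p0 [_ _ _ cl _] jp km.
rewrite -(cl k j) ?(ltnW jp) //; last exact: in_piece_right.
by rewrite -(cl k j.+1) //; exact: in_piece_left.
Qed.

Lemma pieces_knot m p s q j : (0 < p)%N -> spline_pieces m p s q ->
  (j < p)%N -> s (pt p j.+1) = (q j).[pt p j.+1].
Proof.
move=> p0 [_ _ _ cl _] jp.
by rewrite -[LHS]/(derive1n 0 s _) (cl 0%N j) ?(ltnW jp) //; exact: in_piece_right.
Qed.

Lemma piece_energy_ge0 m p s q j : spline_pieces m p s q -> (j <= p)%N ->
  0 <= piece_energy m p q q j.
Proof.
move=> [sz _ _ _ _] jp; rewrite subr_ge0 green_le ?sz //; exact: design_pt_le.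
Qed.

Lemma energy_ge0 m p s q : spline_pieces m p s q -> 0 <= energy m p q q.
Proof.
move=> sp; rewrite /energy big_nat_cond; apply: sumr_ge0 => j /andP[/andP[_ jp] _].
exact: piece_energy_ge0 sp (ltnW jp).
Qed.

Lemma green_small m (r : {poly R}) x : (size r <= m)%N -> (green m r r).[x] = 0.
Proof.
move=> sr; rewrite /green horner_sum big1 // => k _.
rewrite derivn_small ?mul0r ?scaler0 ?horner0 //.
exact: leq_trans sr (leq_addr _ _).
Qed.

(** At a knot all boundary terms of [green] are continuous, except for the last
    one, which contains the value of the spline as a factor: the sum telescopes
    to the ends, where the spline is a polynomial of degree less than [m]. *)
Lemma energy_knots0 m p s q : (0 < m)%N -> (0 < p)%N -> spline_pieces m p s q ->
  (forall j, (j < p)%N -> s (pt p j.+1) = 0) -> energy m p q q = 0.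
Proof.
move=> m0 p0 sp s0; have [_ sz0 szp _ _] := sp.
pose G j := (green m (q j) (q j)).[pt p j].
have hF j : (j < p)%N -> (green m (q j) (q j)).[pt p j.+1] = G j.+1.
  move=> jp; rewrite /G /green !horner_sum; apply: eq_bigr => k _.
  rewrite !hornerZ !hornerM; congr (_ * _).
  have [km|km] := ltnP k m.-1.
    by congr (_ * _); apply: pieces_match sp _ _ => //; lia.
  have -> : (m - k.+1 = 0)%N by lia.
  have h := s0 _ jp; have h1 := pieces_knot p0 sp jp.
  have h2 := pieces_match p0 sp jp (leq0n _).
  by rewrite !derivn0 in h2 *; rewrite -h2 -h1 h !mulr0.
have -> : energy m p q q = \sum_(1 <= j < p) (G j.+1 - G j).
  by rewrite /energy !big_nat; apply: eq_bigr => j /andP[_ jp]; rewrite -hF.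
rewrite telescope_sumr // -(hF 0%N) // /G !green_small //; exact: subrr.
Qed.

Lemma in_piece_ex p (x : R) : exists2 j, (j <= p)%N & in_piece p j x.
Proof.
pose P j := (j <= p)%N && ((j == 0%N) || (pt p j <= x)).
have P0 : exists j, P j by exists 0%N; rewrite /P eqxx.
have Pp j : P j -> (j <= p)%N by case/andP.
have [j /andP[jp jx] jmax] := ex_maxnP P0 Pp; exists j => //; split.
  by move=> j0; move: jx; rewrite eqn0Ngt j0.
move=> jlt; rewrite leNgt; apply/negP => xj.
have : P j.+1 by rewrite /P jlt (ltW xj) orbT.
by move=> /jmax; rewrite ltnn.
Qed.

(** On each piece the primitive [green] is nondecreasing with zero increment, so
    that [q^(m) = 0]; neighbouring pieces, of degree less than [m] and agreeing to
    order [m - 1 <= 2 m - 2] at a knot, coincide. *)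
Lemma energy0_poly m p s q : (0 < m)%N -> (0 < p)%N -> spline_pieces m p s q ->
  energy m p q q = 0 -> exists2 P : {poly R}, (size P <= m)%N & s = horner P.
Proof.
move=> m0 p0 sp e0; have [sz sz0 szp cl _] := sp.
have small j : (j <= p)%N -> (size (q j) <= m)%N.
  move=> jp; have [->//|j0] := eqVneq j 0%N; have [->//|jnp] := eqVneq j p.
  have jlt : (j < p)%N by rewrite ltn_neqAle jnp.
  have : piece_energy m p q q j = 0.
    apply/eqP; move/eqP: e0; rewrite /energy big_nat_cond psumr_eq0; last first.
      by move=> i /andP[/andP[_ ip] _]; exact: piece_energy_ge0 sp (ltnW ip).
    move=> /allP/(_ j); rewrite mem_index_iota lt0n j0 jlt /=; exact.
  move=> ej; set F := green m (q j) (q j).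
  have Fc : F - (F.[pt p j])%:P = 0.
    apply: (@poly0_itv _ _ (pt p j) (pt p j.+1)); first exact: design_pt_lt.
    move=> x /andP[x1 x2]; rewrite hornerD hornerN hornerC; apply/eqP.
    rewrite subr_eq0 eq_le [X in _ && X]green_le ?sz // andbT.
    have -> : F.[pt p j] = F.[pt p j.+1].
      by move/eqP: ej; rewrite subr_eq0 => /eqP.
    by rewrite green_le ?sz.
  apply: size_derivn0; apply/eqP; rewrite -sqrf_eq0 expr2 -deriv_green ?sz //.
  by move/eqP: Fc; rewrite subr_eq0 => /eqP; rewrite -/F => ->; rewrite derivC.
have eqq j : (j <= p)%N -> q j = q 0%N.
  elim: j => // j IH jp; rewrite -IH ?(ltnW jp) //.
  apply: (@poly_derivn_inj _ m _ _ (pt p j.+1)); rewrite ?small ?(ltnW jp) //.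
  by move=> k km; apply/esym/(pieces_match p0 sp jp); lia.
exists (q 0%N) => //; apply/funext => x.
have [j jp jx] := in_piece_ex p x.
by rewrite -[LHS]/(derive1n 0 s x) (cl 0%N j) // derivn0 eqq.
Qed.

(** Cauchy-Schwarz inequality for [s^(m)], glued over the pieces. *)
Lemma increment_le_energy m p s q a b x y : (0 < m)%N -> (0 < p)%N ->
  spline_pieces m p s q -> (a <= b)%N -> (b <= p)%N ->
  pt p a <= x -> x <= y -> y <= pt p b ->
  (derive1n m.-1 s y - derive1n m.-1 s x) ^+ 2 <=
    (y - x) * \sum_(a <= j < b) piece_energy m p q q j.
Proof.
move=> m0 p0 sp; have [sz _ _ cl _] := sp.
set g := derive1n m.-1 s.
have m1 : (m.-1 <= 2 * m - 2)%N by lia.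
have e0 j : (j <= p)%N -> 0 <= piece_energy m p q q j by exact: piece_energy_ge0 sp.
have S0 i j : (j <= p)%N -> 0 <= \sum_(i <= k < j) piece_energy m p q q k.
  move=> jp; rewrite big_nat_cond; apply: sumr_ge0 => k /andP[/andP[_ kj] _].
  exact: e0 (leq_trans (ltnW kj) jp).
elim: b => [|b IH] in x y *.
  rewrite leqn0 => /eqP -> _ h1 xy h2.
  have -> : x = y by apply/eqP; rewrite eq_le xy (le_trans h2 h1).
  by rewrite !subrr mul0r expr0n.
rewrite leq_eqVlt => /predU1P[->|ab] bp h1 xy h2.
  have -> : x = y by apply/eqP; rewrite eq_le xy (le_trans h2 h1).
  by rewrite !subrr mul0r expr0n.
have last_piece u v : pt p b <= u -> u <= v -> v <= pt p b.+1 ->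
    (g v - g u) ^+ 2 <= (v - u) * piece_energy m p q q b.
  move=> bu uv vb; rewrite /g !(cl _ b) ?(ltnW bp) //; last 2 first.
  - by split=> // _; exact: le_trans uv vb.
  - by split=> // _; exact: le_trans bu uv.
  apply: le_trans (green_cs m0 (sz _ (ltnW bp)) uv) _.
  apply: ler_wpM2l; first by rewrite subr_ge0.
  by apply: lerB; apply: green_le => //; rewrite sz // ltnW.
rewrite big_nat_recr //=; set E := \sum_(_ <= _ < _) _; set e := piece_energy _ _ _ _ _.
have E0 : 0 <= E by apply: S0; exact: ltnW.
have ee0 : 0 <= e by apply: e0; exact: ltnW.
have [yb|by_] := leP y (pt p b).
  apply: le_trans (IH x y _ _ _ _ _) _ => //; first exact: ltnW.
  by apply: ler_wpM2l; rewrite ?subr_ge0 // lerDl.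
have [bx|xb] := leP (pt p b) x.
  apply: le_trans (last_piece x y _ _ _) _ => //.
  by apply: ler_wpM2l; rewrite ?subr_ge0 // lerDr.
have i1 := IH x (pt p b) ab (ltnW bp) h1 (ltW xb) (lexx _).
have i2 := last_piece (pt p b) y (lexx _) (ltW by_) h2.
rewrite -/E -/e in i1 i2.
move: i1 i2; set c := pt p b in xb by_ *.
have -> : g y - g x = (g c - g x) + (g y - g c) by rewrite [RHS]addrC addrA subrK.
set u := g c - g x; set v := g y - g c => i1 i2.
have d1 : 0 < c - x by rewrite subr_gt0.
have d2 : 0 < y - c by rewrite subr_gt0.
have -> : y - x = (c - x) + (y - c) by rewrite [RHS]addrC addrA subrK.
move: (c - x) (y - c) d1 d2 i1 i2 => h k h0 k0 i1 i2.
(* Cauchy-Schwarz, in the form [(u k - v h)^2 >= 0] *)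
have i3 : 2 * u * v <= h * e + k * E.
  have := sqr_ge0 (u * k - v * h).
  have j1 : k * u ^+ 2 <= k * (h * E) by rewrite ler_pM2l.
  have j2 : h * v ^+ 2 <= h * (k * e) by rewrite ler_pM2l.
  have hk : 0 < h * k by exact: mulr_gt0.
  move=> sq; rewrite -(ler_pM2l hk); nra.
nra.
Qed.

End Energy.
(** * Bounding a spline with many zeros by its energy *)

Section SampledSplines.
Variable R : realType.
Implicit Types (s : R -> R) (q : nat -> {poly R}).
Local Notation pt := (design_pt R).

Lemma derivable_everywhere_continuous (f : R -> R) :
  (forall x, derivable f x 1) -> continuous f.
Proof.
by move=> df x; apply: differentiable_continuous; apply/derivable1_diffP.
Qed.

Lemma rolle_path (f : R -> R) z zs : (forall x, derivable f x 1) ->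
  path <%R z zs -> all (fun x => f x == 0) (z :: zs) ->
  exists ws, [/\ size ws = size zs, path <%R z ws,
    all (fun x => f^`()%classic x == 0) ws & all (<= last z zs) ws].
Proof.
move=> df; elim: zs z => [|y zs IH] z; first by exists [::].
move=> /= /andP[zy pzs] /and3P[fz fy fzs].
have [|ws [sw pw w0 wl]] := IH y pzs; first by rewrite /= fy.
have [||| w wzy dw] := @Rolle R f z y zy.
- by move=> x _; exact: df.
- by apply: continuous_subspaceT; exact: derivable_everywhere_continuous.
- by rewrite (eqP fz) (eqP fy).
exists (w :: ws); move: wzy; rewrite in_itv /= => /andP[zw wy].
have yl : y <= last y zs.
  elim: (zs) (y) pzs => //= a l IHl b /andP[ba /IHl]; exact/le_trans/ltW.
split=> /=.
- by rewrite sw.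
- by rewrite zw /=; case: ws pw {sw w0 wl} => //= v ws /andP[yv ->]; rewrite (lt_trans wy yv).
- by rewrite w0 derive1E derive_val eqxx.
- by rewrite wl andbT (le_trans (ltW wy)).
Qed.

(** Each application of Rolle's theorem loses one zero. *)
Lemma derive1n_zero s (a b : R) n k zs : (k <= n)%N ->
  (forall i, (i < n)%N -> forall x, derivable (derive1n i s) x 1) ->
  (n < size zs)%N -> sorted <%R zs -> all (fun x => s x == 0) zs ->
  all (fun x => a <= x <= b) zs ->
  exists2 z, a <= z <= b & derive1n k s z = 0.
Proof.
move=> kn ds nz szs s0 ab.
suff [ws [sw wsort w0 wab]] : exists ws, [/\ (n - k < size ws)%N, sorted <%R ws,
    all (fun x => derive1n k s x == 0) ws & all (fun x => a <= x <= b) ws].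
  case: ws sw w0 wab {wsort} => // z ws _ /= /andP[/eqP z0 _] /andP[zab _].
  by exists z.
elim: k kn => [|k IH] kn; first by exists zs; rewrite subn0.
have [[|z ws] [sw wsort w0 wab]] := IH (ltnW kn); first by [].
have [vs [sv pv v0 vl]] := rolle_path (ds k kn) wsort w0.
exists vs; rewrite sv; split => //.
- by move: sw => /=; lia.
- exact: path_sorted pv.
- apply/allP => v vin; have /andP[az _] : a <= z <= b by move: wab => /= /andP[].
  have zv : z < v by move: pv; rewrite path_sortedE; [case/andP=> /allP/(_ v vin)|exact: lt_trans].
  have lb : last z ws <= b by have /allP/(_ _ (mem_last z ws))/andP[] := wab.
  by rewrite (le_trans az (ltW zv)) (le_trans (allP vl v vin) lb).
Qed.

Lemma sqr_le_derive (f : R -> R) (a b z x B : R) :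
  (forall y, derivable f y 1) -> a <= z <= b -> a <= x <= b -> f z = 0 ->
  (forall y, a <= y <= b -> f^`()%classic y ^+ 2 <= B) ->
  f x ^+ 2 <= (b - a) ^+ 2 * B.
Proof.
move=> df /andP[az zb] /andP[ax xb] fz dB.
have main u v : a <= u -> u <= v -> v <= b ->
    (f v - f u) ^+ 2 <= (b - a) ^+ 2 * B.
  move=> au uv vb.
  have [||c + ->] := @MVT_segment R f f^`()%classic u v uv.
  - move=> y _; apply: DeriveDef; first exact: df.
    by rewrite derive1E.
  - by apply: continuous_subspaceT; exact: derivable_everywhere_continuous.
  rewrite in_itv /= => /andP[uc cv].
  have cB : f^`()%classic c ^+ 2 <= B.
    by apply: dB; rewrite (le_trans au uc) (le_trans cv vb).
  rewrite exprMn mulrC; apply: ler_pM; rewrite ?sqr_ge0 //.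
  rewrite ler_pXn2r ?nnegrE ?subr_ge0 //.
    by rewrite lerB.
  exact: le_trans au (le_trans uv vb).
have [xz|zx] := leP x z.
  have := main x z ax xz zb; rewrite fz sub0r sqrrN; exact.
by have := main z x az (ltW zx) xb; rewrite fz subr0.
Qed.

(** A spline with [m] zeros between two knots at distance [h] is bounded there by
    its energy: each derivative of order less than [m] has a zero by Rolle's
    theorem, and each integration costs a factor [h]. *)
Lemma spline_zeros_le_energy m p s q a b zs x : (0 < m)%N -> (0 < p)%N ->
  natural_spline m p s -> spline_pieces m p s q -> (a <= b)%N -> (b <= p)%N ->
  (m <= size zs)%N -> sorted <%R zs -> all (fun x => s x == 0) zs ->
  all (fun x => pt p a <= x <= pt p b) zs -> pt p a <= x <= pt p b ->
  s x ^+ 2 <= (pt p b - pt p a) ^+ (2 * m - 1) *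
    \sum_(a <= j < b) piece_energy m p q q j.
Proof.
move=> m0 p0 [ds _ _ _ _] sp ab bp szs sorts s0 zab xab.
set E := \sum_(_ <= _ < _) _; set h := pt p b - pt p a.
have ds' i : (i < m.-1)%N -> forall x, derivable (derive1n i s) x 1.
  by move=> im; apply: ds; lia.
have zero k : (k < m)%N -> exists2 z, pt p a <= z <= pt p b & derive1n k s z = 0.
  move=> km; apply: (@derive1n_zero _ _ _ m.-1 k zs) => //; lia.
have E0 : 0 <= E.
  rewrite /E big_nat_cond; apply: sumr_ge0 => j /andP[/andP[_ jb] _].
  by apply: piece_energy_ge0 sp _; exact: leq_trans (ltnW jb) bp.
suff key i : (i < m)%N -> forall y, pt p a <= y <= pt p b ->
    (derive1n (m.-1 - i) s y) ^+ 2 <= h ^+ (2 * i) * (h * E).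
  have := key m.-1 _ x xab; rewrite subnn => key'.
  have -> : (2 * m - 1 = 2 * m.-1 + 1)%N by lia.
  by rewrite exprD expr1 -mulrA; apply: key'; lia.
elim: i => [|i IH] im y yab.
  rewrite subn0 muln0 expr0 mul1r.
  have [|z zab' z0] := zero m.-1; first by lia.
  move/andP: yab => [ay yb]; move/andP: zab' => [az zb].
  have main u v : pt p a <= u -> u <= v -> v <= pt p b ->
      (derive1n m.-1 s v - derive1n m.-1 s u) ^+ 2 <= h * E.
    move=> au uv vb.
    apply: le_trans (increment_le_energy m0 p0 sp ab bp au uv vb) _.
    by apply: ler_wpM2r => //; rewrite /h lerB.
  have [yz|zy] := leP y z.
    by have := main y z ay yz zb; rewrite z0 sub0r sqrrN.
  by have := main z y az (ltW zy) yb; rewrite z0 subr0.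
have [|z zab' z0] := zero (m.-1 - i.+1)%N; first by lia.
have -> : h ^+ (2 * i.+1) * (h * E) = h ^+ 2 * (h ^+ (2 * i) * (h * E)).
  by rewrite mulnS exprD -!mulrA.
apply: (sqr_le_derive _ zab' yab z0); first by apply: ds'; lia.
move=> u uab; rewrite -derive1nS.
have -> : (m.-1 - i.+1).+1 = (m.-1 - i)%N by lia.
by apply: IH => //; exact: ltnW.
Qed.

Lemma card_divn_le p L c : (0 < L)%N -> (\sum_(j < p) (j %/ L == c) <= L)%N.
Proof.
move=> L0; case: L L0 => // L _.
rewrite (eq_bigr (fun j : 'I_p => if (j %/ L.+1 == c)%N then 1%N else 0%N)); last first.
  by move=> j _; case: eqP.
rewrite -big_mkcond /= sum1dep_card -[X in (_ <= X)%N]card_ord.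
pose f (j : 'I_p) : 'I_L.+1 := inord (j %% L.+1).
rewrite -(@card_in_imset _ _ f) ?max_card //.
move=> i j; rewrite !inE => /eqP ic /eqP jc /(congr1 val).
rewrite /f /= !inordK ?ltn_mod // => ij; apply: val_inj => /=.
by rewrite (divn_eq i L.+1) (divn_eq j L.+1) ic jc ij.
Qed.

(** Sampling inequality: grouping the knots into blocks of [L] consecutive ones
    and asking the spline to vanish at the first [m] knots of each block makes
    the previous bound available in each block, with [h <= L / p]. *)
Lemma sampled_spline_le_energy m p L s q : (0 < m)%N -> (0 < p)%N -> (0 < L)%N ->
  natural_spline m p s -> spline_pieces m p s q ->
  (forall j, (j < p)%N -> (j %% L < m)%N -> s (pt p j.+1) = 0) ->
  \sum_(j < p) s (pt p j.+1) ^+ 2 <=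
    L%:R * (L%:R / p%:R) ^+ (2 * m - 1) * energy m p q q.
Proof.
move=> m0 p0 L0 ns sp s0.
set K := (L%:R / p%:R) ^+ (2 * m - 1).
have K0 : 0 <= K by rewrite exprn_ge0 // divr_ge0.
have e0 j : (j < p)%N -> 0 <= piece_energy m p q q j.
  by move=> jp; apply: piece_energy_ge0 sp (ltnW jp).
pose Eb c := \sum_(1 <= i < p) ((i %/ L)%N == c)%:R * piece_energy m p q q i.
have point (j : 'I_p) : s (pt p j.+1) ^+ 2 <= K * Eb (j %/ L)%N.
  set c := (j %/ L)%N; have jE := divn_eq j L; rewrite -/c in jE.
  have jL := ltn_pmod j L0.
  have Eb0 : 0 <= Eb c.
    rewrite /Eb big_nat_cond; apply: sumr_ge0 => i /andP[/andP[_ ip] _].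
    by rewrite mulr_ge0 // e0.
  have [jm|mj] := ltnP (j %% L)%N m.
    by rewrite s0 // expr0n /= mulr_ge0.
  (* the last block may be incomplete *)
  pose b := minn (c.+1 * L) p.
  have ab : ((c * L).+1 <= b)%N by rewrite leq_min; have := ltn_ord j; lia.
  have bp : (b <= p)%N by exact: geq_minr.
  have jb : (j.+1 <= b)%N by rewrite leq_min ltn_ord; lia.
  pose zs := [seq pt p k.+1 | k <- iota (c * L) m].
  have kb k : k \in iota (c * L) m -> (k.+1 <= b)%N /\ (c * L <= k)%N /\ (k < p)%N /\ (k %% L < m)%N.
    rewrite mem_iota => /andP[k1 k2]; have kj : (k < j)%N by lia.
    split; first exact: leq_trans kj (ltnW jb).
    split=> //; split; first exact: ltn_trans kj (ltn_ord j).
    by rewrite -(subnKC k1) modnMDl; apply: leq_ltn_trans (leq_mod _ _) _; lia.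
  apply: le_trans (@spline_zeros_le_energy m p s q (c * L).+1 b zs _ m0 p0 ns sp ab bp _ _ _ _ _) _.
  - by rewrite size_map size_iota.
  - rewrite sorted_map; apply: sub_sorted (iota_ltn_sorted _ _) => x y xy /=.
    exact: design_pt_lt.
  - apply/allP => x /mapP[k /kb[_ [_ [kp km]]] ->]; apply/eqP; exact: s0.
  - apply/allP => x /mapP[k /kb[kb' [ck _]] ->]; rewrite !design_pt_le //.
  - by rewrite !design_pt_le //; lia.
  have hle : pt p b - pt p (c * L).+1 <= L%:R / p%:R.
    rewrite /design_pt -mulrBl ler_wpM2r ?invr_ge0 // -natrB //.
    by rewrite ler_nat /b; have := geq_minl (c.+1 * L) p; lia.
  have h0 : 0 <= pt p b - pt p (c * L).+1 by rewrite subr_ge0 design_pt_le.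
  apply: ler_pM.
  - exact: exprn_ge0.
  - rewrite big_nat_cond; apply: sumr_ge0 => i /andP[/andP[_ ib] _].
    by apply: e0; exact: leq_trans ib bp.
  - by rewrite /K; apply: lerXn2r; rewrite ?nnegrE // divr_ge0.
  - have cp : ((c * L).+1 <= p)%N := leq_trans ab bp.
    rewrite /Eb (big_cat_nat (n := (c * L).+1) (m := 1%N) (p := p)) //=.
    rewrite (big_cat_nat (n := b) (m := (c * L).+1) (p := p)) //=.
    rewrite addrCA -[X in X <= _]addr0; apply: lerD; last first.
      apply: addr_ge0; rewrite big_nat_cond; apply: sumr_ge0 => i.
        move=> /andP[/andP[i1 i2] _]; rewrite mulr_ge0 // e0 //.
        exact: leq_trans i2 cp.
      by move=> /andP[/andP[i1 i2] _]; rewrite mulr_ge0 // e0.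
    rewrite !big_nat; apply: ler_sum => i /andP[i1 i2].
    have -> : (i %/ L)%N = c.
      have := geq_minl (c.+1 * L) p; rewrite -/b => bc.
      apply/eqP; rewrite eqn_leq -ltnS ltn_divLR // leq_divRL //; lia.
    by rewrite eqxx mul1r.
apply: le_trans (ler_sum _ (fun j _ => point j)) _.
rewrite -mulr_sumr (mulrC L%:R) -mulrA ler_wpM2l //.
rewrite /Eb exchange_big /= /energy mulr_sumr !big_nat.
apply: ler_sum => i /andP[_ ip].
rewrite -mulr_suml ler_wpM2r ?e0 // -natr_sum ler_nat.
by under eq_bigr do rewrite eq_sym; exact: card_divn_le.
Qed.

End SampledSplines.
(** * The energy as an integral, and the space of natural splines *)

Section SplineSpace.
Variable R : realType.
Local Notation pt := (design_pt R).

Lemma FTC_poly (f : R -> R) (G : {poly R}) a b : a < b ->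
  (forall x, a < x < b -> f x = G^`().[x]) ->
  measurable_fun `]a, b]%classic f /\
  (\int[lebesgue_measure]_(x in `]a, b]) (f x)%:E = (G.[b] - G.[a])%:E)%E.
Proof.
move=> ab fG.
have mG (D : set R) : measurable_fun D (horner G^`()).
  apply: measurable_funTS; apply: continuous_measurable_fun.
  by move=> x; apply: continuous_horner.
have fGi : {in `]a, b[, f =1 horner G^`()}.
  by move=> x; rewrite in_itv /= => /fG.
have mf : measurable_fun `]a, b[%classic f.
  apply: (eq_measurable_fun (horner G^`())) => // x.
  by rewrite inE /= => /fGi.
split.
  exact: measurable_fun_itv_oc mf.
rewrite (@eq_integral_itv_bounded R a b (horner G^`()) f _ _ mf (mG _) fGi).
rewrite integral_itv_obnd_cbnd; last first.
  by apply/measurable_EFinP.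
rewrite (@continuous_FTC2 R (horner G^`()) (horner G)) //.
- by apply: continuous_subspaceT => x; apply: continuous_horner.
- split.
  + by move=> x _; apply: derivable_horner.
  + by apply: cvg_at_right_filter; apply: continuous_horner.
  + by apply: cvg_at_left_filter; apply: continuous_horner.
- by move=> x _; rewrite derivE.
Qed.

(** Both splines are polynomials of degree less than [m] before the first knot,
    so that only the bounded pieces contribute. *)
Lemma integral_derive1n_spline m p s1 s2 q1 q2 : (0 < m)%N -> (0 < p)%N ->
  spline_pieces m p s1 q1 -> spline_pieces m p s2 q2 ->
  \int[lebesgue_measure]_(t in @I01 R) (derive1n m s1 t * derive1n m s2 t) =
  energy m p q1 q2.
Proof.
move=> m0 p0 [sz1 sz0 _ _ op1] [_ _ _ _ op2].
set f := fun t => _ * _.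
have piece j : (j < p)%N -> forall x, pt p j < x < pt p j.+1 ->
    f x = (green m (q1 j) (q2 j))^`().[x].
  move=> jp x /andP[x1 x2]; rewrite deriv_green ?sz1 ?(ltnW jp) // hornerM /f.
  by congr (_ * _); [apply: op1|apply: op2]; rewrite ?(ltnW jp).
have pt0 : pt p 0 = 0 by rewrite /design_pt mul0r.
have main j : (j <= p)%N -> measurable_fun `[0, pt p j]%classic f /\
    (\int[lebesgue_measure]_(x in `[0%R, pt p j]) (f x)%:E =
      (\sum_(0 <= i < j) piece_energy m p q1 q2 i)%:E)%E.
  elim: j => [_|j IH jp].
    rewrite pt0 set_itv1 big_nil integral_set1; split=> //.
    exact: measurable_fun_set1.
  have [mf IHf] := IH (ltnW jp).
  have tj : pt p j < pt p j.+1 by apply: design_pt_lt.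
  have [mg Ig] := FTC_poly tj (piece j jp).
  have t0 : 0 <= pt p j by rewrite -pt0; exact: design_pt_le.
  have U : `[0, pt p j.+1]%classic = `[0, pt p j] `|` `]pt p j, pt p j.+1].
    by apply: itv_bndbnd_setU; rewrite bnd_simp // ltW.
  have mU : measurable_fun (`[0, pt p j] `|` `]pt p j, pt p j.+1]) f.
    by apply/measurable_funU.
  split; first by rewrite U.
  rewrite U integral_setU //.
  - by rewrite IHf Ig -EFinD big_nat_recr.
  - exact/measurable_EFinP.
  - apply/disj_setPS => y /= []; rewrite !in_itv /= => /andP[_ y1] /andP[y2 _].
    by have := lt_le_trans y2 y1; rewrite ltxx.
have [_] := main p (leqnn p).
rewrite /Rintegral /I01 {1}/design_pt divff ?pnatr_eq0 -?lt0n // => -> /=.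
rewrite /energy big_ltn //.
suff -> : piece_energy m p q1 q2 0 = 0 by rewrite add0r.
rewrite /piece_energy; suff h x : (green m (q1 0%N) (q2 0%N)).[x] = 0.
  by rewrite !h subrr.
rewrite /green horner_sum big1 // => k _.
rewrite derivn_small ?mul0r ?scaler0 ?horner0 //.
exact: leq_trans sz0 (leq_addr _ _).
Qed.

Definition lincomb n (a : 'I_n -> R) (D : 'I_n -> R -> R) : R -> R :=
  fun x => \sum_(i < n) a i * D i x.

Lemma size_lincomb_le n k (a : 'I_n -> R) (q : 'I_n -> {poly R}) :
  (forall i, (size (q i) <= k)%N) -> (size (\sum_i a i *: q i)%R <= k)%N.
Proof.
move=> h; apply: (big_ind (fun r : {poly R} => (size r <= k)%N)).
- by rewrite size_poly0.
- by move=> x y xk yk; rewrite (leq_trans (size_polyD _ _)) // geq_max xk.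
- by move=> i _; rewrite (leq_trans (size_scale_leq _ _)).
Qed.

Lemma derive1n_lincomb n (a : 'I_n -> R) (D : 'I_n -> R -> R) N k :
  (forall i l, (l < N)%N -> forall x, derivable (derive1n l (D i)) x 1) ->
  (k <= N)%N ->
  derive1n k (lincomb a D) = lincomb a (fun i => derive1n k (D i)).
Proof.
move=> dD; elim: k => // k IH kN; rewrite derive1nS IH ?(ltnW kN) //.
apply/funext => x; rewrite derive1E.
have -> : lincomb a (fun i => derive1n k (D i)) =
    \sum_(i < n) (a i \*: derive1n k (D i)).
  by rewrite fct_sumE.
rewrite derive_sum; last by move=> i; apply: derivableZ; exact: dD.
apply: eq_bigr => i _; rewrite deriveZ; last exact: dD.
by rewrite derive1nS derive1E.
Qed.

Lemma natural_spline_lincomb m p n (a : 'I_n -> R) (D : 'I_n -> R -> R) :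
  (forall i, natural_spline m p (D i)) -> natural_spline m p (lincomb a D).
Proof.
move=> nD.
have dD i l : (l < 2 * m - 2)%N -> forall x, derivable (derive1n l (D i)) x 1.
  by move=> lm; have [h _ _ _ _] := nD i; exact: h.
have E k : (k <= 2 * m - 2)%N -> derive1n k (lincomb a D) =
    \sum_(i < n) (a i \*: derive1n k (D i)).
  by move=> km; rewrite (derive1n_lincomb a dD km) fct_sumE.
have agr k U : (forall i, agrees_with_poly k U (D i)) ->
    agrees_with_poly k U (lincomb a D).
  move=> h; have pol i : exists r : {poly R},
      (size r <= k)%N /\ forall x, U x -> D i x = r.[x].
    by have [r sr rP] := h i; exists r.
  have [q qP] := choice pol.
  exists (\sum_(i < n) a i *: q i).
    by apply: size_lincomb_le => i; have [] := qP i.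
  move=> x Ux; rewrite horner_sum; apply: eq_bigr => i _.
  by rewrite hornerZ; have [_ ->] := qP i.
split.
- move=> k km x; rewrite E ?(ltnW km) //; apply: derivable_sum => i.
  by apply: derivableZ; exact: dD.
- rewrite E //; apply: (big_ind (fun f : R -> R => continuous f)).
  + by move=> x; apply: cvg_cst.
  + by move=> f g cf cg x; apply: continuousD; [exact: cf|exact: cg].
  + move=> i _ x; apply: cvgZr; have [_ c _ _ _] := nD i; exact: c.
- by move=> j jp; apply: agr => i; have [_ _ h _ _] := nD i; exact: h.
- by apply: agr => i; have [_ _ _ h _] := nD i.
- by apply: agr => i; have [_ _ _ _ h] := nD i.
Qed.

Lemma natural_spline_horner m p (q : {poly R}) : (size q <= m)%N ->
  natural_spline m p (horner q).
Proof.
move=> sq.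
have E k : derive1n k (horner q) = horner q^`(k).
  by elim: k => // k IH; rewrite derive1nS IH derivnS derivE.
have agr k U : (m <= k)%N -> agrees_with_poly k U (horner q).
  by move=> mk; exists q => //; exact: leq_trans sq mk.
split.
- by move=> k _ x; rewrite E; apply: derivable_horner.
- by rewrite E => x; apply: continuous_horner.
- by move=> j _; apply: agr; rewrite mul2n -addnn leq_addr.
- exact: agr.
- exact: agr.
Qed.

Lemma spline_pieces_lincomb m p n (a : 'I_n -> R) (D : 'I_n -> R -> R)
    (Q : 'I_n -> nat -> {poly R}) :
  (forall i, natural_spline m p (D i)) -> (forall i, spline_pieces m p (D i) (Q i)) ->
  spline_pieces m p (lincomb a D) (fun j => \sum_(i < n) a i *: Q i j).
Proof.
move=> nD sQ.
have dD i l : (l < 2 * m - 2)%N -> forall x, derivable (derive1n l (D i)) x 1.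
  by move=> lm; have [h _ _ _ _] := nD i; exact: h.
have szs k j : (forall i, (size (Q i j) <= k)%N) ->
    (size (\sum_(i < n) a i *: Q i j)%R <= k)%N.
  exact: size_lincomb_le.
have cl k j x : (k <= 2 * m - 2)%N -> (j <= p)%N -> in_piece p j x ->
    derive1n k (lincomb a D) x = (\sum_(i < n) a i *: Q i j)^`(k).[x].
  move=> km jp jx; rewrite (derive1n_lincomb a dD km) linear_sum horner_sum /=.
  apply: eq_bigr => i _; rewrite linearZ /= hornerZ; have [_ _ _ h _] := sQ i.
  by rewrite (h k j).
split=> //.
- by move=> j jp; apply: szs => i; have [h _ _ _ _] := sQ i; exact: h.
- by apply: szs => i; have [_ h _ _ _] := sQ i.
- by apply: szs => i; have [_ _ h _ _] := sQ i.
move=> k j x jp jx; apply: (@derive1n_eq_horner R [set x | in_open_piece p j x]) => //.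
  exact: open_piece_open.
move=> y [h1 h2]; rewrite -[LHS]/(derive1n 0 _ y) (cl 0%N j) ?derivn0 //.
by split=> [/h1/ltW|/h2/ltW].
Qed.

End SplineSpace.
(** * The roughness penalty *)

Section Penalty.
Variable R : realType.
Local Notation pt := (design_pt R).
Local Notation qform := (@qform R _).

(** The monomials of degree less than [m] are independent natural splines. *)
Lemma natural_spline_basis_dim m p (D : 'I_p -> R -> R) :
  is_basis (natural_spline m p) D -> (m <= p)%N.
Proof.
move=> [_ bD].
have mono (l : 'I_m) : exists a : {ffun 'I_p -> R},
    horner 'X^l = (fun x => \sum_(i < p) a i * D i x).
  have [|a [aE _]] := bD (horner 'X^l); last by exists a.
  by apply: natural_spline_horner; rewrite size_polyXn.
have [a aE] := choice mono.
pose M : 'M[R]_(m, p) := \matrix_(l, i) a l i.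
suff : row_free M by rewrite /row_free => /eqP <-; exact: rank_leq_col.
rewrite -kermx_eq0; apply/rowV0P => c /sub_kermxP cM.
have q0 : \sum_(l < m) c 0 l *: 'X^l = 0 :> {poly R}.
  apply: (@poly0_itv _ _ 0 1) => // x _; rewrite horner_sum.
  have aE' (l : 'I_m) : ('X^l).[x] = \sum_(i < p) a l i * D i x.
    by rewrite -[LHS]/(horner 'X^l x) aE.
  under eq_bigr do rewrite hornerZ aE' mulr_sumr.
  rewrite exchange_big /= big1 // => i _.
  have -> : \sum_(l < m) c 0 l * (a l i * D i x) = (c *m M) 0 i * D i x.
    rewrite mxE mulr_suml; apply: eq_bigr => l _; rewrite mxE; exact: mulrA.
  by rewrite cM mxE mul0r.
apply/rowP => l; rewrite mxE.
have := congr1 (fun r : {poly R} => r`_l) q0.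
rewrite coef0 coef_sum (bigD1 l) //= big1 ?addr0; last first.
  move=> k kl; rewrite coefZ coefXn eq_sym.
  by rewrite (inj_eq val_inj) (negbTE kl) mulr0.
by rewrite coefZ coefXn eqxx mulr1.
Qed.

Lemma basis_lincomb0 m p (D : 'I_p -> R -> R) (a : 'I_p -> R) :
  is_basis (natural_spline m p) D -> lincomb a D = (fun=> 0) -> forall i, a i = 0.
Proof.
move=> [nD bD] a0 i.
have [b [_ bu]] := bD _ (natural_spline_lincomb a nD).
have ba : b = [ffun i => a i].
  by apply: bu; apply/funext => x; apply: eq_bigr => k _; rewrite ffunE.
have b0 : b = [ffun=> 0].
  apply: bu; rewrite a0; apply/funext => x.
  by rewrite big1 // => k _; rewrite ffunE mul0r.
by have := ba; rewrite b0 => /ffunP/(_ i); rewrite !ffunE.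
Qed.

Lemma poly_roots_design m p (P : {poly R}) : (0 < p)%N -> (m <= p)%N ->
  (size P <= m)%N -> (forall j, (j < p)%N -> P.[pt p j.+1] = 0) -> P = 0.
Proof.
move=> p0 mp sP P0; apply/eqP/negPn/negP => Pn0.
have := @max_poly_roots _ P [seq pt p k.+1 | k <- iota 0 p] Pn0.
rewrite size_map size_iota => h.
have : (p < size P)%N.
  apply: h.
    apply/allP => x /mapP[k]; rewrite mem_iota => /andP[_ kp] ->.
    exact/rootP/P0.
  rewrite map_inj_uniq ?iota_uniq // => i j.
  move=> /(mulIf _) h; have /h/eqP : (p%:R : R)^-1 != 0.
    by rewrite invr_eq0 pnatr_eq0 -lt0n.
  by rewrite eqr_nat => /eqP[].
by rewrite ltnNge (leq_trans sP mp).
Qed.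

(** Natural spline interpolation is unique: a spline vanishing at all the knots
    has zero energy, hence is a polynomial of degree less than [m <= p]. *)
Lemma spline_mx_unit m p (D : 'I_p -> R -> R) : (0 < m)%N -> (0 < p)%N ->
  is_basis (natural_spline m p) D -> spline_mx D \in unitmx.
Proof.
move=> m0 p0 bD; have [nD _] := bD.
rewrite -unitmx_tr -row_free_unit -kermx_eq0; apply/rowV0P => u /sub_kermxP uD.
have nu := natural_spline_lincomb (u 0) nD.
have [q sq] := natural_spline_pieces m0 p0 nu.
have s0 j : (j < p)%N -> lincomb (u 0) D (pt p j.+1) = 0.
  move=> jp; have := congr1 (fun v : 'rV_p => v 0 (Ordinal jp)) uD.
  by rewrite !mxE => <-; apply: eq_bigr => i _; rewrite !mxE.
have [P sP sE] := energy0_poly m0 p0 sq (energy_knots0 m0 p0 sq s0).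
have P0 : P = 0.
  apply: (poly_roots_design p0 (natural_spline_basis_dim bD) sP) => j jp.
  by rewrite -[LHS]/(horner P _) -sE s0.
apply/rowP => i; rewrite mxE; apply: (basis_lincomb0 bD).
by rewrite sE P0; apply/funext => x; rewrite horner0.
Qed.

Lemma qform_roughness m p (D : 'I_p -> R -> R) Q (a : 'rV[R]_p) :
  (0 < m)%N -> (0 < p)%N -> (forall i, spline_pieces m p (D i) (Q i)) ->
  qform (roughness_mx m D) a =
    energy m p (fun j => \sum_(i < p) a 0 i *: Q i j)
               (fun j => \sum_(i < p) a 0 i *: Q i j).
Proof.
move=> m0 p0 sQ; rewrite qformE.
under eq_bigr do under eq_bigr do rewrite mxE (integral_derive1n_spline m0 p0 (sQ _) (sQ _)).
rewrite /energy /piece_energy.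
under eq_bigr do under eq_bigr do rewrite mulr_sumr mulr_suml.
under eq_bigr do rewrite exchange_big /=.
rewrite exchange_big /=; apply: eq_bigr => j _.
rewrite green_suml !horner_sum -sumrB; apply: eq_bigr => i _.
rewrite green_sumr !hornerZ !horner_sum -mulrBr -sumrB mulr_sumr.
by apply: eq_bigr => k _; rewrite !hornerZ; ring.
Qed.


(** The residual [u - Q u] is orthogonal to the range of [Q]. *)
Lemma orth_proj_gram p (E : set 'cV[R]_p) (Q : 'M[R]_p) :
  is_orth_proj E Q -> Q = Q^T *m Q.
Proof.
move=> hQ.
have h : Q^T *m Q = Q^T.
  apply/eqP; rewrite eq_sym -subr_eq0; apply/eqP; set W := _ - _.
  apply/matrixP => i j; rewrite [RHS]mxE.
  have [_ /(_ _ (proj1 (hQ (delta_mx i 0))))] := hQ (delta_mx j 0).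
  have -> : (Q *m delta_mx i 0)^T *m (delta_mx j 0 - Q *m delta_mx j 0) =
      delta_mx 0 i *m W *m delta_mx j 0 :> 'M[R]_1.
    by rewrite /W !mulmxBr mulmxBl trmx_mul trmx_delta !mulmxA.
  rewrite -rowE -colE => /(congr1 (fun v : 'M[R]_1 => v 0 0)).
  have -> : W i j = (col j (row i W)) 0 0 by rewrite [RHS]mxE [RHS]mxE.
  by move=> ->; rewrite mxE.
by have := congr1 trmx h; rewrite trmx_mul !trmxK.
Qed.

Section FixedBasis.
Variables (m p : nat) (D : 'I_p -> R -> R) (Pm : 'M[R]_p).
Hypotheses (m0 : (0 < m)%N) (p0 : (0 < p)%N).
Hypothesis bD : is_basis (natural_spline m p) D.
Hypothesis hP : is_orth_proj (poly_vectors R m p) Pm.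

Let interp (u : 'rV[R]_p) : R -> R := lincomb ((u *m (invmx (spline_mx D))^T) 0) D.

Let natural_spline_interp u : natural_spline m p (interp u).
Proof. by apply: natural_spline_lincomb; have [] := bD. Qed.

Let interpE u (j : 'I_p) : interp u (pt p j.+1) = u 0 j.
Proof.
have uB := spline_mx_unit m0 p0 bD.
have -> : u 0 j = (u *m (invmx (spline_mx D))^T *m (spline_mx D)^T) 0 j.
  by rewrite -mulmxA -trmx_mul mulmxV // trmx1 mulmx1.
by rewrite mxE; apply: eq_bigr => i _; rewrite !mxE.
Qed.

(** The matrix [(D^T D)^-1 D^T] is the inverse of the invertible spline matrix: it
    maps the values at the knots to the coefficients of the interpolating spline,
    so that the second term of the penalty is the energy of this spline. *)
Lemma penalty_energy : exists F : 'rV[R]_p -> nat -> {poly R},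
  (forall u, spline_pieces m p (interp u) (F u)) /\
  forall u, qform (penalty_mx m Pm D) u =
    qform Pm u + p%:R * energy m p (F u) (F u).
Proof.
have [nD _] := bD.
have [Q sQ] := choice (fun i => natural_spline_pieces m0 p0 (nD i)).
set B := spline_mx D; have uB : B \in unitmx := spline_mx_unit m0 p0 bD.
exists (fun u j => \sum_(i < p) (u *m (invmx B)^T) 0 i *: Q i j); split.
  by move=> u; exact: spline_pieces_lincomb.
move=> u; rewrite -(qform_roughness _ m0 p0 sQ) -qform_mul -qformZ -qformD.
rewrite /penalty_mx -/B; congr (qform (_ + _ *: _) _).
have uBt : B^T \in unitmx by rewrite unitmx_tr.
have -> : invmx (B^T *m B) = invmx B *m invmx B^T.
  have uBB : B^T *m B \in unitmx by rewrite unitmx_mul uBt.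
  by rewrite -[RHS]mulmx1 -(mulmxV uBB) !mulmxA mulmxKV // mulVmx // mul1mx.
by rewrite !mulmxA mulmxV // mul1mx mulmxKV // trmx_inv.
Qed.

Let qform_proj u : qform Pm u = qform 1%:M (u *m Pm^T).
Proof. by rewrite {1}(orth_proj_gram hP) -[Pm^T in LHS]mulmx1 qform_mul. Qed.

Lemma penalty_psdmx : psdmx (penalty_mx m Pm D).
Proof.
have [F [sF qF]] := penalty_energy; split; last first.
  move=> u; rewrite qF addr_ge0 //; first by rewrite qform_proj qform1_ge0.
  by rewrite mulr_ge0 // (energy_ge0 (sF u)).
have sR : (roughness_mx m D)^T = roughness_mx m D.
  apply/matrixP => i k; rewrite !mxE; apply: eq_Rintegral => t _; exact: mulrC.
have sDD : (invmx ((spline_mx D)^T *m spline_mx D))^T =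
    invmx ((spline_mx D)^T *m spline_mx D).
  by rewrite trmx_inv trmx_mul trmxK.
have sP : Pm^T = Pm by rewrite (orth_proj_gram hP) trmx_mul trmxK.
rewrite /penalty_mx linearD /= sP linearZ /= !trmx_mul trmxK sDD sR.
by rewrite !mulmxA.
Qed.

(** A spline of zero energy is a polynomial of degree less than [m], and such
    polynomials are detected by the projection. *)
Lemma penalty_definite u : qform (penalty_mx m Pm D) u = 0 -> u = 0.
Proof.
have [F [sF qF]] := penalty_energy; rewrite qF => /eqP.
have e0 := energy_ge0 (sF u).
rewrite paddr_eq0; last 2 first.
- by rewrite qform_proj qform1_ge0.
- by rewrite mulr_ge0.
rewrite mulf_eq0 pnatr_eq0 (gtn_eqF p0) /= => /andP[/eqP Pu /eqP eu].
have [P sP sE] := energy0_poly m0 p0 (sF u) eu.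
have uE : poly_vectors R m p u^T.
  exists (fun l => P`_l); apply/colP => j; rewrite !mxE -interpE sE.
  by rewrite (horner_coef_wide _ sP).
rewrite qform_proj in Pu; have {}Pu := qform1_eq0 Pu.
have PuT : Pm *m u^T = 0 by rewrite -[LHS]trmxK trmx_mul trmxK Pu trmx0.
have [_ /(_ _ uE)] := hP u^T; rewrite PuT subr0 trmxK => uu.
by apply: qform1_eq0; rewrite /qform mulmx1 uu mxE.
Qed.

Lemma penalty_ge_sampled L (u : 'rV[R]_p) : (0 < L)%N ->
  (forall j : 'I_p, (j %% L < m)%N -> u 0 j = 0) ->
  (p%:R / L%:R) ^+ (2 * m) * qform 1%:M u <= qform (penalty_mx m Pm D) u.
Proof.
move=> L0 u0; have [F [sF qF]] := penalty_energy.
have := @sampled_spline_le_energy R m p L (interp u) (F u) m0 p0 L0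
  (natural_spline_interp u) (sF u).
move=> h.
have {}h : qform 1%:M u <=
    L%:R * (L%:R / p%:R) ^+ (2 * m - 1) * energy m p (F u) (F u).
  rewrite qform1; under eq_bigr do rewrite -interpE; apply: h => j jp jL.
  by have /= -> := interpE u (Ordinal jp); exact: u0.
have Lr : 0 < L%:R :> R by rewrite ltr0n.
have pr : 0 < p%:R :> R by rewrite ltr0n.
rewrite qF -[X in X <= _]add0r; apply: lerD; first by rewrite qform_proj qform1_ge0.
rewrite mulrC -ler_pdivlMr; last by rewrite exprn_gt0 // divr_gt0.
apply: le_trans h _; rewrite le_eqVlt; apply/orP; left; apply/eqP.
have -> : (2 * m = (2 * m - 1).+1)%N by lia.
rewrite subSS subn0; move: (2 * m - 1)%N (energy _ _ _ _) => k e.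
rewrite -exprVn invf_div exprS; field; exact/lt0r_neq0.
Qed.

(** Blocks of [L = floor (p m / r) + 1] knots: there are at most [p / L + 1] of
    them, hence [m (p / L + 1) <= m + r] conditions, and [r <= p] gives
    [p / L >= r / (m + 1)]. *)
Lemma penalty_lower_bound r : (0 < r)%N -> (r <= p)%N ->
  exists l (CA : 'M[R]_(p, l)), (\rank CA <= m + r)%N /\
    forall u, u *m CA = 0 ->
      (r%:R / m.+1%:R) ^+ (2 * m) * qform 1%:M u <= qform (penalty_mx m Pm D) u.
Proof.
move=> r0 rp; pose L := ((p * m) %/ r).+1.
pose J := [set j : 'I_p | (j %% L < m)%N].
pose CA : 'M[R]_(p, #|J|) := \matrix_(j, i) (enum_val i == j)%:R.
have L0 : (0 < L)%N by [].
have pmL : (p * m < L * r)%N by rewrite /L mulnC -ltn_divLR // mulnC.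
have Lpm : (L * r <= p * m.+1)%N.
  rewrite /L mulSn mulnS; apply: leq_add => //; exact: leq_trunc_div.
exists #|J|, CA; split.
  apply: leq_trans (rank_leq_col _) _.
  have dm : ((p %/ L) * m <= r)%N.
    rewrite -(leq_pmul2l L0); apply: leq_trans (ltnW pmL).
    by rewrite mulnA leq_mul2r mulnC leq_trunc_div orbT.
  apply: (@leq_trans ((p %/ L).+1 * m)); last by rewrite mulSn leq_add2l.
  have jL (j : 'I_p) : (j %/ L < (p %/ L).+1)%N.
    by rewrite ltnS leq_div2r // ltnW.
  pose f (j : 'I_p) : 'I_(p %/ L).+1 * 'I_m.-1.+1 :=
    (inord (j %/ L), inord (j %% L)).
  rewrite -(card_in_imset (f := f)).
    apply: leq_trans (max_card _) _.
    by rewrite card_prod !card_ord prednK.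
  move=> i j; rewrite !inE => im jm [] /(congr1 val) /= h1 /(congr1 val) /= h2.
  rewrite !inordK // in h1; rewrite !inordK ?prednK // in h2.
  by apply: val_inj => /=; rewrite (divn_eq i L) (divn_eq j L) h1 h2.
move=> u uC; apply: le_trans (@penalty_ge_sampled L u L0 _).
  apply: ler_wpM2r; first exact: qform1_ge0.
  apply: lerXn2r; rewrite ?nnegrE ?divr_ge0 //.
  rewrite ler_pdivrMr ?ltr0n // mulrAC ler_pdivlMr ?ltr0n // -!natrM ler_nat.
  by rewrite mulnC.
move=> j jm; have jJ : j \in J by rewrite inE.
have := congr1 (fun v : 'rV_ _ => v 0 (enum_rank_in jJ j)) uC.
rewrite !mxE (bigD1 j) //= big1 ?addr0; last first.
  by move=> k kj; rewrite !mxE enum_rankK_in // eq_sym (negbTE kj) mulr0.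
by rewrite !mxE enum_rankK_in // eqxx mulr1.
Qed.

End FixedBasis.
End Penalty.
(** * Covariance inequality for bounded functions *)

Section BoundedMeasurable.
Context (R : realType) (dO : measure_display) (Omega : measurableType dO).
Variable P : probability Omega R.
Implicit Types f g : Omega -> R.

(** On this algebra of functions the expectation is finite and linear, without
    integrability conditions. *)
Definition bounded_measurable f :=
  measurable_fun setT f /\ exists K, forall w, `|f w| <= K.

Definition expect f : R := \int[P]_w f w.

Lemma bounded_measurable_integrable f :
  bounded_measurable f -> P.-integrable setT (EFin \o f).
Proof.
move=> [mf [K fK]]; apply: (@le_integrable _ _ _ _ _ _ _ (EFin \o cst K)) => //.
- exact/measurable_EFinP.
- by move=> w _ /=; rewrite lee_fin (le_trans (fK w)) // ler_norm.
- exact: finite_measure_integrable_cst.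
Qed.

Lemma expectE f : bounded_measurable f -> (\int[P]_w (f w)%:E = (expect f)%:E)%E.
Proof.
move=> bf; rewrite /expect /Rintegral fineK //.
exact: integrable_fin_num (bounded_measurable_integrable bf).
Qed.

Lemma bm_cst (c : R) : bounded_measurable (fun=> c).
Proof. by split; [exact: measurable_cst|exists `|c|]. Qed.

Lemma bmD f g : bounded_measurable f -> bounded_measurable g ->
  bounded_measurable (fun w => f w + g w).
Proof.
move=> [mf [K fK]] [mg [L gL]]; split; first exact: measurable_funD.
by exists (K + L) => w; rewrite (le_trans (ler_normD _ _)) // lerD.
Qed.

Lemma bmM f g : bounded_measurable f -> bounded_measurable g ->
  bounded_measurable (fun w => f w * g w).
Proof.
move=> [mf [K fK]] [mg [L gL]]; split; first exact: measurable_funM.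
by exists (K * L) => w; rewrite normrM ler_pM.
Qed.

Lemma bmN f : bounded_measurable f -> bounded_measurable (fun w => - f w).
Proof.
move=> [mf [K fK]]; split; last by exists K => w; rewrite normrN.
exact: measurableT_comp.
Qed.

Lemma bm_sum (I : Type) (r : seq I) (F : I -> Omega -> R) :
  (forall i, bounded_measurable (F i)) ->
  bounded_measurable (fun w => \sum_(i <- r) F i w).
Proof.
move=> bF; elim: r => [|i r IH].
  by under eq_fun do rewrite big_nil; exact: bm_cst.
by under eq_fun do rewrite big_cons; exact: bmD.
Qed.

Lemma bm_indic (A : set Omega) : measurable A -> bounded_measurable \1_A.
Proof.
move=> mA; split; first exact: measurable_indic.
by exists 1 => w; rewrite indicE; case: (_ \in _); rewrite ?normr1 ?normr0.
Qed.

Lemma expectD f g : bounded_measurable f -> bounded_measurable g ->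
  expect (fun w => f w + g w) = expect f + expect g.
Proof. by move=> bf bg; apply: RintegralD => //; exact: bounded_measurable_integrable. Qed.

Lemma expectZ c f : bounded_measurable f -> expect (fun w => c * f w) = c * expect f.
Proof. by move=> bf; apply: RintegralZl => //; exact: bounded_measurable_integrable. Qed.

Lemma expect_sum (I : Type) (r : seq I) (F : I -> Omega -> R) :
  (forall i, bounded_measurable (F i)) ->
  expect (fun w => \sum_(i <- r) F i w) = \sum_(i <- r) expect (F i).
Proof.
move=> bF; elim: r => [|i r IH].
  rewrite big_nil; under eq_fun do rewrite big_nil.
  by rewrite /expect /Rintegral integral0.
rewrite big_cons -IH -expectD //; last exact: bm_sum.
by congr expect; apply/funext => w; rewrite big_cons.
Qed.

Lemma expect_cst c : expect (fun=> c) = c.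
Proof.
rewrite /expect Rintegral_cst // -[RHS]mulr1; congr (_ * _).
by rewrite -[RHS]/(fine 1%:E); congr fine; exact: probability_setT.
Qed.

Lemma expectB f g : bounded_measurable f -> bounded_measurable g ->
  expect (fun w => f w - g w) = expect f - expect g.
Proof.
move=> bf bg; rewrite expectD //; last exact: bmN.
congr (_ + _); rewrite -mulN1r -expectZ //; congr expect; apply/funext => w.
by rewrite mulN1r.
Qed.

Lemma expect_indic (A : set Omega) : measurable A -> expect \1_A = fine (P A).
Proof. by move=> mA; rewrite /expect /Rintegral integral_indic // setIT. Qed.

Lemma expect_ge0 f : (forall w, 0 <= f w) -> 0 <= expect f.
Proof. by move=> f0; apply: Rintegral_ge0. Qed.

Lemma expect_le f g : bounded_measurable f -> bounded_measurable g ->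
  (forall w, f w <= g w) -> expect f <= expect g.
Proof.
move=> bf bg fg; rewrite -subr_ge0 -expectB //; apply: expect_ge0 => w.
by rewrite subr_ge0.
Qed.

Lemma norm_expect_le f K : bounded_measurable f -> (forall w, `|f w| <= K) ->
  `|expect f| <= K.
Proof.
move=> bf fK; rewrite ler_norml -{1}(expect_cst (- K)) -{2}(expect_cst K).
by apply/andP; split; apply: expect_le => //; try exact: bm_cst;
   move=> w; have := fK w; rewrite ler_norml => /andP[].
Qed.

(** Rounding down to a multiple of [K / N], written as a combination of indicators
    of upper level sets: those are the events to which mixing applies. *)
Definition step (N : nat) (K x : R) : R :=
  \sum_(l < N) (K / N%:R) * (K * l.+1%:R / N%:R <= x)%R%:R.

Lemma step_approx N K x : (0 < N)%N -> 0 <= x -> x <= K ->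
  0 <= x - step N K x <= K / N%:R.
Proof.
move=> N0 x0 xK.
have Nr : 0 < N%:R :> R by rewrite ltr0n.
have K0 : 0 <= K := le_trans x0 xK.
have h0 : 0 <= K / N%:R by rewrite divr_ge0 // ltW.
set h := K / N%:R in h0 *.
have main n : (n <= N)%N -> 
  let s := \sum_(l < n) h * (K * l.+1%:R / N%:R <= x)%R%:R in
  [/\ s <= x, s <= h * n%:R & s = h * n%:R \/ x - s < h ].
  elim: n => [|n IH] nN.
    rewrite big_ord0 mulr0; split=> //; left=> //.
  rewrite /= big_ord_recr /=.
  have [s1 s2 s3] := IH (ltnW nN).
  have hE : K * n.+1%:R / N%:R = h * n%:R + h.
    by rewrite /h -natr1 mulrDr mulr1 mulrDl mulrAC.
  have hS : h * n.+1%:R = h * n%:R + h by rewrite -natr1 mulrDr mulr1.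
  rewrite hE hS; case: (leP (h * n%:R + h) x) => hx; rewrite /= ?mulr1 ?mulr0 ?addr0.
    split; [lra|lra|].
    case: s3 => [->|]; [by left|move=> h3; right; lra].
  split=> //; first lra.
  by case: s3 => [s3|s3]; right=> //; lra.
have [s1 s2 s3] := main N (leqnn _); rewrite /step -/h.
move: s1 s2 s3 => /=; set s := \sum_(l < N) _ => s1 s2 s3.
rewrite subr_ge0 s1 /=; case: s3 => [->|/ltW//].
have -> : h * N%:R = K by rewrite /h divfK // gt_eqF.
lra.
Qed.

(** Covariance inequality for mixing events: both functions are averages of the
    indicators of their upper level sets, up to [1 / N]. *)
Lemma cov_level_sets_nonneg f g (K L a : R) : bounded_measurable f -> bounded_measurable g ->
  (forall w, 0 <= f w <= K) -> (forall w, 0 <= g w <= L) ->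
  (forall s t : R, `|expect (fun w => (s <= f w)%R%:R * (t <= g w)%R%:R)
     - expect (fun w => (s <= f w)%R%:R) * expect (fun w => (t <= g w)%R%:R)| <= a) ->
  `|expect (fun w => f w * g w) - expect f * expect g| <= K * L * a.
Proof.
move=> bf bg fK gL hst.
have ind_bm (h : Omega -> R) (s : R) : bounded_measurable h -> bounded_measurable (fun w => (s <= h w)%R%:R).
  move=> [mh _].
  have mA : measurable [set w | s <= h w].
    have := mh measurableT `[s, +oo[%classic (measurable_itv _); rewrite setTI.
    congr measurable; apply/seteqP; split=> w /=; rewrite in_itv /= andbT //.
  have -> : (fun w => (s <= h w)%R%:R) = \1_[set w | s <= h w] :> (Omega -> R).
    by apply/funext => w; rewrite indicE; congr (_%:R); rewrite mem_setE.
  exact: bm_indic.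
have step_bm h N M : bounded_measurable h -> bounded_measurable (fun w => step N M (h w)).
  by move=> bh; apply: bm_sum => l; apply: bmM; [exact: bm_cst|exact: ind_bm].
have expect_step h N M : bounded_measurable h -> expect (fun w => step N M (h w)) =
    \sum_(l < N) M / N%:R * expect (fun w => (M * l.+1%:R / N%:R <= h w)%R%:R).
  move=> bh; rewrite expect_sum; last first.
    by move=> l; apply: bmM; [exact: bm_cst|exact: ind_bm].
  by apply: eq_bigr => l _; rewrite expectZ //; exact: ind_bm.
(* the signs of [K], [L] and [a] are read off at a point of [Omega] *)
have [w0] : exists w0 : Omega, True.
  apply: contrapT => h0; have := probability_setT P.
  have -> : [set: Omega] = set0.
    by apply/seteqP; split=> // w _; apply: h0; exists w.
  by rewrite measure0 => /eqP; rewrite eqe eq_sym oner_eq0.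
move=> _.
have K0 : 0 <= K by have /andP[x y] := fK w0; exact: le_trans x y.
have L0 : 0 <= L by have /andP[x y] := gL w0; exact: le_trans x y.
have a0 : 0 <= a by apply: le_trans (hst 0 0).
have steps N : (0 < N)%N -> let fN := fun w => step N K (f w) in
    let gN := fun w => step N L (g w) in
    `|expect (fun w => fN w * gN w) - expect fN * expect gN| <= K * L * a.
  move=> N0 /=; set fN := fun w => step N K (f w); set gN := fun w => step N L (g w).
  have Nr : 0 < N%:R :> R by rewrite ltr0n.
  have -> : expect (fun w => fN w * gN w) = \sum_(l < N) \sum_(k < N)
      (K / N%:R * (L / N%:R)) * expect (fun w =>
        (K * l.+1%:R / N%:R <= f w)%R%:R * (L * k.+1%:R / N%:R <= g w)%R%:R).
    have -> : (fun w => fN w * gN w) = (fun w => \sum_(l < N) \sum_(k < N)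
      (K / N%:R * (L / N%:R)) *
        ((K * l.+1%:R / N%:R <= f w)%R%:R * (L * k.+1%:R / N%:R <= g w)%R%:R)).
      apply/funext => w; rewrite /fN /gN /step mulr_suml; apply: eq_bigr => l _.
      by rewrite mulr_sumr; apply: eq_bigr => k _; rewrite mulrACA.
    have bt (l k : 'I_N) : bounded_measurable (fun w =>
        (K * l.+1%:R / N%:R <= f w)%R%:R * (L * k.+1%:R / N%:R <= g w)%R%:R).
      by apply: bmM; exact: ind_bm.
    rewrite expect_sum; last first.
      by move=> l; apply: bm_sum => k; apply: bmM; [exact: bm_cst|exact: bt].
    apply: eq_bigr => l _; rewrite expect_sum; last first.
      by move=> k; apply: bmM; [exact: bm_cst|exact: bt].
    by apply: eq_bigr => k _; rewrite expectZ.
  rewrite !expect_step // mulr_suml -sumrB.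
  under eq_bigr do rewrite mulr_sumr -sumrB.
  apply: (@le_trans _ _ (\sum_(l < N) \sum_(k < N) (K / N%:R * (L / N%:R)) * a)).
    apply: le_trans (ler_norm_sum _ _ _) _; apply: ler_sum => l _.
    apply: le_trans (ler_norm_sum _ _ _) _; apply: ler_sum => k _.
    rewrite [X in _ - X]mulrACA -mulrBr normrM ger0_norm; last first.
      by rewrite mulr_ge0 // divr_ge0 // ltW.
    by apply: ler_wpM2l; [rewrite mulr_ge0 // divr_ge0 // ltW|exact: hst].
  have sum_cst (c : R) : \sum_(l < N) c = c * N%:R.
    by rewrite sumr_const card_ord mulr_natr.
  rewrite !sum_cst.
  rewrite le_eqVlt; apply/orP; left; apply/eqP; field; exact: lt0r_neq0.
have close N : (0 < N)%N ->
    `|expect (fun w => f w * g w) - expect f * expect g| <= K * L * a + 4 * K * L / N%:R.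
  move=> N0; have := steps N N0; move=> /=.
  set fN := fun w => step N K (f w); set gN := fun w => step N L (g w) => hN.
  have Nr : 0 < N%:R :> R by rewrite ltr0n.
  have bfN : bounded_measurable fN by exact: step_bm.
  have bgN : bounded_measurable gN by exact: step_bm.
  have fa w : 0 <= f w - fN w <= K / N%:R.
    by have /andP[x y] := fK w; exact: step_approx.
  have ga w : 0 <= g w - gN w <= L / N%:R.
    by have /andP[x y] := gL w; exact: step_approx.
  have fN0 w : 0 <= fN w.
    by apply: sumr_ge0 => l _; rewrite mulr_ge0 // divr_ge0 // ltW.
  have gN0 w : 0 <= gN w.
    by apply: sumr_ge0 => l _; rewrite mulr_ge0 // divr_ge0 // ltW.
  set hK := K / N%:R in fa *; set hL := L / N%:R in ga *.
  have hK0 : 0 <= hK by rewrite divr_ge0 // ltW.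
  have hL0 : 0 <= hL by rewrite divr_ge0 // ltW.
  have -> : 4 * K * L / N%:R = 2 * K * hL + 2 * L * hK by rewrite /hK /hL; ring.
  have d1 : `|expect (fun w => f w * g w) - expect (fun w => fN w * gN w)| <=
      K * hL + L * hK.
    rewrite -expectB; [|exact: bmM..].
    apply: norm_expect_le.
      by apply: bmD; [exact: bmM|apply: bmN; exact: bmM].
    move=> w; have /andP[f0 f1] := fK w; have /andP[g0 g1] := gL w.
    have /andP[fa0 fa1] := fa w; have /andP[ga0 ga1] := ga w.
    have := fN0 w; have := gN0 w; move: (f w) (g w) (fN w) (gN w) f0 f1 g0 g1 fa0 fa1 ga0 ga1.
    move=> x y u v *; have -> : x * y - u * v = x * (y - v) + v * (x - u) by ring.
    rewrite ger0_norm; last by rewrite addr_ge0 // mulr_ge0.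
    by apply: lerD; apply: ler_pM => //; lra.
  have ex h M : bounded_measurable h -> (forall w, 0 <= h w <= M) ->
      0 <= expect h <= M.
    move=> bh hM; rewrite expect_ge0 => [|w]; last by have /andP[] := hM w.
    rewrite -[M](expect_cst) /=; apply: expect_le => //; first exact: bm_cst.
    by move=> w; have /andP[] := hM w.
  have /andP[f0 f1] := ex _ _ bf fK; have /andP[g0 g1] := ex _ _ bg gL.
  have [bfd bgd] : bounded_measurable (fun w => f w - fN w) /\
      bounded_measurable (fun w => g w - gN w).
    by split; apply: bmD => //; exact: bmN.
  have := ex _ _ bfd fa; have := ex _ _ bgd ga; rewrite !expectB //.
  move=> /andP[ga0 ga1] /andP[fa0 fa1].
  have v0 : 0 <= expect gN by apply: expect_ge0.
  have d2 : `|expect fN * expect gN - expect f * expect g| <= K * hL + L * hK.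
    move: (expect f) (expect g) (expect fN) (expect gN) f0 f1 g0 g1 fa0 fa1 ga0 ga1 v0.
    move=> x y u v *; rewrite distrC.
    have -> : x * y - u * v = x * (y - v) + v * (x - u) by ring.
    rewrite ger0_norm; last by rewrite addr_ge0 // mulr_ge0.
    by apply: lerD; apply: ler_pM => //; lra.
  have -> : expect (fun w => f w * g w) - expect f * expect g =
      (expect (fun w => f w * g w) - expect (fun w => fN w * gN w)) +
      (expect (fun w => fN w * gN w) - expect fN * expect gN) +
      (expect fN * expect gN - expect f * expect g) by ring.
  have n1 := ler_normD (expect (fun w => f w * g w) - expect (fun w => fN w * gN w) +
      (expect (fun w => fN w * gN w) - expect fN * expect gN))
      (expect fN * expect gN - expect f * expect g).
  have n2 := ler_normD (expect (fun w => f w * g w) - expect (fun w => fN w * gN w))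
      (expect (fun w => fN w * gN w) - expect fN * expect gN).
  apply: le_trans n1 _; lra.
apply/ler_addgt0Pr => e e0.
have c0 : 0 <= 4 * K * L by rewrite !mulr_ge0.
pose N := (Num.truncn (e^-1 * (4 * K * L))).+1.
apply: le_trans (close N _) _ => //; rewrite lerD2l.
rewrite ler_pdivrMr ?ltr0n // -ler_pdivrMl //.
by apply: ltW; exact: truncnS_gt.
Qed.

(** A translation reduces to nonnegative functions; it changes neither the
    covariance nor the family of level sets. *)
Lemma covariance_inequality f g (K L a : R) : bounded_measurable f -> bounded_measurable g ->
  (forall w, `|f w| <= K) -> (forall w, `|g w| <= L) ->
  (forall s t : R, `|expect (fun w => (s <= f w)%R%:R * (t <= g w)%R%:R)
     - expect (fun w => (s <= f w)%R%:R) * expect (fun w => (t <= g w)%R%:R)| <= a) ->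
  `|expect (fun w => f w * g w) - expect f * expect g| <= 4 * K * L * a.
Proof.
move=> bf bg fK gL hst.
have bf' : bounded_measurable (fun w => f w + K) by apply: bmD => //; exact: bm_cst.
have bg' : bounded_measurable (fun w => g w + L) by apply: bmD => //; exact: bm_cst.
have cK : bounded_measurable (fun=> K) by exact: bm_cst.
have cL : bounded_measurable (fun=> L) by exact: bm_cst.
have E1 : expect (fun w => (f w + K) * (g w + L)) =
    expect (fun w => f w * g w) + L * expect f + (K * expect g + K * L).
  have -> : (fun w => (f w + K) * (g w + L)) =
      (fun w => (f w * g w + L * f w) + (K * g w + K * L)).
    by apply/funext => w; ring.
  have bLf : bounded_measurable (fun w => L * f w) by exact: bmM.
  have bKg : bounded_measurable (fun w => K * g w) by exact: bmM.
  have bKL : bounded_measurable (fun=> K * L) by exact: bmM.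
  have bfg : bounded_measurable (fun w => f w * g w) by exact: bmM.
  have b1 : bounded_measurable (fun w => f w * g w + L * f w) by exact: bmD.
  have b2 : bounded_measurable (fun w => K * g w + K * L) by exact: bmD.
  by rewrite !expectD // !expectZ // expect_cst.
have E2 : expect (fun w => f w + K) = expect f + K by rewrite expectD // expect_cst.
have E3 : expect (fun w => g w + L) = expect g + L by rewrite expectD // expect_cst.
have := @cov_level_sets_nonneg (fun w => f w + K) (fun w => g w + L) (2 * K) (2 * L) a
  bf' bg'; rewrite E1 E2 E3.
have -> : expect (fun w => f w * g w) + L * expect f + (K * expect g + K * L) -
    (expect f + K) * (expect g + L) =
    expect (fun w => f w * g w) - expect f * expect g by ring.
have -> : 2 * K * (2 * L) * a = 4 * K * L * a by ring.
apply.
- by move=> w; have := fK w; rewrite ler_norml => /andP[x y]; apply/andP; split; lra.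
- by move=> w; have := gL w; rewrite ler_norml => /andP[x y]; apply/andP; split; lra.
- move=> s t; have := hst (s - K) (t - L).
  have Ef w : (s - K <= f w) = (s <= f w + K) by rewrite lerBlDr.
  have Eg w : (t - L <= g w) = (t <= g w + L) by rewrite lerBlDr.
  have F : (fun w => (s - K <= f w)%R%:R) = (fun w => (s <= f w + K)%R%:R) :> (Omega -> R).
    by apply/funext => w; rewrite Ef.
  have Gg : (fun w => (t - L <= g w)%R%:R) = (fun w => (t <= g w + L)%R%:R) :> (Omega -> R).
    by apply/funext => w; rewrite Eg.
  have FG : (fun w => (s - K <= f w)%R%:R * (t - L <= g w)%R%:R) =
      (fun w => (s <= f w + K)%R%:R * (t <= g w + L)%R%:R) :> (Omega -> R).
    by apply/funext => w; rewrite Ef Eg.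
  by rewrite F Gg FG.
Qed.
End BoundedMeasurable.
(** * Conditional expectations *)

Section CondExp.
Context (R : realType) (dO : measure_display) (Omega : measurableType dO).
Variable P : probability Omega R.
Local Notation bm := (@bounded_measurable R dO Omega).
Local Notation expect := (expect P).

Lemma covariance_mixing (FU FV : set (set Omega)) f g K L (a : R) :
  (forall A, FU A -> measurable A) -> (forall A, FV A -> measurable A) ->
  bm f -> bm g -> (forall w, `|f w| <= K) -> (forall w, `|g w| <= L) ->
  (forall s, FU [set w | s <= f w]) -> (forall s, FV [set w | s <= g w]) ->
  (forall A B, FU A -> FV B -> (`|P (A `&` B) - P A * P B| <= a%:E)%E) ->
  `|expect (fun w => f w * g w) - expect f * expect g| <= 4 * K * L * a.
Proof.
move=> mFU mFV bf bg fK gL fU gV h.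
apply: (covariance_inequality bf bg fK gL) => s t.
have indE (u : Omega -> R) (r : R) :
    (fun w => (r <= u w)%R%:R) = \1_[set w | r <= u w] :> (Omega -> R).
  by apply/funext => w; rewrite indicE; congr (_%:R); rewrite mem_setE.
set A := [set w | s <= f w]; set B := [set w | t <= g w].
have mA : measurable A by exact/mFU/fU.
have mB : measurable B by exact/mFV/gV.
have -> : (fun w => (s <= f w)%R%:R * (t <= g w)%R%:R) = \1_(A `&` B) :> (Omega -> R).
  rewrite indicI; apply/funext => w /=.
  by rewrite -(congr1 (@^~ w) (indE f s)) -(congr1 (@^~ w) (indE g t)).
rewrite !indE !expect_indic //; last exact: measurableI.
have fin C : measurable C -> P C \is a fin_num by move=> mC; exact: fin_num_measure.
have := h A B (fU s) (gV t).
rewrite -(fineK (fin _ (measurableI _ _ mA mB))) -(fineK (fin _ mA)) -(fineK (fin _ mB)).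
by rewrite -EFinM -EFinB /= lee_fin.
Qed.

Section SubAlgebra.
Variable Gen : set (set Omega).
Hypothesis Gen_measurable : Gen `<=` measurable.
Local Notation G := <<s Gen >>.
Local Notation T' := (g_sigma_algebraType Gen).

Lemma sub_sigma_measurable : G `<=` measurable.
Proof. by apply: smallest_sub => //; exact: sigma_algebra_measurable. Qed.

Lemma sub_measurable_fun (f : Omega -> R) :
  measurable_fun setT (f : T' -> R) -> measurable_fun setT f.
Proof.
move=> mf _ B mB; apply: sub_sigma_measurable.
by have := mf measurableT B mB.
Qed.

Lemma sub_level_set (f : Omega -> R) s :
  measurable_fun setT (f : T' -> R) -> G [set w | s <= f w].
Proof.
move=> mf; have := mf measurableT `[s, +oo[%classic (measurable_itv _).
rewrite setTI; congr G; apply/seteqP; split=> w /=; by rewrite in_itv /= andbT.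
Qed.

(** The event where one version exceeds the other belongs to [G], and the
    difference has a zero integral over it. *)
Lemma is_cond_exp_unique f g1 g2 : is_cond_exp P G f g1 -> is_cond_exp P G f g2 ->
  {ae P, forall w, g1 w = g2 w}.
Proof.
have half g h : is_cond_exp P G f g -> is_cond_exp P G f h ->
    {ae P, forall w, g w <= h w}.
  move=> [mg ig Eg] [mh ih Eh].
  have mg' : measurable_fun setT (g : T' -> R).
    by move=> _ B mB; rewrite setTI; exact: mg.
  have mh' : measurable_fun setT (h : T' -> R).
    by move=> _ B mB; rewrite setTI; exact: mh.
  pose A := [set w | h w < g w].
  have GA : G A.
    have := measurable_funB mg' mh' measurableT (measurable_itv `]0, +oo[).
    rewrite setTI; congr G; apply/seteqP; split=> w /=;
      by rewrite in_itv /= andbT subr_gt0.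
  have mA : measurable A := sub_sigma_measurable GA.
  have iA (u : Omega -> R) : P.-integrable setT (EFin \o u) ->
      P.-integrable A (EFin \o u).
    by move=> iu; apply: integrableS iu.
  have I0 : (\int[P]_(w in A) (g w - h w)%:E = 0)%E.
    under eq_integral do rewrite EFinB.
    rewrite integralB //=; [|exact: iA..].
    rewrite Eg // Eh // subee //.
    have := integrable_fin_num mA (iA _ ih); by rewrite /= Eh.
  have m1 : measurable_fun A (EFin \o (fun w => g w - h w)).
    apply/measurable_EFinP; apply: measurable_funTS; apply: measurable_funB.
      exact: sub_measurable_fun.
    exact: sub_measurable_fun.
  have : ae_eq P A (EFin \o (fun w => g w - h w)) (cst 0%E).
    apply/(ae_eq_integral_abs P mA m1); rewrite -[RHS]I0.
    apply: eq_integral => w; rewrite inE /A /= => hw.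
    by rewrite ger0_norm // subr_ge0 ltW.
  apply: filterS => w /= hw; rewrite leNgt; apply/negP => Aw.
  by have := hw Aw => -[] /eqP; rewrite subr_eq0 gt_eqF.
move=> h1 h2; have a1 := half _ _ h1 h2; have a2 := half _ _ h2 h1.
by apply: filterS2 a1 a2 => w x y; apply/eqP; rewrite eq_le x y.
Qed.

Lemma integral_indic_expect (f : Omega -> R) A : bm f -> measurable A ->
  (\int[P]_(w in A) (f w)%:E = (expect (fun w => f w * \1_A w))%:E)%E.
Proof.
move=> bf mA; rewrite -expectE; last by apply: bmM => //; exact: bm_indic.
rewrite integral_mkcond; apply: eq_integral => w _.
by rewrite patchE indicE; case: (w \in A); rewrite ?mulr1 ?mulr0.
Qed.

(** The variable [f] may be unbounded on a null set, where it is replaced by the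
    bounded [f']; then integrability is automatic. *)
Lemma cond_expE f f' g : measurable_fun setT f -> bm f' ->
  {ae P, forall w, f w = f' w} -> measurable_fun setT (g : T' -> R) -> bm g ->
  (forall A, G A ->
    expect (fun w => g w * \1_A w) = expect (fun w => f' w * \1_A w)) ->
  {ae P, forall w, cond_exp P G f w = g w} /\
  measurable_fun setT (cond_exp P G f).
Proof.
move=> mf bf' ff' mg bg Eg.
have ce : is_cond_exp P G f g.
  split.
  - by move=> B mB; have := mg measurableT B mB; rewrite setTI.
  - exact: bounded_measurable_integrable.
  - move=> A GA; have mA := sub_sigma_measurable GA.
    rewrite integral_indic_expect // Eg // -integral_indic_expect //.
    apply: ae_eq_integral => //.
    + by apply/measurable_EFinP; apply: measurable_funTS; case: bf'.
    + by apply/measurable_EFinP; exact: measurable_funTS.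
    + by apply: filterS ff' => w -> .
have ce' : is_cond_exp P G f (cond_exp P G f).
  by rewrite /cond_exp; apply: (@xgetPex _ _ [set g | is_cond_exp P G f g]); exists g.
split; first exact: is_cond_exp_unique ce' ce.
apply: sub_measurable_fun => _ B mB; rewrite setTI.
by case: ce' => h _ _; exact: h.
Qed.
End SubAlgebra.
End CondExp.
(** * Summability of polynomial decay over the grid *)

Section PowerSums.
Variable R : realType.

Lemma powRN_le (x y s : R) : 0 < x -> x <= y -> 0 <= s ->
  y `^ (- s) <= x `^ (- s).
Proof.
move=> x0 xy s0; have y0 := lt_le_trans x0 xy.
rewrite !powRN lef_pV2 ?posrE ?powR_gt0 //.
by rewrite ge0_ler_powR // nnegrE ltW.
Qed.

(** A discrete form of the derivative of [y^(1 - s)], which makes the sums of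
    [y^(- s)] telescope; it comes from [1 + x <= exp x] and [ln (1 + x) <= x]. *)
Lemma powR_telescope (s y : R) : 1 < s -> 0 < y ->
  (s - 1) * (y + 1) `^ (- s) <= y `^ (1 - s) - (y + 1) `^ (1 - s).
Proof.
move=> s1 y0; have y1 : 0 < y + 1 by rewrite addr_gt0.
set a := s - 1; have a0 : 0 < a by rewrite subr_gt0.
have t0 : 0 < y / (y + 1) by rewrite divr_gt0.
have E1 : (y + 1) `^ (1 - s) = (y + 1) * (y + 1) `^ (- s).
  rewrite powRD; last by rewrite (gt_eqF y1) implybT.
  by rewrite powRr1 // ltW.
have E2 : y `^ (1 - s) = (y / (y + 1)) `^ (1 - s) * (y + 1) `^ (1 - s).
  by rewrite -powRM ?(ltW t0) ?(ltW y1) // divfK // gt_eqF.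
have E3 : 1 + a / (y + 1) <= (y / (y + 1)) `^ (1 - s).
  rewrite /powR gt_eqF //; apply: le_trans (expR_ge1Dx _).
  have -> : 1 - s = - a by rewrite opprB.
  rewrite lerD2l mulNr -mulrN ler_pM2l // lerNr.
  have -> : y / (y + 1) = 1 + (- (y + 1)^-1) by field; exact: lt0r_neq0.
  apply: le_ln1Dx; rewrite ltrN2 invf_lt1 // ltrDr //.
have P0 : 0 <= (y + 1) `^ (- s) by exact: powR_ge0.
rewrite E2 -[X in _ - X]mul1r -mulrBl E1 mulrA; apply: ler_wpM2r => //.
rewrite -ler_pdivrMr // lerBrDl //.
Qed.

Lemma sum_powR_le (s : R) N : 1 < s ->
  \sum_(x < N) (1 + x%:R) `^ (- s) <= 1 + (s - 1)^-1.
Proof.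
move=> s1; have a0 : 0 < s - 1 by rewrite subr_gt0.
have ai0 : 0 < (s - 1)^-1 by rewrite invr_gt0.
case: N => [|N]; first by rewrite big_ord0 addr_ge0 // ltW.
suff h : \sum_(x < N.+1) (1 + x%:R) `^ (- s) <=
    1 + (s - 1)^-1 * (1 - (N.+1%:R : R) `^ (1 - s)).
  apply: le_trans h _; rewrite lerD2l ler_piMr // ?ltW // gerBl; exact: powR_ge0.
elim: N => [|N IH].
  by rewrite big_ord_recl big_ord0 !addr0 !powR1 subrr mulr0 addr0.
rewrite big_ord_recr /=; apply: le_trans (lerD IH (lexx _)) _.
have := @powR_telescope s N.+1%:R s1 (ltr0Sn _ _); rewrite natr1.
have -> : 1 + N.+1%:R = N.+2%:R :> R by rewrite addrC natr1.
move=> h; rewrite -addrA lerD2l -lerBrDl -mulrBr.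
rewrite mulrC ler_pdivlMr // mulrC; apply: le_trans h _; lra.
Qed.

Lemma sum_powR_dist_le (s : R) N b : 1 < s -> (b < N)%N ->
  \sum_(a < N) (1 + (b - a + (a - b))%N%:R) `^ (- s) <= 2 * (1 + (s - 1)^-1).
Proof.
move=> s1 bN; have s0 : 0 <= s by rewrite ltW // (lt_trans ltr01).
rewrite -(big_mkord xpredT (fun a => (1 + (b - a + (a - b))%N%:R : R) `^ (- s))).
rewrite (big_cat_nat (n := b)) ?(ltnW bN) //= mulrDl mul1r; apply: lerD.
  apply: le_trans (@sum_powR_le s b s1); rewrite big_nat_rev /= big_mkord.
  apply: ler_sum => a _; have ab := ltn_ord a; apply: powRN_le => //.
  by rewrite lerD2l ler_nat; lia.
apply: le_trans (@sum_powR_le s (N - b) s1).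
rewrite -{1}[b]add0n big_addn big_mkord; apply: ler_sum => a _; apply: powRN_le => //.
by rewrite lerD2l ler_nat; lia.
Qed.

End PowerSums.

Section Grid.
Variable R : realType.

Definition grid_digit n d i k := ((i %/ n ^ (d - k.+1)) %% n)%N.

Lemma base_digits_inj n d i j : (0 < n)%N -> (i < n ^ d)%N -> (j < n ^ d)%N ->
  (forall k, (k < d)%N -> (i %/ n ^ k %% n = j %/ n ^ k %% n)%N) -> i = j.
Proof.
move=> n0; elim: d => [|d IH] in i j *.
  by rewrite expn0 !ltnS !leqn0 => /eqP -> /eqP ->.
rewrite expnSr -!ltn_divLR // => id jd h.
have /= := h 0%N isT; rewrite expn0 !divn1 => h0.
rewrite (divn_eq i n) (divn_eq j n) h0; congr (_ * _ + _)%N.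
by apply: IH => // k kd; have := h k.+1 kd; rewrite expnS !divnMA.
Qed.

Lemma grid_digit_inj n d (i j : 'I_(n ^ d)) : (0 < n)%N ->
  (forall k : 'I_d, grid_digit n d i k = grid_digit n d j k) -> i = j.
Proof.
move=> n0 h; apply: val_inj; apply: (base_digits_inj n0 (ltn_ord i) (ltn_ord j)).
move=> k kd; have dk : (d - k.+1 < d)%N by lia.
have := h (Ordinal dk); rewrite /grid_digit /=.
by have -> : (d - (d - k.+1).+1 = k)%N by lia.
Qed.

(** Sites are injected into the functions from the [d] coordinates to the [n]
    digits, over which a sum of products is a product of sums. *)
Lemma sum_grid_le n d (phi : nat -> nat -> R) (B : R) (i : 'I_(n ^ d)) : (0 < n)%N ->
  (forall a b, 0 <= phi a b) ->
  (forall b, (b < n)%N -> \sum_(a < n) phi b a <= B) ->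
  \sum_(j < n ^ d) \prod_(k < d) phi (grid_digit n d i k) (grid_digit n d j k)
    <= B ^+ d.
Proof.
move=> n0 phi0 phiB.
have dig j k : (grid_digit n d j k < n)%N by exact: ltn_pmod.
pose g (j : 'I_(n ^ d)) : {ffun 'I_d -> 'I_n} := [ffun k : 'I_d => Ordinal (dig j k)].
have g_inj : injective g.
  move=> j1 j2 e; apply: grid_digit_inj => // k.
  by have := congr1 (fun f : {ffun 'I_d -> 'I_n} => val (f k)) e; rewrite !ffunE.
pose F (f : {ffun 'I_d -> 'I_n}) := \prod_(k < d) phi (grid_digit n d i k) (f k).
have F0 f : 0 <= F f by apply: prodr_ge0.
have -> : \sum_(j < n ^ d) \prod_(k < d) phi (grid_digit n d i k) (grid_digit n d j k) =
    \sum_(f in g @: finset.setTfor 'I_(n ^ d)) F f.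
  rewrite big_imset /=; last by move=> ? ? _ _; exact: g_inj.
  apply: eq_big => [j|j _]; first by rewrite inE.
  by apply: eq_bigr => k _; rewrite ffunE.
apply: (@le_trans _ _ (\sum_f F f)).
  by rewrite [leRHS](bigID (mem (g @: finset.setTfor 'I_(n ^ d)))) /= lerDl sumr_ge0.
rewrite /F -(bigA_distr_bigA (fun (k : 'I_d) (a : 'I_n) => phi (grid_digit n d i k) a)).
rewrite -[X in B ^+ X]card_ord -prodr_const; apply: ler_prod => k _.
by rewrite sumr_ge0 //= phiB.
Qed.

Lemma grid_site_digit n d (i : 'I_(n ^ d)) k :
  @grid_site d n i 0 k = (grid_digit n d i k).+1%:Z.
Proof. by rewrite mxE. Qed.

Lemma normr_intB_nat a b : `|(a.+1%:Z - b.+1%:Z)%:~R| = (a - b + (b - a))%N%:R :> R.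
Proof.
have -> : a.+1%:Z - b.+1%:Z = a%:Z - b%:Z by lia.
have [ab|ba] := leqP a b.
  have -> : a%:Z - b%:Z = - ((a - b + (b - a))%N : int) by lia.
  by rewrite rmorphN normrN normr_nat.
have -> : a%:Z - b%:Z = ((a - b + (b - a))%N : int) by lia.
by rewrite normr_nat.
Qed.

(** The Euclidean distance dominates each coordinate, so that its polynomial
    decay splits into a product over the coordinates. *)
Lemma dist_site_decay d (theta : R) (i j : 'rV[int]_d) : (0 < d)%N -> 0 <= theta ->
  (1 + dist_site R i j) `^ (- theta) <=
    \prod_(k < d) (1 + `|(i 0 k - j 0 k)%:~R|) `^ (- (theta / d%:R)).
Proof.
move=> d0 th0; have dr : 0 < d%:R :> R by rewrite ltr0n.
have D0 : 0 <= dist_site R i j by exact: sqrtr_ge0.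
have -> : (1 + dist_site R i j) `^ (- theta) =
    \prod_(k < d) (1 + dist_site R i j) `^ (- (theta / d%:R)).
  rewrite prodr_const card_ord -powR_mulrn ?powR_ge0 // -powRrM; congr (_ `^ _).
  by rewrite mulNr divfK // gt_eqF.
apply: ler_prod => k _; rewrite powR_ge0 /=; apply: powRN_le.
- by rewrite ltr_pwDl.
- rewrite lerD2l -sqrtr_sqr ler_wsqrtr // (bigD1 k) //= lerDl.
  by apply: sumr_ge0 => l _; rewrite sqr_ge0.
- by rewrite divr_ge0 // ltW.
Qed.

Lemma sum_dist_site_decay n d (theta : R) (i : 'I_(n ^ d)) : (0 < n)%N -> (0 < d)%N ->
  d%:R < theta ->
  \sum_(j < n ^ d) (1 + dist_site R (@grid_site d n i) (@grid_site d n j)) `^ (- theta)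
    <= (2 * (1 + (theta / d%:R - 1)^-1)) ^+ d.
Proof.
move=> n0 d0 dth; have dr : 0 < d%:R :> R by rewrite ltr0n.
have th0 : 0 <= theta by rewrite ltW // (lt_trans dr).
have s1 : 1 < theta / d%:R by rewrite ltr_pdivlMr // mul1r.
pose phi a b : R := (1 + (a - b + (b - a))%N%:R) `^ (- (theta / d%:R)).
apply: le_trans (@sum_grid_le n d phi _ i n0 _ _).
- apply: ler_sum => j _; apply: le_trans (dist_site_decay _ _ d0 th0) _.
  rewrite le_eqVlt; apply/orP; left; apply/eqP; apply: eq_bigr => k _.
  by rewrite !grid_site_digit normr_intB_nat.
- by move=> a b; exact: powR_ge0.
- by move=> b bn; exact: sum_powR_dist_le.
Qed.

End Grid.
(** * Covariances of the errors *)

Section Clamp.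
Variable R : realType.

(** Truncation turns an almost sure bound into a sure one. *)
Definition clamp (M x : R) : R := Num.max (- M) (Num.min M x).

Lemma clamp_norm M x : 0 <= M -> `|clamp M x| <= M.
Proof.
move=> M0; rewrite /clamp ler_norml le_max lexx /=.
by rewrite ge_max ge_min lexx /= andbT (le_trans _ M0) // oppr_le0.
Qed.

Lemma clamp_id M x : `|x| <= M -> clamp M x = x.
Proof. by rewrite ler_norml /clamp => /andP[x1 x2]; rewrite min_r // max_r. Qed.

Lemma measurable_clamp M : measurable_fun setT (clamp M).
Proof.
apply: measurable_maxr; first exact: measurable_cst.
by apply: measurable_minr; [exact: measurable_cst|exact: measurable_id].
Qed.
End Clamp.

Section SigmaOf.
Context (R : realType) (dO : measure_display) (Omega : measurableType dO).
Context (I : Type) (dS : measure_display) (S : measurableType dS).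
Variable Z : I -> Omega -> S.

Lemma sigma_of_preimage (L : set I) i B : L i -> measurable B ->
  sigma_of Z L (Z i @^-1` B).
Proof.
move=> Li mB; apply: sub_gen_smallest; exists i => //.
by exists B => //; rewrite setTI.
Qed.

Lemma sigma_of_mono (L1 L2 : set I) : L1 `<=` L2 -> sigma_of Z L1 `<=` sigma_of Z L2.
Proof.
move=> L12; apply: sub_smallest2r; last first.
  by apply: bigcup_subset.
exact: smallest_sigma_algebra.
Qed.

Lemma sigma_gen_measurable (L : set I) : (forall i, measurable_fun setT (Z i)) ->
  \bigcup_(i in L) g_sigma_algebra_preimage (Z i) `<=` measurable.
Proof. by move=> mZ A [i Li [B mB <-]]; exact: mZ. Qed.

Lemma sigma_of_measurable (L : set I) : (forall i, measurable_fun setT (Z i)) ->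
  sigma_of Z L `<=` measurable.
Proof. by move=> mZ; apply: sub_sigma_measurable; exact: sigma_gen_measurable. Qed.

Lemma sigma_of_measurable_fun (L : set I) i dT (T : measurableType dT) (h : S -> T) :
  L i -> measurable_fun setT h ->
  measurable_fun setT ((h \o Z i) : g_sigma_algebraType
    (\bigcup_(i in L) g_sigma_algebra_preimage (Z i)) -> T).
Proof.
move=> Li mh _ B mB; rewrite setTI; apply: (@sigma_of_preimage L i (h @^-1` B)) => //.
by rewrite -[X in measurable X]setTI; exact: mh.
Qed.
End SigmaOf.

Section ErrorCovariance.
Context (R : realType) (dO : measure_display) (Omega : measurableType dO).
Variable P : probability Omega R.
Variables (d : nat) (eps : 'rV[int]_d -> {RV P >-> R}) (M theta sigma : R).
Hypotheses (d0 : (0 < d)%N) (M0 : 0 < M) (htheta : d%:R < theta).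
Local Notation expect := (expect P).
Local Notation e i := (fun w => clamp M (eps i w)).

Lemma bm_clamp (X : {RV P >-> R}) : bounded_measurable (fun w => clamp M (X w)).
Proof.
split; last by exists M => w; apply: clamp_norm; exact: ltW.
apply: (measurableT_comp (measurable_clamp M)); exact: measurable_funPT.
Qed.

Lemma ae_clamp i : {ae P, forall w,
     (ereal_sup [set `|eps i w|%:E | i in setT] < M%:E)%E} ->
  {ae P, forall w, eps i w = clamp M (eps i w)}.
Proof.
apply: filterS => w h; rewrite clamp_id // -lee_fin; apply: le_trans (ltW h).
by apply: ereal_sup_ubound; exists i.
Qed.

Lemma expect_clamp i : {ae P, forall w, eps i w = clamp M (eps i w)} ->
  ('E_P[eps i] = 0)%E -> expect (e i) = 0.
Proof.
move=> ae; rewrite expectation_def => E0; apply: EFin_inj; rewrite -expectE; last exact: bm_clamp.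
rewrite -[RHS]E0; apply: ae_eq_integral => //.
- by apply/measurable_EFinP; case: (bm_clamp (eps i)).
- by apply/measurable_EFinP; exact: measurable_funPT.
- by apply: filterS ae => w h _; rewrite -h.
Qed.

Lemma expect_clamp_sqr i : {ae P, forall w, eps i w = clamp M (eps i w)} ->
  ('E_P[eps i] = 0)%E -> ('V_P[eps i] = (sigma ^+ 2)%:E)%E ->
  expect (fun w => e i w * e i w) = sigma ^+ 2.
Proof.
move=> ae E0; rewrite /variance unlock E0 /= unlock => V.
have bb := bm_clamp (eps i).
apply: EFin_inj; rewrite -expectE; last exact: bmM.
rewrite -[RHS]V.
have -> : (\int[P]_w (((eps i \- cst 0) * (eps i \- cst 0)) w)%:E =
    \int[P]_w (eps i w * eps i w)%:E)%E.
  by apply: eq_integral => w _; rewrite !fctE /= !subr0.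
apply: ae_eq_integral => //.
- by apply/measurable_EFinP; apply: measurable_funM; case: bb.
- by apply/measurable_EFinP; apply: measurable_funM; exact: measurable_funPT.
- by apply: filterS ae => w h _; rewrite -h.
Qed.

(** At large distances the mixing rate enters through the covariance inequality;
    at bounded distances the trivial bound is absorbed in the constant. *)
Lemma covariance_decay : polynomially_mixing P eps theta ->
  exists2 K, 0 < K & forall i j,
    `|expect (fun w => e i w * e j w) - expect (e i) * expect (e j)| <=
      K * (1 + dist_site R i j) `^ (- theta).
Proof.
move=> [K0 [A [_ hA]]].
pose u1 := Num.max 1 (A + 1).
pose K := 4 * M * M * `|K0| * 2 `^ theta + (2 * M ^+ 2) * (1 + u1) `^ theta.
have th0 : 0 < theta by apply: lt_trans htheta; rewrite ltr0n.
have u10 : 0 < u1 by rewrite lt_max ltr01.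
have M2 : 0 < M ^+ 2 by rewrite exprn_gt0.
have Kp : 0 < K.
  rewrite ltr_wpDl // ?mulr_gt0 ?powR_gt0 ?addr_gt0 //.
  by rewrite !mulr_ge0 // ?powR_ge0 // ltW.
exists K => // i j; set D := dist_site R i j.
have D0 : 0 <= D by exact: sqrtr_ge0.
have D1 : 0 < 1 + D by rewrite ltr_pwDl.
have pw0 : 0 < (1 + D) `^ (- theta) by rewrite powR_gt0.
have [Du|uD] := leP u1 D; last first.
  have cov : `|expect (fun w => e i w * e j w) - expect (e i) * expect (e j)| <= 2 * M ^+ 2.
    have n1 : `|expect (fun w => e i w * e j w)| <= M ^+ 2.
      apply: norm_expect_le; first by apply: bmM; exact: bm_clamp.
      by move=> w; rewrite normrM expr2 ler_pM // clamp_norm // ltW.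
    have n2 k : `|expect (e k)| <= M.
      apply: norm_expect_le; first exact: bm_clamp.
      by move=> w; rewrite clamp_norm // ltW.
    apply: le_trans (ler_normB _ _) _; rewrite mulrDl mul1r lerD // normrM expr2.
    by rewrite ler_pM.
  apply: le_trans cov _; apply: (@le_trans _ _ ((2 * M ^+ 2) * (1 + u1) `^ theta *
      (1 + D) `^ (- theta))); last first.
    apply: ler_wpM2r; first exact: ltW.
    by rewrite /K lerDr !mulr_ge0 // ?powR_ge0 // ltW.
  rewrite -mulrA ler_peMr //; first by rewrite mulr_ge0 // ltW.
  rewrite powRN -[X in X <= _](@divff _ ((1 + D) `^ theta)) ?gt_eqF ?powR_gt0 //.
  apply: ler_wpM2r; first by rewrite invr_ge0 powR_ge0.
  rewrite ge0_ler_powR // ?nnegrE ?ltW // ?addr_gt0 //.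
  by rewrite ltrD2l.
have AD : A < D.
  by apply: lt_le_trans Du; rewrite lt_max ltrDl ltr01 orbT.
have D1' : 1 <= D by apply: le_trans Du; rewrite le_max lexx.
have mix B C : sigma_of eps [set i] B -> sigma_of eps [set j] C ->
    (`|P (B `&` C) - P B * P C| <= (`|K0| * D `^ (- theta))%:E)%E.
  move=> sB sC.
  have a1 : (`|P (B `&` C) - P B * P C| <=
      alpha_mixing P (sigma_of eps [set i]) (sigma_of eps [set j]))%E.
    by apply: ereal_sup_ubound; exists B => //; exists C.
  apply: le_trans a1 _.
  apply: (@le_trans _ _ (alpha_1oo P eps D)).
    apply: ereal_sup_ubound; exists i, [set j]; split=> //.
    apply: le_ereal_inf_tmp => x [k -> [l -> <-]]; rewrite lee_fin /D /dist_site.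
    rewrite le_eqVlt; apply/orP; left; apply/eqP; congr Num.sqrt.
    by apply: eq_bigr => t _; rewrite -opprB rmorphN sqrrN.
  apply: le_trans (hA D AD) _; rewrite lee_fin; apply: ler_wpM2r; first exact: powR_ge0.
  exact: ler_norm.
have me i' : measurable_fun setT (eps i') by exact: measurable_funPT.
have lev k s : sigma_of eps [set k] [set w | s <= e k w].
  have -> : [set w | s <= e k w] = eps k @^-1` ((@clamp R M) @^-1` `[s, +oo[).
    by apply/seteqP; split=> w /=; rewrite in_itv /= andbT.
  apply: sigma_of_preimage => //; rewrite -[X in measurable X]setTI.
  exact: (measurable_clamp M measurableT).
have cn k w : `|e k w| <= M by rewrite clamp_norm // ltW.
apply: le_trans (@covariance_mixing R dO Omega P (sigma_of eps [set i])
  (sigma_of eps [set j]) (e i) (e j) M M (`|K0| * D `^ (- theta))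
  (sigma_of_measurable me) (sigma_of_measurable me) (bm_clamp _) (bm_clamp _)
  (cn i) (cn j) (lev i) (lev j) mix) _.
have h2 : D `^ (- theta) <= 2 `^ theta * (1 + D) `^ (- theta).
  have -> : D `^ (- theta) = 2 `^ theta * (2 * D) `^ (- theta).
    rewrite powRM // ?(le_trans ler01 D1') // mulrA -powRD ?subrr; last first.
      by rewrite pnatr_eq0 implybT.
    by rewrite powRr0 mul1r.
  apply: ler_wpM2l; first exact: powR_ge0.
  by apply: powRN_le => //; [lra|exact: ltW].
have c0 : 0 <= 4 * M * M * `|K0| by rewrite !mulr_ge0 // ltW.
apply: (@le_trans _ _ (4 * M * M * `|K0| * 2 `^ theta * (1 + D) `^ (- theta))).
  rewrite mulrA -(mulrA (4 * M * M * `|K0|) (2 `^ theta)); exact: ler_wpM2l.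
apply: ler_wpM2r; first exact: ltW.
rewrite /K lerDl; apply: mulr_ge0; last exact: powR_ge0.
by rewrite mulr_ge0 // ltW.
Qed.

(** The sum of the covariances off the diagonal is bounded by a constant, which
    [ln n >= ln 2] turns into a multiple of [ln n]; for [n = 1] it is empty. *)
Lemma covariance_row_sums : polynomially_mixing P eps theta ->
  (forall i, expect (e i) = 0) -> (forall i, expect (fun w => e i w * e i w) = sigma ^+ 2) ->
  exists2 c, 0 < c & forall n (i : 'I_(n ^ d)), (0 < n)%N ->
    \sum_(j < n ^ d) `|expect (fun w => e (grid_site i) w * e (grid_site j) w)| <=
      sigma ^+ 2 + c * ln n%:R.
Proof.
move=> mix E0 Es; have [K K0 hK] := covariance_decay mix.
pose B := (2 * (1 + (theta / d%:R - 1)^-1)) ^+ d.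
have dr : 0 < d%:R :> R by rewrite ltr0n.
have B0 : 0 < B.
  rewrite exprn_gt0 // mulr_gt0 // addr_gt0 // invr_gt0 subr_gt0.
  by rewrite ltr_pdivlMr // mul1r.
have l2 : 0 < ln 2 :> R by rewrite ln_gt0 // ltr1n.
exists (K * B / ln 2); first by rewrite divr_gt0 // mulr_gt0.
move=> n i n0; rewrite (bigD1 i) //= Es ger0_norm ?sqr_ge0 // lerD2l.
have [n1|n1] := leqP n 1.
  have nE : n = 1%N by apply/eqP; rewrite eqn_leq n1.
  rewrite big1.
    by rewrite nE ln1 mulr0.
  move=> j /eqP ji; exfalso; apply: ji; apply: val_inj => /=.
  have N1 : (n ^ d = 1)%N by rewrite nE exp1n.
  by have := ltn_ord i; have := ltn_ord j; rewrite [X in (_ < X)%N]N1; lia.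
apply: (@le_trans _ _ (K * B)).
  apply: le_trans (ler_wpM2l (ltW K0) (@sum_dist_site_decay R n d theta i n0 d0 htheta)).
  rewrite mulr_sumr [leRHS](bigD1 i) //= -[X in X <= _]add0r; apply: lerD.
    by rewrite mulr_ge0 ?powR_ge0 // ltW.
  apply: ler_sum => j _; have := hK (grid_site i) (grid_site j).
  by rewrite !E0 mul0r subr0.
have -> : K * B / ln 2 * ln n%:R = K * B * (ln n%:R / ln 2) by rewrite mulrAC -mulrA.
rewrite ler_peMr ?mulr_ge0 ?(ltW K0) ?(ltW B0) // ler_pdivlMr // mul1r.
by rewrite ler_ln ?posrE ?ltr0n // ler_nat.
Qed.
End ErrorCovariance.
(** * The trace for the smoothing parameter *)

Section SmoothingTrace.
Variable R : realType.

(** From [rho^(- 1 / s) < r + 1 <= 2 r]. *)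
Lemma truncn_powR_ge (rho s : R) : 0 < rho -> 0 < s ->
  let r := Num.truncn (rho `^ (- s^-1)) in (0 < r)%N ->
  rho^-1 <= 2 `^ s * r%:R `^ s.
Proof.
move=> rho0 s0 /=; set r := Num.truncn _ => r0.
have h : rho `^ (- s^-1) <= r.+1%:R by apply: ltW; exact: truncnS_gt.
have -> : rho^-1 = (rho `^ (- s^-1)) `^ s.
  by rewrite -powRrM mulNr mulVf ?gt_eqF // powR_inv1 // ltW.
rewrite -powRM //; apply: ge0_ler_powR; rewrite ?nnegrE ?powR_ge0 ?mulr_ge0 //.
  exact: ltW.
apply: le_trans h _; rewrite -natrM ler_nat; lia.
Qed.

(** The term [tail / (rho kappa)] is at most a multiple of
    [rho^-1 r^(- 2 q - 2 m)], that is of [r], by the choice of [r]. *)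
Lemma mxtrace_smoothing m p (M A : 'M[R]_p) (rho q C : R) lam :
  (0 < m)%N -> (0 < p)%N -> psdmx M -> psdmx A ->
  (forall u, qform A u = 0 -> u = 0) -> 0 < rho -> 0 < q -> 0 < C ->
  (forall r, (0 < r)%N -> (r <= p)%N ->
    exists l (CA : 'M[R]_(p, l)), (\rank CA <= m + r)%N /\
      forall u, u *m CA = 0 ->
        (r%:R / m.+1%:R) ^+ (2 * m) * qform 1%:M u <= qform A u) ->
  char_poly M = \prod_(l <- lam) ('X - l%:P) ->
  let r := Num.truncn (rho `^ (- (2 * m%:R + 2 * q + 1)^-1)) in
  \sum_(r <= j < p) lam`_j <= C * r%:R `^ (- (2 * q)) ->
  \tr (invmx (M + rho *: A) *m M) <=
    m%:R + r%:R * (2 + C * (m.+1%:R ^+ (2 * m) * 2 `^ (2 * m%:R + 2 * q + 1))).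
Proof.
move=> m0 p0 pM pA dA rho0 q0 C0 lowA cM /=; set s := 2 * m%:R + 2 * q + 1.
have s0 : 0 < s by rewrite !addr_gt0 ?mulr_gt0 ?ltr0n.
have := @truncn_powR_ge rho s rho0 s0; move=> /=.
set r := Num.truncn _ => hrho tail.
set K := m.+1%:R ^+ (2 * m) : R.
have K0 : 0 < K by rewrite exprn_gt0 // ltr0n.
have P20 : 0 < 2 `^ s :> R by rewrite powR_gt0.
(* if [r = 0], then [r `^ (- (2 * q)) = 0]: all of [M] has zero trace *)
have [r0|r0] := posnP r.
  have [eta eta0 etaA] := definite_coercive pA dA.
  apply: le_trans (@mxtrace_ridge_tail R p 1 M A rho lam 0 0 eta pM pA dA rho0 cM eta0
    (fun u _ => etaA u)) _.
  rewrite mxrank0 !add0r r0 mul0r addr0; move: tail; rewrite r0 => tail.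
  rewrite powR0 ?mulr0 in tail; last by rewrite oppr_eq0 mulf_neq0 ?gt_eqF.
  apply: (@le_trans _ _ 0); last by rewrite ler0n.
  by rewrite pmulr_rle0 // invr_gt0 mulr_gt0.
have rr : 0 < r%:R :> R by rewrite ltr0n.
(* if [r > p], the dimension alone bounds the trace *)
have [rp|pr] := leqP r p; last first.
  apply: le_trans (mxtrace_ridge_le_dim pM pA dA rho0) _.
  apply: (@le_trans _ _ r%:R); first by rewrite ler_nat ltnW.
  have m0r : 0 <= m%:R :> R by [].
  have : 0 <= r%:R * (1 + C * (K * 2 `^ s)) by rewrite mulr_ge0 // addr_ge0 // !mulr_ge0 // ltW.
  lra.
have [l [CA [rCA hCA]]] := lowA r r0 rp.
set kappa := (r%:R / m.+1%:R) ^+ (2 * m) in hCA.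
have k0 : 0 < kappa by rewrite exprn_gt0 // divr_gt0 // ltr0n.
apply: le_trans (@mxtrace_ridge_tail R p l M A rho lam r CA kappa pM pA dA rho0 cM k0 hCA) _.
have -> : m%:R + r%:R * (2 + C * (K * 2 `^ s)) =
    (m + r)%:R + r%:R + C * K * (2 `^ s * r%:R).
  by rewrite natrD; ring.
apply: lerD; first by rewrite lerD2r ler_nat.
apply: (@le_trans _ _ ((rho * kappa)^-1 * (C * r%:R `^ (- (2 * q))))).
  by rewrite ler_wpM2l // invr_ge0 ltW // mulr_gt0.
have -> : kappa = r%:R ^+ (2 * m) / K by rewrite /kappa exprMn exprVn.
have rm0 : 0 < r%:R ^+ (2 * m) :> R by rewrite exprn_gt0.
have rq0 : 0 < r%:R `^ (2 * q) :> R by rewrite powR_gt0.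
have rs : r%:R `^ s = r%:R ^+ (2 * m) * r%:R `^ (2 * q) * r%:R.
  rewrite /s !powRD ?(gt_eqF rr) ?implybT //; congr (_ * _ * _).
    by rewrite -powR_mulrn ?ltW // natrM.
  by rewrite powRr1 // ltW.
rewrite powRN invfM invf_div.
have -> : rho^-1 * (K / r%:R ^+ (2 * m)) * (C * (r%:R `^ (2 * q))^-1) =
    C * K * (rho^-1 / (r%:R ^+ (2 * m) * r%:R `^ (2 * q))).
  by field; rewrite !gt_eqF.
rewrite ler_pM2l ?mulr_gt0 // ler_pdivrMr ?mulr_gt0 //.
apply: le_trans (hrho r0) _; rewrite rs le_eqVlt; apply/orP; left; apply/eqP; ring.
Qed.

End SmoothingTrace.
(** * Random matrices *)

Section MeasurableMatrices.
Context (R : realType) (dT : measure_display) (T : measurableType dT).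

Definition mx_measurable a b (F : T -> 'M[R]_(a, b)) :=
  forall i j, measurable_fun setT (fun w => F w i j).

Lemma mx_measurable_cst a b (A : 'M[R]_(a, b)) : mx_measurable (fun=> A).
Proof. by move=> i j; exact: measurable_cst. Qed.

Lemma mx_measurableD a b (F H : T -> 'M[R]_(a, b)) :
  mx_measurable F -> mx_measurable H -> mx_measurable (fun w => F w + H w).
Proof.
move=> mF mH i j; under eq_fun do rewrite mxE.
exact: measurable_funD.
Qed.

Lemma mx_measurableZ a b (c : R) (F : T -> 'M[R]_(a, b)) :
  mx_measurable F -> mx_measurable (fun w => c *: F w).
Proof.
move=> mF i j; under eq_fun do rewrite mxE.
by apply: measurable_funM => //; exact: measurable_cst.
Qed.

Lemma mx_measurableT a b (F : T -> 'M[R]_(a, b)) :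
  mx_measurable F -> mx_measurable (fun w => (F w)^T).
Proof. by move=> mF i j; under eq_fun do rewrite mxE; exact: mF. Qed.

Lemma mx_measurableM a b c (F : T -> 'M[R]_(a, b)) (H : T -> 'M[R]_(b, c)) :
  mx_measurable F -> mx_measurable H -> mx_measurable (fun w => F w *m H w).
Proof.
move=> mF mH i j; under eq_fun do rewrite mxE.
by apply: measurable_sum => k; exact: measurable_funM.
Qed.

Lemma measurable_det n (F : T -> 'M[R]_n) : mx_measurable F ->
  measurable_fun setT (fun w => \det (F w)).
Proof.
move=> mF; rewrite /determinant; apply: measurable_sum => s.
apply: measurable_funM; first exact: measurable_cst.
by apply: measurable_prod => i _; exact: mF.
Qed.

Lemma mx_measurable_adj n (F : T -> 'M[R]_n) : mx_measurable F ->
  mx_measurable (fun w => \adj (F w)).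
Proof.
move=> mF i j; under eq_fun do rewrite mxE /cofactor.
apply: measurable_funM; first exact: measurable_cst.
by apply: measurable_det => k l; under eq_fun do rewrite !mxE; exact: mF.
Qed.

Lemma mx_measurable_inv n (F : T -> 'M[R]_n) : mx_measurable F ->
  (forall w, F w \in unitmx) -> mx_measurable (fun w => invmx (F w)).
Proof.
move=> mF uF i j; under eq_fun do rewrite /invmx uF mxE.
apply: measurable_funM; last exact: mx_measurable_adj.
have mV : measurable_fun [set x : R | x != 0] (@GRing.inv R).
  apply: open_continuous_measurable_fun; first exact: open_neq.
  by move=> x; rewrite inE => x0; apply: inv_continuous.
apply: (measurable_comp _ _ mV (measurable_det mF)).
- by apply: open_measurable; exact: open_neq.
- by move=> _ [w _ <-] /=; rewrite -unitfE -unitmxE.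
Qed.

End MeasurableMatrices.
(** * Inner products of the predictors with the slope function *)

Section FunctionalPredictors.
Variable R : realType.
Implicit Types f g x : R -> R.
Local Notation mu := (@lebesgue_measure R).

Lemma deriv_on01_continuous f g : deriv_on01 f g -> {within `[0, 1], continuous f}.
Proof.
move=> df; apply/subspace_continuousP => t It.
apply/cvgrPdist_lt => e e0.
have h : \forall s \near t, s != t -> I01 s ->
    `|g t - (f s - f t) / (s - t)| < 1.
  by have /cvgrPdist_lt/(_ 1 ltr01) := df t It.
pose L := `|g t| + 1; have L0 : 0 < L by rewrite ltr_wpDl.
have n2 : \forall s \near t, `|t - s| < e / L.
  by apply: (nbhsx_ballx t); rewrite divr_gt0.
suff : \forall s \near t, I01 s -> `|f t - f s| < e by [].
apply: filterS2 n2 h => s hs q1 Is.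
have [->|st] := eqVneq s t; first by rewrite subrr normr0.
have {}q1 := q1 st Is.
have st0 : s - t != 0 by rewrite subr_eq0.
have qL : `|(f s - f t) / (s - t)| <= L.
  have := ler_normB (g t) (g t - (f s - f t) / (s - t)).
  by rewrite opprB addrC subrK => /le_trans; apply; rewrite lerD2l ltW.
rewrite distrC -(divfK st0 (f s - f t)) normrM -(distrC t s).
apply: (@le_lt_trans _ _ (L * `|t - s|)); first by rewrite ler_wpM2r.
by rewrite mulrC -ltr_pdivlMr.
Qed.

Lemma continuous_inL2 f : {within `[0, 1], continuous f} -> inL2 f.
Proof.
move=> cf.
have mI : measurable (@I01 R) by exact: measurable_itv.
have mf : measurable_fun (@I01 R) f by exact: subspace_continuous_measurable_fun.
have mfr : measurable_fun setT (f \_ (@I01 R)).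
  by apply/measurable_restrict => //; rewrite setTI.
have [c _ cmax] := EVT_max ler01 cf.
have [c' _ cmin] := EVT_min ler01 cf.
pose B := `|f c| + `|f c'|.
have fB t : I01 t -> `|f t| <= B.
  move=> It; have h1 := cmax t It; have h2 := cmin t It.
  rewrite ler_norml /B; have := ler_norm (f c); have := ler_norm (- f c').
  rewrite normrN => n1 n2; have n3 := normr_ge0 (f c); have n4 := normr_ge0 (f c').
  by apply/andP; split; lra.
apply/andP; split; first by rewrite inE.
rewrite inE /finite_norm unlock /=; apply: poweR_lty.
have -> : (fun t => `|(EFin \o f \_ (@I01 R)) t| `^ 2)%E =
    ((fun t => (`|f t| `^ 2)%:E) \_ (@I01 R)).
  apply/funext => t; rewrite !patchE /= patchE; case: ifP => _ /=.
    by [].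
  rewrite -[X in `|X|]/(0 : R) normr0 powR0 //.
rewrite -integral_mkcond.
apply: (@le_lt_trans _ _ (\int[mu]_(t in @I01 R) ((B `^ 2)%:E))%E).
  apply: ge0_le_integral => //.
  - apply/measurable_EFinP; apply: (measurableT_comp (f := fun y => y `^ 2)); first exact: measurable_powR.
    exact: measurableT_comp.
  - move=> t It; rewrite lee_fin ge0_ler_powR ?nnegrE // ?fB //.
    by rewrite addr_ge0.
rewrite integral_cst // [X in (_ * X)%E](_ : _ = 1%E) ?mule1 ?ltry //.
have := @lebesgue_measure_itv R `[0, 1]; rewrite /= lte01 => ->.
by rewrite oppr0 adde0.
Qed.

Lemma innerL2C x f : innerL2 x f = innerL2 f x.
Proof. by apply: eq_Rintegral => t _; exact: mulrC. Qed.

Lemma innerL2_le x f M : inL2 x -> inL2 f -> (normL2 x < M%:E)%E -> 0 < M ->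
  `|innerL2 x f| <= M * fine (normL2 f).
Proof.
move=> /andP[]; rewrite inE => mx _ /andP[]; rewrite inE => mf.
rewrite inE /finite_norm => nf nx M0.
have nfE : (fine (normL2 f))%:E = normL2 f.
  by apply: fineK; rewrite ge0_fin_numE // /normL2; exact: Lnorm_ge0.
have CS : (\int[mu]_(t in @I01 R) `|(x t * f t)%:E| <= (M * fine (normL2 f))%:E)%E.
  have := @hoelder _ _ _ mu (x \_ (@I01 R)) (f \_ (@I01 R)) 2 2 mx mf.
  have half : (2 : R)^-1 + 2^-1 = 1 by lra.
  move=> /(_ (ltr0n _ 2) (ltr0n _ 2) half) H.
  apply: (@le_trans _ _ (normL2 x * normL2 f)%E); last first.
    by rewrite EFinM nfE; apply: lee_wpmul2r; [exact: Lnorm_ge0|exact: ltW].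
  apply: le_trans H; rewrite Lnorm1 le_eqVlt; apply/orP; left; apply/eqP.
  rewrite [LHS]integral_mkcond; apply: eq_integral => t _.
  rewrite patchE /= !patchE; case: ifP => _ //.
  by rewrite -[X in X * _]/(0 : R) mul0r /= normr0.
have mxf : measurable_fun (@I01 R) (fun t => x t * f t).
  have mI : measurable (@I01 R) by exact: measurable_itv.
  have r2 g : measurable_fun setT (g \_ (@I01 R)) -> measurable_fun (@I01 R) g.
    by move=> /(measurable_restrict g mI measurableT).2; rewrite setTI.
  by apply: measurable_funM; exact: r2.
have h : (`| \int[mu]_(t in @I01 R) (x t * f t)%:E | <= (M * fine (normL2 f))%:E)%E.
  apply: le_trans CS; apply: le_abse_integral; first exact: measurable_itv.
  exact/measurable_EFinP.
rewrite /innerL2 /Rintegral; move: h; by case: (\int[mu]_(t in _) _)%E.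
Qed.

Lemma measurable_eval t : @I01 R t ->
  measurable_fun setT (fun x : ranfun R => x t).
Proof.
move=> It _ B mB; rewrite setTI; apply: sub_gen_smallest; left.
by exists t, B.
Qed.

Lemma measurable_innerL2 f : inL2 f ->
  measurable_fun setT (fun x : ranfun R => innerL2 f x).
Proof.
move=> Lf _ B mB; rewrite setTI; apply: sub_gen_smallest; right.
exists f, B; split=> //; apply/seteqP; split=> x /=; by rewrite innerL2C.
Qed.

Lemma nderiv_inL2 m f g : (0 < m)%N -> nderiv_on01 m f g -> inL2 f.
Proof.
case: m => // m _ /= [f1 df _]; apply: continuous_inL2.
exact: deriv_on01_continuous df.
Qed.

End FunctionalPredictors.
(** * Conditional variance of the estimator *)

Lemma scaling_constant (R : realType) a b : (0 < a)%N -> (0 < b)%N ->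
  b%:R^-1 * (a%:R^-1 / a%:R / (a * b)%:R) = (a ^ 3 * b ^ 2)%:R^-1 :> R.
Proof.
move=> a0 b0; rewrite !natrM; field.
by rewrite !pnatr_eq0 -!lt0n a0 b0.
Qed.

Section ConditionalVariance.
Context (R : realType) (dO : measure_display) (Omega : measurableType dO).
Variable P : probability Omega R.
Variables (d n p : nat) (X : 'rV[int]_d -> {RV P >-> ranfun R}).
Variables (Y eps : 'rV[int]_d -> {RV P >-> R}) (A : 'M[R]_p) (rho M : R).
Variables (beta : R -> R) (beta0 Bm : R).
Hypotheses (n0 : (0 < n)%N) (p0 : (0 < p)%N) (rho0 : 0 < rho) (M0 : 0 < M).
Hypotheses (pA : psdmx A) (dA : forall u, qform A u = 0 -> u = 0).
Hypothesis Lbeta : inL2 beta.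
Hypothesis hY : forall i w, Y i w = beta0 + innerL2 beta (X i w) + eps i w.
Hypothesis heps : forall i, {ae P, forall w, eps i w = clamp M (eps i w)}.
Hypothesis Bm0 : 0 <= Bm.
Hypothesis hBm : forall i, {ae P, forall w, `|innerL2 beta (X i w)| <= Bm}.
Hypothesis indep : indep_sigma P (sigma_of eps setT) (sigma_of X setT).
Local Notation expect := (expect P).
Local Notation bm := (@bounded_measurable R dO Omega).
Hypothesis eps_mean0 : forall i, expect (fun w => clamp M (eps i w)) = 0.

Local Notation site := (@grid_site d n).
Let Gen : set (set Omega) :=
  \bigcup_(i in range site) g_sigma_algebra_preimage (X i).
Local Notation G := (sigma_of X (range site)).
Local Notation T' := (g_sigma_algebraType Gen).
Local Notation Xm := (Xmx X n p).
Let N := (n ^ d)%N.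
Let e (i : 'I_N) w := clamp M (eps (site i) w).
Let S w := gram X n p w + rho *: A.
Let H w : 'M[R]_(p, N) := invmx (S w) *m (Xm w)^T.
Let K w : 'M[R]_N := Xm w *m H w.
Let B w : 'M[R]_N := ((N ^ 3 * p ^ 2)%:R)^-1 *: ((K w)^T *m K w).
Let Sig : 'M[R]_N := \matrix_(i, k) expect (fun w => e i w * e k w).

Let N0 : (0 < N)%N. Proof. by rewrite expn_gt0 n0. Qed.

Let Gen_measurable : Gen `<=` measurable.
Proof. by apply: sigma_gen_measurable => i; exact: measurable_funPT. Qed.

Let Xm_measurable : @mx_measurable R _ T' _ _ Xm.
Proof.
have mX (i : 'I_N) t : @I01 R t -> measurable_fun setT ((fun w => X (site i) w t) : T' -> R).
  move=> It; apply: (@sigma_of_measurable_fun _ _ _ _ _ X (range site) (site i) _ _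
    (fun x : ranfun R => x t)); last exact: measurable_eval.
  by exists i.
move=> i j; under eq_fun do rewrite mxE.
have It : @I01 R (design_pt R p j.+1).
  rewrite /I01 /= in_itv /= /design_pt divr_ge0 //=.
  by rewrite ler_pdivrMr ?ltr0n // mul1r ler_nat.
apply: measurable_funB; first exact: mX.
apply: measurable_funM; first exact: measurable_cst.
by apply: measurable_sum => k; exact: mX.
Qed.

Let S_unit w : S w \in unitmx.
Proof.
apply: definite_unitmx; apply: definite_ridge => //.
by apply: psdmxZ; [rewrite invr_ge0|exact: psdmx_gram].
Qed.

Let H_measurable : @mx_measurable R _ T' _ _ H.
Proof.
apply: mx_measurableM; last exact: mx_measurableT.
apply: mx_measurable_inv => //; apply: mx_measurableD; last exact: mx_measurable_cst.
by apply: mx_measurableZ; apply: mx_measurableM => //; exact: mx_measurableT.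
Qed.

Let K_measurable : @mx_measurable R _ T' _ _ K.
Proof. exact: mx_measurableM. Qed.

Let HK_bounded : exists L, forall w,
  (forall i j, `|H w i j| <= L) /\ (forall i j, `|K w i j| <= L).
Proof.
have c0 : 0 < (N * p)%:R :> R by rewrite ltr0n muln_gt0 N0.
have [L _ hL] := @ridge_entries_bounded R p N A rho _ pA dA rho0 c0.
by exists L => w; exact: hL.
Qed.

Let bmH i j : bm (fun w => H w i j).
Proof.
split; first by apply: (sub_measurable_fun Gen_measurable); exact: H_measurable.
by have [L hL] := HK_bounded; exists L => w; have [h _] := hL w.
Qed.

Let bmK i j : bm (fun w => K w i j).
Proof.
split; first by apply: (sub_measurable_fun Gen_measurable); exact: K_measurable.
by have [L hL] := HK_bounded; exists L => w; have [_ h] := hL w.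
Qed.

Let bme i : bm (e i). Proof. exact: bm_clamp. Qed.

(** Independence is the case of a zero mixing coefficient. *)
Let expect_indep (U V : Omega -> R) : bm U -> bm V ->
  measurable_fun setT (U : T' -> R) ->
  measurable_fun setT (V : g_sigma_algebraType
    (\bigcup_(i in setT) g_sigma_algebra_preimage (eps i)) -> R) ->
  expect (fun w => U w * V w) = expect U * expect V.
Proof.
move=> bU bV mU mV; have [KU hU] := bU.2; have [KV hV] := bV.2.
have mX i : measurable_fun setT (X i) by exact: measurable_funPT.
have me i : measurable_fun setT (eps i) by exact: measurable_funPT.
have := @covariance_mixing R dO Omega P (sigma_of eps setT) (sigma_of X setT) V U KV KU 0
  (sigma_of_measurable me) (sigma_of_measurable mX) bV bU hV hU.
rewrite mulr0 => h.
have : `|expect (fun w => V w * U w) - expect V * expect U| <= 0.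
  apply: h.
  - by move=> s; exact: (sub_level_set (Gen := _) s mV).
  - move=> s; apply: (@sigma_of_mono _ _ _ _ _ X (range site) setT) => //.
    exact: (sub_level_set (Gen := Gen) s mU).
  - move=> C D hC hD; rewrite indep // subee ?abse0 //.
    have mC : measurable C := sigma_of_measurable me hC.
    have mD : measurable D := sigma_of_measurable mX hD.
    by rewrite fin_numM // fin_num_measure.
rewrite normr_le0 subr_eq0 => /eqP h2.
by rewrite mulrC -h2; congr expect; apply/funext => w; exact: mulrC.
Qed.

Let e_measurable i : measurable_fun setT (e i : g_sigma_algebraType
    (\bigcup_(i in setT) g_sigma_algebra_preimage (eps i)) -> R).
Proof.
apply: (@sigma_of_measurable_fun _ _ _ _ _ eps setT (site i) _ _ (@clamp R M)) => //.
exact: measurable_clamp.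
Qed.

(** The columns of the centred data matrix sum to zero, so that centring the
    responses has no effect. *)
Let beta_hatE w : beta_hat X Y n A rho w =
  (N%:R)^-1 *: (H w *m \col_i Y (site i) w).
Proof.
rewrite /beta_hat -/(S w) -/(H w) -/N; congr (_ *: _).
have -> : Yvec Y n w = \col_i Y (site i) w -
    const_mx (N%:R^-1 * \sum_(k < N) Y (site k) w).
  by apply/colP => i; rewrite !mxE.
rewrite mulmxBr [X in _ - X](_ : _ = 0) ?subr0 // /H -mulmxA.
rewrite [X in _ *m X](_ : _ = 0) ?mulmx0 //.
have Nn0 : N%:R != 0 :> R by rewrite pnatr_eq0 -lt0n.
have col0 j : \sum_i Xm w i j = 0.
  under eq_bigr do rewrite mxE.
  rewrite sumrB sumr_const card_ord -[X in _ - X]mulr_natl mulrA divff //.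
  by rewrite mul1r subrr.
apply/colP => j; rewrite [RHS]mxE mxE; under eq_bigr do rewrite mxE [const_mx _ _ _]mxE.
by rewrite -mulr_suml col0 mul0r.
Qed.

(* Truncation makes the predictable part of the responses bounded everywhere. *)
Let m (i : 'I_N) w := clamp Bm (innerL2 beta (X (site i) w)).

Let m_measurable i : measurable_fun setT (m i : T' -> R).
Proof.
apply: (@sigma_of_measurable_fun _ _ _ _ _ X (range site) (site i) _ _
    (fun x : ranfun R => clamp Bm (innerL2 beta x))); first by exists i.
apply: (measurableT_comp (measurable_clamp Bm)); exact: measurable_innerL2.
Qed.

Let bmm i : bm (m i).
Proof.
split; first by apply: (sub_measurable_fun Gen_measurable); exact: m_measurable.
by exists Bm => w; exact: clamp_norm.
Qed.

Let g j w := (N%:R)^-1 * \sum_i H w j i * (beta0 + m i w).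

Let beta_hat_cond_exp j :
  {ae P, forall w, cond_exp P G (fun v => beta_hat X Y n A rho v j 0) w = g j w} /\
  measurable_fun setT (cond_exp P G (fun v => beta_hat X Y n A rho v j 0)).
Proof.
pose f' w := g j w + (N%:R)^-1 * \sum_i H w j i * e i w.
have bhE w : beta_hat X Y n A rho w j 0 = N%:R^-1 * \sum_i H w j i * Y (site i) w.
  by rewrite beta_hatE mxE mxE; congr (_ * _); apply: eq_bigr => i _;
     rewrite [X in _ * X]mxE.
have bm0 i : bm (fun w => beta0 + m i w) by apply: bmD; [exact: bm_cst|exact: bmm].
have bHm i : bm (fun w => H w j i * (beta0 + m i w)).
  by apply: bmM; [exact: bmH|exact: bm0].
have bg : bm (g j) by apply: bmM; [exact: bm_cst|exact: bm_sum].
have bHe i : bm (fun w => H w j i * e i w) by exact: bmM.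
have bs : bm (fun w => \sum_i H w j i * e i w) by exact: bm_sum.
have bNs : bm (fun w => N%:R^-1 * \sum_i H w j i * e i w).
  by apply: bmM => //; exact: bm_cst.
apply: (@cond_expE R dO Omega P Gen Gen_measurable _ f' (g j)) => //.
- under eq_fun do rewrite bhE; apply: measurable_funM; first exact: measurable_cst.
  apply: measurable_sum => i; apply: measurable_funM; first by case: (bmH j i).
  exact: measurable_funPT.
- exact: bmD.
- have ae : {ae P, forall w, forall i : 'I_N, eps (site i) w = e i w /\
      `|innerL2 beta (X (site i) w)| <= Bm}.
    apply: filter_forall => i; apply: filterS2 (heps (site i)) (hBm (site i)).
    by move=> w h1 h2.
  apply: filterS ae => w h; rewrite bhE /f' /g -mulrDr -big_split /=; congr (_ * _).
  apply: eq_bigr => i _; have [h1 h2] := h i.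
  by rewrite -mulrDr hY h1 /m clamp_id.
- apply: measurable_funM; first exact: measurable_cst.
  apply: measurable_sum => i; apply: measurable_funM; first exact: H_measurable.
  by apply: measurable_funD; [exact: measurable_cst|exact: m_measurable].
move=> C GC; have mC : measurable C := sub_sigma_measurable Gen_measurable GC.
have bC : bm \1_C by exact: bm_indic.
have -> : (fun w => f' w * \1_C w) = (fun w => g j w * \1_C w +
    N%:R^-1 * \sum_i (H w j i * \1_C w) * e i w).
  apply/funext => w; rewrite /f' mulrDl; congr (_ + _); rewrite -mulrA mulr_suml.
  by congr (_ * _); apply: eq_bigr => i _; rewrite mulrAC.
have bHC i : bm (fun w => H w j i * \1_C w) by exact: bmM.
have bHCe i : bm (fun w => H w j i * \1_C w * e i w) by exact: bmM.
have bS : bm (fun w => \sum_i (H w j i * \1_C w) * e i w) by exact: bm_sum.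
rewrite expectD; [|exact: bmM|by apply: bmM => //; exact: bm_cst].
rewrite expectZ // expect_sum // big1 ?mulr0 ?addr0 // => i _.
rewrite (expect_indep (U := fun w => H w j i * \1_C w)) //.
  by rewrite eps_mean0 mulr0.
apply: measurable_funM; first exact: H_measurable.
by apply: measurable_indic; exact: GC.
Qed.

(** Almost surely the squared semi-norm is [eps^T B eps]; since [B] is a function
    of the predictors, independence replaces each product [eps_i eps_k] by its
    expectation. *)
Lemma conditional_variance :
  let bhat := beta_hat X Y n A rho in
  let Ebhat := fun w => \col_(j < p) cond_exp P G (fun v => bhat v j 0) w in
  {ae P, forall w, cond_exp P G (fun v => sqnorm_Gamma X n v (bhat v - Ebhat v)) w =
    \tr (B w *m Sig)}.
Proof.
move=> bhat Ebhat.
pose F' w := \sum_i \sum_k B w i k * (e i w * e k w).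
pose g2 w := \sum_i \sum_k B w i k * Sig i k.
have B_measurable : @mx_measurable R _ T' _ _ B.
  apply: mx_measurableZ; apply: mx_measurableM; last exact: K_measurable.
  exact: mx_measurableT.
have bmB i k : bm (fun w => B w i k).
  under eq_fun do rewrite mxE; apply: bmM; first exact: bm_cst.
  under eq_fun do rewrite mxE; apply: bm_sum => l; apply: bmM => //.
  under eq_fun do rewrite mxE; exact: bmK.
have bee i k : bm (fun w => e i w * e k w) by exact: bmM.
have bF' : bm F' by apply: bm_sum => i; apply: bm_sum => k; exact: bmM.
have bg2 : bm g2.
  by apply: bm_sum => i; apply: bm_sum => k; apply: bmM => //; exact: bm_cst.
have g2E w : g2 w = \tr (B w *m Sig).
  rewrite /mxtrace; apply: eq_bigr => i _; rewrite mxE; apply: eq_bigr => k _.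
  by rewrite !mxE; congr (_ * expect _); apply/funext => v; exact: mulrC.
have aeF : {ae P, forall w, sqnorm_Gamma X n w (bhat w - Ebhat w) = F' w}.
  have ae1 : {ae P, forall w, forall j : 'I_p, Ebhat w j 0 = g j w}.
    apply: filter_forall => j; have [ae _] := beta_hat_cond_exp j.
    by apply: filterS ae => w h; rewrite mxE.
  have ae2 : {ae P, forall w, forall i : 'I_N, eps (site i) w = e i w /\
      `|innerL2 beta (X (site i) w)| <= Bm}.
    apply: filter_forall => i; apply: filterS2 (heps (site i)) (hBm (site i)).
    by move=> w h1 h2.
  apply: filterS2 ae1 ae2 => w h1 h2.
  have -> : bhat w - Ebhat w = N%:R^-1 *: (H w *m \col_i e i w).
    apply/colP => j; rewrite mxE [X in _ + X]mxE h1 /bhat beta_hatE !mxE /g -mulrBr.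
    congr (_ * _); rewrite -sumrB; apply: eq_bigr => i _; have [h3 h4] := h2 i.
    by rewrite !mxE -mulrBr hY h3 /m clamp_id // addrC addKr.
  have -> : F' w = qform (B w) (\row_i e i w).
    rewrite qformE; apply: eq_bigr => i _; apply: eq_bigr => k _.
    by rewrite !mxE; ring.
  rewrite /sqnorm_Gamma /gram /B -/N qformZ /qform.
  have -> : (\row_i e i w)^T = \col_i e i w by apply/colP => i; rewrite !mxE.
  have -> : \row_i e i w = (\col_i e i w)^T by apply/rowP => i; rewrite !mxE.
  set u := H w *m \col_i e i w.
  have -> : (\col_i e i w)^T *m ((K w)^T *m K w) *m \col_i e i w =
      u^T *m ((Xm w)^T *m Xm w) *m u.
    by rewrite /u /K !trmx_mul !mulmxA.
  have -> : (N%:R^-1 *: u)^T = N%:R^-1 *: u^T by rewrite linearZ.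
  rewrite -!(scalemxAl, scalemxAr) !scalerA [X in _ * X = _]mxE mulrA.
  congr (_ * _); exact: scaling_constant.
have mF : measurable_fun setT (fun v => sqnorm_Gamma X n v (bhat v - Ebhat v)).
  have mbh : mx_measurable bhat.
    move=> j k; rewrite ord1; under eq_fun do rewrite /bhat beta_hatE !mxE.
    apply: measurable_funM; first exact: measurable_cst.
    apply: measurable_sum => i; apply: measurable_funM; first by case: (bmH j i).
    under eq_fun do rewrite mxE; exact: measurable_funPT.
  have mE : mx_measurable Ebhat.
    move=> j k; rewrite ord1; under eq_fun do rewrite mxE.
    by have [_ h] := beta_hat_cond_exp j.
  have mX : mx_measurable Xm.
    by move=> i j; apply: (sub_measurable_fun Gen_measurable); exact: Xm_measurable.
  have mu : mx_measurable (fun v => bhat v - Ebhat v).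
    move=> j k; under eq_fun do rewrite mxE [X in _ + X]mxE.
    by apply: measurable_funB.
  apply: measurable_funM; first exact: measurable_cst.
  apply: mx_measurableM => //; apply: mx_measurableM; first exact: mx_measurableT.
  apply: mx_measurableZ; apply: mx_measurableM => //; exact: mx_measurableT.
have [ae _] : {ae P, forall w, cond_exp P G
      (fun v => sqnorm_Gamma X n v (bhat v - Ebhat v)) w = g2 w} /\
    measurable_fun setT (cond_exp P G
      (fun v => sqnorm_Gamma X n v (bhat v - Ebhat v))); last first.
  by apply: filterS ae => w ->.
apply: (@cond_expE R dO Omega P Gen Gen_measurable _ F' g2) => //.
  apply: measurable_sum => i; apply: measurable_sum => k.
  by apply: measurable_funM; [exact: B_measurable|exact: measurable_cst].
move=> C GC; have mC : measurable C := sub_sigma_measurable Gen_measurable GC.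
have bC : bm \1_C by exact: bm_indic.
have bBC i k : bm (fun w => B w i k * \1_C w) by exact: bmM.
have -> : (fun w => g2 w * \1_C w) =
    (fun w => \sum_i \sum_k Sig i k * (B w i k * \1_C w)).
  apply/funext => w; rewrite /g2 mulr_suml; apply: eq_bigr => i _.
  by rewrite mulr_suml; apply: eq_bigr => k _; rewrite mulrAC mulrC.
have -> : (fun w => F' w * \1_C w) =
    (fun w => \sum_i \sum_k (B w i k * \1_C w) * (e i w * e k w)).
  apply/funext => w; rewrite /F' mulr_suml; apply: eq_bigr => i _.
  by rewrite mulr_suml; apply: eq_bigr => k _; rewrite mulrAC.
have bt1 i k : bm (fun w => Sig i k * (B w i k * \1_C w)).
  by apply: bmM => //; exact: bm_cst.
have bt2 i k : bm (fun w => (B w i k * \1_C w) * (e i w * e k w)) by exact: bmM.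
rewrite !expect_sum => [|i|i]; [|exact: bm_sum..].
apply: eq_bigr => i _; rewrite !expect_sum //; apply: eq_bigr => k _.
rewrite expectZ // (expect_indep (U := fun w => B w i k * \1_C w)) //.
- by rewrite mxE mulrC.
- apply: measurable_funM; first exact: B_measurable.
  by apply: measurable_indic; exact: GC.
- exact: measurable_funM.
Qed.

End ConditionalVariance.
(** * The variance bound *)

Lemma mxtrace_hat_sqr (R : rcfType) N p (X : 'M[R]_(N, p)) (V : 'M[R]_p) (c : R) :
  c != 0 -> V^T = V -> let M := c^-1 *: (X^T *m X) in
  let K := X *m (V *m X^T) in
  \tr (K^T *m K) = c ^+ 2 * \tr (V *m M *m V *m M).
Proof.
move=> c0 sV /=.
rewrite !trmx_mul trmxK sV -!(scalemxAl, scalemxAr) scalerA linearZ /=.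
rewrite mulrA [X in X * _](_ : _ = 1) ?mul1r; last by field.
by rewrite -!mulmxA mxtrace_mulC -!mulmxA.
Qed.

Theorem theorem1
  (R : realType) (dO : measure_display) (Omega : measurableType dO)
  (P : probability Omega R)
  (d m : nat) (hd : (1 <= d)%N) (hm : (1 <= m)%N)
  (X : 'rV[int]_d -> {RV P >-> ranfun R})
  (Y eps : 'rV[int]_d -> {RV P >-> R})
  (beta0 : R) (beta betam : R -> R) (sigma M1 M2 theta : R)
  (hX : forall i w, inL2 (X i w))
  (hY : forall i w, Y i w = beta0 + innerL2 beta (X i w) + eps i w)
  (heps0 : forall i, ('E_P[eps i] = 0)%E)
  (hsigma : 0 < sigma)
  (hepsV : forall i, ('V_P[eps i] = (sigma ^+ 2)%:E)%E)
  (hbeta : nderiv_on01 m beta betam)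
  (hbetam : inL2 betam)
  (heps_stat : strictly_stationary P eps)
  (heps_indep : indep_sigma P (sigma_of eps setT) (sigma_of X setT))
  (hM1 : 0 < M1)
  (heps_bounded : {ae P, forall w,
     (ereal_sup [set `|eps i w|%:E | i in setT] < M1%:E)%E})
  (hXY_stat : strictly_stationary P (fun i w => (X i w, Y i w)))
  (hM2 : 0 < M2)
  (hX_bounded : forall i, {ae P, forall w, (normL2 (X i w) < M2%:E)%E})
  (htheta : d%:R < theta)
  (heps_mix : polynomially_mixing P eps theta)
  (hXY_mix : polynomially_mixing P (fun i w => (X i w, Y i w)) theta) :
  exists c : R, 0 < c /\
  forall q : R, 0 < q ->
  exists C0 : R, 0 < C0 /\
  forall (n p : nat) (rho C : R) (D : 'I_p -> R -> R) (Pm : 'M[R]_p),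
    (1 <= n)%N -> (1 <= p)%N -> n%:R ^- (2 * m * d) < rho -> 0 < C ->
    is_basis (natural_spline m p) D ->
    is_orth_proj (poly_vectors R m p) Pm ->
    let A := penalty_mx m Pm D in
    let r := Num.truncn (rho `^ (- (2 * m%:R + 2 * q + 1)^-1)) in
    let G := sigma_of X (range (@grid_site d n)) in
    let bhat := beta_hat X Y n A rho in
    let Ebhat := fun w => \col_(j < p) cond_exp P G (fun v => bhat v j 0) w in
    {ae P, forall w, forall lam : seq R,
      ordered_eigenvalues (gram X n p w) lam ->
      \sum_(r <= j < p) lam`_j <= C * r%:R `^ (- (2 * q)) ->
      cond_exp P G (fun v => sqnorm_Gamma X n v (bhat v - Ebhat v)) w <=
      (sigma ^+ 2 / (n ^ d)%:R + c * ln n%:R / (n ^ d)%:R)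
        * (m%:R + r%:R * (2 + C * C0))}.

Proof.
have Lbeta : inL2 beta := nderiv_inL2 hm hbeta.
have heps i := ae_clamp i heps_bounded.
have E0 i := expect_clamp hM1 (heps i) (heps0 i).
have Es i := expect_clamp_sqr hM1 (heps i) (heps0 i) (hepsV i).
have [c c0 hc] := covariance_row_sums hd hM1 htheta heps_mix E0 Es.
exists c; split=> // q q0.
exists (m.+1%:R ^+ (2 * m) * 2 `^ (2 * m%:R + 2 * q + 1)); split.
  by rewrite mulr_gt0 ?powR_gt0 // exprn_gt0 // ltr0n.
move=> n p rho C D Pm n0 p0 nrho C0 bD hP A r G bhat Ebhat.
have rho0 : 0 < rho.
  by apply: lt_trans nrho; rewrite invr_gt0 exprn_gt0 // ltr0n.
have pA : psdmx A := penalty_psdmx hm p0 bD hP.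
have dA u : qform A u = 0 -> u = 0 by exact: (penalty_definite hm p0 bD hP).
pose Bm := M2 * fine (normL2 beta).
have Bm0 : 0 <= Bm.
  by apply: mulr_ge0; [exact: ltW|apply: fine_ge0; exact: Lnorm_ge0].
have hBm i : {ae P, forall w, `|innerL2 beta (X i w)| <= Bm}.
  apply: filterS (hX_bounded i) => w nX; rewrite innerL2C.
  exact: innerL2_le (hX i w) Lbeta nX hM2.
have := @conditional_variance R dO Omega P d n p X Y eps A rho M1 beta beta0 Bm
  n0 p0 rho0 hM1 pA dA Lbeta hY heps Bm0 hBm heps_indep E0.
apply: filterS => w; rewrite -/G -/bhat -/Ebhat => -> lam [_ cM] tail.
set N := (n ^ d)%N.
have N0 : (0 < N)%N by rewrite expn_gt0 n0.
have Nr : 0 < N%:R :> R by rewrite ltr0n.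
have pr : 0 < p%:R :> R by rewrite ltr0n.
have pM : psdmx (gram X n p w).
  by apply: psdmxZ; [rewrite invr_ge0|exact: psdmx_gram].
have T1 := mxtrace_smoothing hm p0 pM pA dA rho0 q0 C0
  (penalty_lower_bound hm p0 bD hP) cM tail.
have T2 := mxtrace_ridge pM pA dA rho0.
set V := invmx (gram X n p w + rho *: A).
have sV : V^T = V.
  by rewrite trmx_inv linearD /= (proj1 pM) linearZ /= (proj1 pA).
set Sig := (X in _ *m X).
set K := Xmx X n p w *m (V *m (Xmx X n p w)^T).
have pB : psdmx ((N ^ 3 * p ^ 2)%:R^-1 *: (K^T *m K)).
  by apply: psdmxZ; [rewrite invr_ge0|exact: psdmx_gram].
have sSig : Sig^T = Sig.
  by apply/matrixP => i k; rewrite !mxE; congr expect; apply/funext => v; exact: mulrC.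
have rS i : \sum_j `|Sig i j| <= sigma ^+ 2 + c * ln n%:R.
  by under eq_bigr do rewrite mxE; exact: hc.
apply: le_trans (mxtrace_row_sum_le pB sSig rS) _.
have s0 : 0 <= sigma ^+ 2 + c * ln n%:R.
  by rewrite addr_ge0 ?sqr_ge0 // mulr_ge0 ?(ltW c0) // ln_ge0 // ler1n.
rewrite -mulrDl -mulrA; apply: ler_wpM2l => //.
have cn0 : (N * p)%:R != 0 :> R by rewrite pnatr_eq0 -lt0n muln_gt0 N0.
rewrite linearZ /= (mxtrace_hat_sqr _ cn0 sV) mulrA.
rewrite [X in X * _](_ : _ = N%:R^-1); last first.
  by rewrite !natrM; field; rewrite !pnatr_eq0 -!lt0n N0 p0.
rewrite ler_pM2l ?invr_gt0 //; exact: le_trans T2 T1.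
Qed.
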